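(* Let $A\subset\mathbb{R}^n$ be a locally closed definable set and $f:A\to\mathbb{R}^k$ a definable inner Lipschitz mapping. Let $\varepsilon:A\to(0,+\infty)$ be a continuous definable function and let $\mu>0$. Then there exists a definable $\mathscr{C}^1$ inner Lipschitz mapping $g:A\to\mathbb{R}^k$ such that for all $x\in A$: (i) $|f(x)-g(x)|<\varepsilon(x)$, (ii) $|d_xg|\le\mathring{L}_f(x)+\mu$.
   Context: An o-minimal structure expanding $(\mathbb{R},+,\cdot)$ is a family $\mathcal{D}=(\mathcal{D}_n)_{n\in\mathbb{N}}$, $\mathcal{D}_n$ a Boolean algebra of subsets of $\mathbb{R}^n$, stable under Cartesian products and under projections $\mathbb{R}^n\to\mathbb{R}^{n-1}$ onto the first $n-1$ coordinates, containing all real algebraic sets, and such that every element of $\mathcal{D}_1$ is a finite union of intervals and points. It is polynomially bounded if for every function $f:\mathbb{R}\to\mathbb{R}$ with graph in $\mathcal{D}$ there are $a>0$, $p\in\mathbb{N}$ with $|f(x)|<x^p$ for all $x>a$. Throughout, $\mathcal{D}$ is a fixed polynomially bounded o-minimal structure expanding $(\mathbb{R},+,\cdot)$; ''definable'' means belonging to $\mathcal{D}$ (for sets) or having graph in $\mathcal{D}$ (for maps). Inner metric: for $x,y$ in the same connected component of a definable set $A$, $\mathring{d}_A(x,y)$ is the infimum of the lengths of the continuous definable arcs $\gamma:[0,1]\to A$ with $\gamma(0)=x$, $\gamma(1)=y$ (length being the supremum of $\sum_i|\gamma(t_i)-\gamma(t_{i+1})|$ over partitions of $[0,1]$); if $x,y$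 lie in different connected components of $A$, $\mathring{d}_A(x,y)=+\infty$. A mapping $f:A\to\mathbb{R}^k$ is inner Lipschitz if there is a constant $C$ such that $|f(x)-f(y)|\le C\,\mathring{d}_A(x,y)$ for all $x,y\in A$ (the inequality being void when $\mathring{d}_A(x,y)=+\infty$). For $x_0\in A$, $\mathring{L}_f(x_0)$ is the infimum of all $C\ge0$ for which there is $r>0$ such that $|f(x)-f(y)|\le C\,\mathring{d}_A(x,y)$ for all $x,y\in \mathbf{B}(x_0,r)\cap A$, where $\mathbf{B}(x_0,r)$ is the open euclidean ball of radius $r$ centered at $x_0$. A mapping is $\mathscr{C}^m$ on $A$ if it extends to a $\mathscr{C}^m$ mapping on an open neighborhood of $A$ in $\mathbb{R}^n$; the $\mathscr{C}^1$ mapping $g$ comes with such an extension, $d_xg$ denotes its derivative at $x\in A$, and $|d_xg|=\sup_{|u|=1}|d_xg(u)|$, where $|\cdot|$ is the euclidean norm. *)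

(* Defs.v *)
From HB Require Import structures.
From mathcomp Require Import all_boot all_order all_algebra.
From mathcomp Require Import all_classical all_reals all_analysis.
(* Not imported: the notations of mpoly clash with those of mathcomp-analysis. *)
From mathcomp.multinomials Require mpoly.
Set Implicit Arguments.
Unset Strict Implicit.
Unset Printing Implicit Defensive.
Import Order.TTheory GRing.Theory Num.Theory.
Import numFieldNormedType.Exports.
Local Open Scope classical_set_scope.
Local Open Scope ring_scope.

(* Points of R^n are row vectors. The topology and the notion of
   differentiability on 'rV[R]_n are the library's; its norm `|x| is the sup
   norm, so every metric quantity below uses [enorm] instead. Maps defined on
   a subset A of R^n are total functions of which only the values on A matter. *)

Definition enorm (R : realType) (n : nat) (x : 'rV[R]_n) : R :=
  Num.sqrt (\sum_(i < n) x 0 i ^+ 2).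

Definition eball (R : realType) (n : nat) (x0 : 'rV[R]_n) (r : R) :
  set 'rV[R]_n := [set x | enorm (x - x0) < r].

Definition zero_locus (R : realType) (n : nat) (S : set (mpoly.mpoly n R)) :
  set 'rV[R]_n := [set x | forall p, S p -> mpoly.meval (x 0) p = 0].

Definition set_family (R : realType) := forall n : nat, set (set 'rV[R]_n).

Record o_minimal (R : realType) (D : set_family R) : Prop := {
  omin_set0 : forall n, D n set0;
  omin_setU : forall n (A B : set 'rV[R]_n), D n A -> D n B -> D n (A `|` B);
  omin_setC : forall n (A : set 'rV[R]_n), D n A -> D n (~` A);
  omin_prod : forall m n (A : set 'rV[R]_m) (B : set 'rV[R]_n),
    D m A -> D n B ->
    D (m + n)%N [set z | A (lsubmx z) /\ B (rsubmx z)];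
  omin_proj : forall n (A : set 'rV[R]_(n + 1)),
    D (n + 1)%N A -> D n (lsubmx @` A);
  omin_algebraic : forall n (S : set (mpoly.mpoly n R)), D n (zero_locus S);
  (* A point a is the interval `[a, a]. *)
  omin_tame : forall A : set 'rV[R]_1, D 1%N A ->
    exists s : seq (interval R), A = [set x | exists2 i, i \in s & x 0 0 \in i]
}.

Definition definable_map (R : realType) (D : set_family R) (m n : nat)
    (A : set 'rV[R]_m) (f : 'rV[R]_m -> 'rV[R]_n) : Prop :=
  D (m + n)%N [set row_mx x (f x) | x in A].

(* R itself is identified with R^1 through a |-> a%:M and x |-> x 0 0. *)
Definition definable_fun (R : realType) (D : set_family R) (m : nat)
    (A : set 'rV[R]_m) (f : 'rV[R]_m -> R) : Prop :=
  definable_map D A (fun x => (f x)%:M : 'rV[R]_1).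

Definition polynomially_bounded (R : realType) (D : set_family R) : Prop :=
  forall f : R -> R,
    definable_fun D [set: 'rV[R]_1] (fun x => f (x 0 0)) ->
    exists a : R, exists p : nat,
      0 < a /\ forall x, a < x -> `|f x| < x ^+ p.

Definition locally_closed (T : topologicalType) (A : set T) : Prop :=
  exists U F : set T, [/\ open U, closed F & A = U `&` F].

(* Follows the library's [variation], which is restricted to real-valued
   functions. *)
Definition arc_variation (R : realType) (n : nat) (gamma : R -> 'rV[R]_n)
    (s : seq R) : R :=
  let F := gamma \o nth 1 (0 :: s) in
  \sum_(0 <= i < size s) enorm (F i - F i.+1).

Definition arc_length (R : realType) (n : nat) (gamma : R -> 'rV[R]_n) :
    \bar R :=
  ereal_sup [set (arc_variation gamma s)%:E | s in itv_partition 0 1].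

Definition definable_arc (R : realType) (D : set_family R) (n : nat)
    (A : set 'rV[R]_n) (x y : 'rV[R]_n) (gamma : R -> 'rV[R]_n) : Prop :=
  [/\ {within `[0, 1], continuous gamma},
      definable_map D [set t : 'rV[R]_1 | 0 <= t 0 0 <= 1]
        (fun t => gamma (t 0 0)),
      (forall t, 0 <= t <= 1 -> A (gamma t)),
      gamma 0 = x
    & gamma 1 = y].

Definition inner_dist (R : realType) (D : set_family R) (n : nat)
    (A : set 'rV[R]_n) (x y : 'rV[R]_n) : \bar R :=
  if `[< connected_component A x y >]
  then ereal_inf [set arc_length gamma | gamma in definable_arc D A x y]
  else +oo%E.

(* The inequality is guarded because 0 * +oo = 0 in \bar R, whereas it has to
   be void at infinite distance also for C = 0. *)
Definition inner_lipschitz_on (R : realType) (D : set_family R) (n k : nat)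
    (A B : set 'rV[R]_n) (f : 'rV[R]_n -> 'rV[R]_k) (C : R) : Prop :=
  forall x y, B x -> B y -> (inner_dist D A x y < +oo)%E ->
    ((enorm (f x - f y))%:E <= C%:E * inner_dist D A x y)%E.

Definition inner_lipschitz (R : realType) (D : set_family R) (n k : nat)
    (A : set 'rV[R]_n) (f : 'rV[R]_n -> 'rV[R]_k) : Prop :=
  exists C : R, inner_lipschitz_on D A A f C.

Definition local_inner_lip (R : realType) (D : set_family R) (n k : nat)
    (A : set 'rV[R]_n) (f : 'rV[R]_n -> 'rV[R]_k) (x0 : 'rV[R]_n) : \bar R :=
  ereal_inf [set C%:E | C in [set C : R | 0 <= C /\
    exists2 r : R, 0 < r & inner_lipschitz_on D A (eball x0 r `&` A) f C]].

Definition C1_on (R : realType) (n k : nat) (U : set 'rV[R]_n)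
    (G : 'rV[R]_n -> 'rV[R]_k) : Prop :=
  forall x, U x -> differentiable G x /\ {for x, continuous (jacobian G)}.

(* G witnesses that g is C^1 on A. *)
Definition C1_extension (R : realType) (n k : nat) (A : set 'rV[R]_n)
    (g G : 'rV[R]_n -> 'rV[R]_k) : Prop :=
  exists U : set 'rV[R]_n,
    [/\ open U, A `<=` U, C1_on U G & forall x, A x -> G x = g x].

(* For n = 0 the unit sphere is empty and the value is sup set0 = 0. *)
Definition diff_norm (R : realType) (n k : nat) (G : 'rV[R]_n -> 'rV[R]_k)
    (x : 'rV[R]_n) : R :=
  sup [set enorm ('d G x u) | u in [set u : 'rV[R]_n | enorm u = 1]].

(* Main.v *)
(* By curve selection, f has at every x in A a pointwise Lipschitz constant
   ("slope") at most L_f(x): a definable curve ending at x is asymptotically as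
   short as the distance of its endpoints. From then on only slopes matter.

   Let B be a definable subset of A and d maximal such that some projection of B
   to d coordinates has nonempty interior. Over a dense open part of that
   projection, B consists locally of C^1 sections s. At a generic point of s the
   tangential derivative of f is at most the slope of f at all nearby points of
   A, up to mu: otherwise s is a limit of curves along which f grows too slowly.
   Hence extending f affinely off B gives a C^1 map F near a piece Y of B that is
   open in B, with derivative bounded by slope + mu on A, and B \ Y has no longer
   a projection with interior to the chosen d coordinates.

   Assume that H approximates f near A \ B, and F is as above. With a definable
   C^1 gauge eta, small with small derivative and vanishing at B \ Y, replace H by
   H - rho k(|H - F|^2 / eta^2) (H - F), where rho localizes to a neighbourhood of
   Y and k is a cutoff with |t k'(t)| uniformly small; the derivative of the
   correction is then a convex combination of those of H and F up to a small
   error. Starting from B = A, finitely many steps reach the empty set. *)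
Require Import Defs.
From HB Require Import structures.
From mathcomp Require Import all_boot all_order all_algebra.
From mathcomp Require Import all_classical all_reals all_analysis.
From mathcomp Require Import ring lra zify.
From mathcomp.multinomials Require mpoly.
Import (canonicals) mpoly.
Set Implicit Arguments.
Unset Strict Implicit.
Unset Printing Implicit Defensive.
Import Order.TTheory GRing.Theory Num.Theory.
Import numFieldNormedType.Exports.
Local Open Scope classical_set_scope.
Local Open Scope ring_scope.

(** * Definability *)

(** Tameness is postulated in one variable only, and no cell decomposition is derived from it. Its
    place is taken by a Baire property: if countably many definable sets cover a box, one of them
    contains a box. Countable alternatives (a sign, a rational level, a scale 1/(m+1)) thus become
    uniform on a smaller box; continuity, differentiability and separation of fibres at generic
    points all come from this.

    The derivative of F has to be compared with the slope at each point of A near the piece, also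
    off B, although slopes need not vary continuously. This is why growth along B must be controlled
    by points of small slope that merely accumulate at B.

    Gluing requires H to be close to f compared with a gauge that may tend to 0 at B \ Y. Hence the
    induction runs over a statement about all definable error bounds that are positive off B
    only. *)

(* Types coordinatized by some R^dim, along which definability is transported. *)
Class dtype (R : realType) (T : Type) := DType {
  dim : nat;
  enc : T -> 'rV[R]_dim;
  dec : 'rV[R]_dim -> T;
  encK : cancel enc dec;
  decK : cancel dec enc }.
Arguments dim R T {dtype}.

#[global] Instance dtype_rV (R : realType) n : dtype R 'rV[R]_n | 1 :=
  @DType R _ n id id (fun=> erefl) (fun=> erefl).

Lemma scalar_encK (R : realType) :
  cancel (fun r : R => r%:M : 'rV[R]_1) (fun v => v 0 0).
Proof. by move=> r; rewrite !mxE eqxx mulr1n. Qed.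

Lemma scalar_decK (R : realType) :
  cancel (fun v : 'rV[R]_1 => v 0 0) (fun r => r%:M).
Proof. by move=> v; apply/rowP => i; rewrite ord1 !mxE eqxx mulr1n. Qed.

#[global] Instance dtype_R (R : realType) : dtype R R :=
  DType (@scalar_encK R) (@scalar_decK R).

(** The lower priority keeps row vectors, which are also matrices, with the identity encoding of
    [dtype_rV]. *)
#[global] Instance dtype_mx (R : realType) m n : dtype R 'M[R]_(m, n) | 2 :=
  @DType R _ (m * n) (@mxvec R m n) (@vec_mx R m n) (@mxvecK R m n)
    (@vec_mxK R m n).

Section dtype_pair.
Context (R : realType) (T U : Type) (dT : dtype R T) (dU : dtype R U).

Let encp (z : T * U) : 'rV[R]_(dim R T + dim R U) := row_mx (enc z.1) (enc z.2).
Let decp (v : 'rV[R]_(dim R T + dim R U)) : T * U :=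
  (dec (lsubmx v), dec (rsubmx v)).

Let encpK : cancel encp decp.
Proof. by case=> a b; rewrite /encp /decp row_mxKl row_mxKr !encK. Qed.

Let decpK : cancel decp encp.
Proof. by move=> v; rewrite /encp /decp !decK hsubmxK. Qed.

#[global] Instance dtype_prod : dtype R (T * U) := DType encpK decpK.
End dtype_pair.

Section Definability.
Context (R : realType) (D : set_family R) (omD : o_minimal D).

Definition def T {dT : dtype R T} (P : T -> Prop) := D [set v | P (dec v)].

(** Functions are total, so composition needs no domains; a map given on a set is first extended by
    a default value, as in [definable_map_dfun]. *)
Definition dfun T U {dT : dtype R T} {dU : dtype R U} (f : T -> U) :=
  def (fun z : T * U => z.2 = f z.1).

Lemma omin_ext n (S S' : set 'rV[R]_n) :
  D S -> (forall v, S v <-> S' v) -> D S'.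
Proof. by move=> DS SS'; rewrite -(_ : S = S')//; apply/seteqP; split=> v /SS'. Qed.

Lemma def_eqv T {dT : dtype R T} (P Q : T -> Prop) :
  (forall t, P t <-> Q t) -> def P -> def Q.
Proof.
by move=> PQ; rewrite /def; congr (D _); apply/seteqP; split=> v /= /PQ.
Qed.

Lemma def_ext T {dT : dtype R T} (P Q : T -> Prop) :
  def P -> (forall t, P t <-> Q t) -> def Q.
Proof. by move=> dP PQ; exact: def_eqv dP. Qed.

Lemma def_or T {dT : dtype R T} (P Q : T -> Prop) :
  def P -> def Q -> def (fun t => P t \/ Q t).
Proof. by move=> dP dQ; apply: (omin_setU omD dP dQ). Qed.

Lemma def_not T {dT : dtype R T} (P : T -> Prop) :
  def P -> def (fun t => ~ P t).
Proof. by move=> dP; apply: (omin_setC omD dP). Qed.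

Lemma def_and T {dT : dtype R T} (P Q : T -> Prop) :
  def P -> def Q -> def (fun t => P t /\ Q t).
Proof.
move=> dP dQ; apply: (@def_eqv _ _ (fun t => ~ (~ P t \/ ~ Q t))).
  move=> t; split=> [h|[p q] []//].
  by split; apply: contrapT => ?; apply: h; [left|right].
by apply/def_not/def_or; exact: def_not.
Qed.

Lemma def_imp T {dT : dtype R T} (P Q : T -> Prop) :
  def P -> def Q -> def (fun t => P t -> Q t).
Proof.
move=> dP dQ; apply: (@def_eqv _ _ (fun t => ~ P t \/ Q t)).
  move=> t; split=> [[np|//] /np //|h].
  by have [/h|] := pselect (P t); [right|left].
by apply: def_or => //; exact: def_not.
Qed.

Lemma def_iff T {dT : dtype R T} (P Q : T -> Prop) :
  def P -> def Q -> def (fun t => P t <-> Q t).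
Proof. by move=> dP dQ; apply: def_and; exact: def_imp. Qed.

Lemma def_cst T {dT : dtype R T} (P : Prop) : def (fun _ : T => P).
Proof.
have def0 : def (fun _ : T => False) by exact: omin_set0.
have [HP|HP] := pselect P; last by apply: (def_ext def0) => t; split.
by apply: (def_ext (def_not def0)) => t; split=> // _ [].
Qed.

Lemma def_forall_fin T {dT : dtype R T} (I : finType) (P : I -> T -> Prop) :
  (forall i, def (P i)) -> def (fun t => forall i, P i t).
Proof.
move=> dP.
have H : forall s : seq I, def (fun t : T => forall i, i \in s -> P i t).
  elim=> [|i s IH]; first by apply: (def_ext (def_cst (T:=T) True)).
  apply: (def_ext (def_and (dP i) IH)) => t; split.
    by move=> [h1 h2] j; rewrite inE => /predU1P[->//|]; exact: h2.
  by move=> h; split=> [|j js]; apply: h; rewrite inE ?eqxx// js orbT.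
apply: (def_ext (H (enum I))) => t.
by split=> h i; [apply: h; rewrite mem_enum|move=> _; exact: h].
Qed.

Lemma omin_cast n m (e : n = m) (S : set 'rV[R]_n) : D S ->
  D [set v : 'rV[R]_m | S (castmx (erefl, esym e) v)].
Proof.
by case: _ / e => DS; congr (D _): DS; apply/seteqP; split=> v /=; rewrite castmx_id.
Qed.

Lemma omin_projn m n (S : set 'rV[R]_(m + n)) : D S -> D (@lsubmx _ 1 m n @` S).
Proof.
elim: n S => [|n IH] S DS.
  have := omin_cast (addn0 m) DS; congr (D _); apply/seteqP; split=> v /=.
    move=> Sv; exists (castmx (erefl, esym (addn0 m)) v) => //.
    by apply/rowP => i; rewrite !mxE castmxE; congr (v _ _); apply: val_inj.
  move=> [w Sw <-]; congr (S _): Sw.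
  by apply/rowP => i; rewrite castmxE !mxE; congr (w _ _); apply: val_inj => /=.
have e : (m + n.+1)%N = (m + n + 1)%N by rewrite addn1 addnS.
have := IH _ (omin_proj omD (omin_cast e DS)); congr (D _).
apply/seteqP; split=> v /=.
  move=> [_ [w Sw <-] <-]; eexists; first exact: Sw.
  by apply/rowP => i; rewrite !mxE castmxE; congr (w _ _); apply: val_inj.
move=> [w Sw <-].
have e2 : castmx (erefl, esym e) (castmx (erefl, e) w) = w.
  by apply/rowP => i; rewrite !castmxE; congr (w _ _); apply: val_inj.
exists (lsubmx (castmx (erefl, e) w)).
  by exists (castmx (erefl, e) w); rewrite ?e2.
by apply/rowP => i; rewrite !mxE castmxE; congr (w _ _); apply: val_inj.
Qed.

Lemma def_ex T U {dT : dtype R T} {dU : dtype R U} (P : T -> U -> Prop) :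
  def (fun z : T * U => P z.1 z.2) -> def (fun t => exists u, P t u).
Proof.
move=> /omin_projn; rewrite /def; congr (D _); apply/seteqP; split=> v /=.
  by move=> [w Pw <-]; exists (dec (rsubmx w)).
move=> [u Pu]; exists (row_mx v (enc u)); last exact: row_mxKl.
by rewrite /= row_mxKl row_mxKr encK.
Qed.

Lemma def_all T U {dT : dtype R T} {dU : dtype R U} (P : T -> U -> Prop) :
  def (fun z : T * U => P z.1 z.2) -> def (fun t => forall u, P t u).
Proof.
move=> dP; apply: (@def_eqv _ _ (fun t => ~ exists u, ~ P t u)).
  move=> t; split=> [h u|h [u]]; last by apply; exact: h.
  by apply: contrapT => ?; apply: h; exists u.
by apply: def_not; apply: def_ex; apply: def_not.
Qed.

Lemma omin_eq_coord n (i j : 'I_n) : D [set v : 'rV[R]_n | v 0 i = v 0 j].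
Proof.
have := omin_algebraic omD [set mpoly.mpolyX R (mpoly.mnm1 i) - mpoly.mpolyX R (mpoly.mnm1 j)].
congr (D _); apply/seteqP; split=> v /=.
  by move=> /(_ _ erefl); rewrite mpoly.mevalB !mpoly.mevalXU => /subr0_eq.
by move=> h _ ->; rewrite mpoly.mevalB !mpoly.mevalXU h subrr.
Qed.

Lemma omin_add_coord n (i j k : 'I_n) :
  D [set v : 'rV[R]_n | v 0 k = v 0 i + v 0 j].
Proof.
have := omin_algebraic omD [set mpoly.mpolyX R (mpoly.mnm1 k) - (mpoly.mpolyX R (mpoly.mnm1 i) + mpoly.mpolyX R (mpoly.mnm1 j))].
congr (D _); apply/seteqP; split=> v /=.
  by move=> /(_ _ erefl); rewrite mpoly.mevalB mpoly.mevalD !mpoly.mevalXU => /subr0_eq.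
by move=> h _ ->; rewrite mpoly.mevalB mpoly.mevalD !mpoly.mevalXU h subrr.
Qed.

Lemma omin_mul_coord n (i j k : 'I_n) :
  D [set v : 'rV[R]_n | v 0 k = v 0 i * v 0 j].
Proof.
have := omin_algebraic omD [set mpoly.mpolyX R (mpoly.mnm1 k) - (mpoly.mpolyX R (mpoly.mnm1 i) * mpoly.mpolyX R (mpoly.mnm1 j))].
congr (D _); apply/seteqP; split=> v /=.
  by move=> /(_ _ erefl); rewrite mpoly.mevalB mpoly.mevalM !mpoly.mevalXU => /subr0_eq.
by move=> h _ ->; rewrite mpoly.mevalB mpoly.mevalM !mpoly.mevalXU h subrr.
Qed.

Lemma omin_cst_coord n (i : 'I_n) (c : R) : D [set v : 'rV[R]_n | v 0 i = c].
Proof.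
have := omin_algebraic omD [set mpoly.mpolyX R (mpoly.mnm1 i) - mpoly.mpolyC n c].
congr (D _); apply/seteqP; split=> v /=.
  by move=> /(_ _ erefl); rewrite mpoly.mevalB mpoly.mevalXU mpoly.mevalC => /subr0_eq.
by move=> h _ ->; rewrite mpoly.mevalB mpoly.mevalXU mpoly.mevalC h subrr.
Qed.

Lemma omin_forall_fin n (I : finType) (S : I -> set 'rV[R]_n) :
  (forall i, D (S i)) -> D [set v | forall i, S i v].
Proof. exact: (@def_forall_fin 'rV[R]_n _ I (fun i v => S i v)). Qed.

(** Selections of coordinates supply projections, reassociations of pairs and matrix entries; their
    graphs are conjunctions of equations between coordinates. *)
Lemma dfun_coord T U {dT : dtype R T} {dU : dtype R U} (f : T -> U)
    (phi : 'I_(dim R U) -> 'I_(dim R T)) :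
  (forall t i, enc (f t) 0 i = enc t 0 (phi i)) -> dfun f.
Proof.
move=> fphi.
have := omin_forall_fin (fun i : 'I_(dim R U) =>
  omin_eq_coord (rshift (dim R T) i) (lshift (dim R U) (phi i))).
rewrite /dfun /def; congr (D _); apply/seteqP; split=> v /=.
  move=> h; apply: (can_inj encK); rewrite decK; apply/rowP => i.
  by rewrite fphi decK !mxE h.
move=> h i; have := fphi (dec (lsubmx v)) i; rewrite -h !decK.
by rewrite !mxE.
Qed.

Lemma def_snd T U {dT : dtype R T} {dU : dtype R U} (P : U -> Prop) :
  def P -> def (fun z : T * U => P z.2).
Proof.
move=> dP; apply: (omin_ext (omin_prod omD (def_cst (T:='rV[R]_(dim R T)) True) dP)).
by move=> v /=; split=> [[]|].
Qed.

Lemma def_sub T U {dT : dtype R T} {dU : dtype R U} (P : U -> Prop)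
  (f : T -> U) : def P -> dfun f -> def (fun t => P (f t)).
Proof.
move=> dP df; apply: (@def_eqv _ _ (fun t => exists u, u = f t /\ P u)).
  by move=> t; split=> [[u [-> //]]|h]; exists (f t).
apply: def_ex; apply: def_and => //; exact: def_snd.
Qed.

Lemma dfun_id T {dT : dtype R T} : dfun (fun t : T => t).
Proof. exact: (dfun_coord (phi := id)). Qed.

Lemma dfun_fst T U {dT : dtype R T} {dU : dtype R U} :
  dfun (fun z : T * U => z.1).
Proof.
by apply: (@dfun_coord (T * U) T _ _ _ (@lshift _ _)) => z i; rewrite row_mxEl.
Qed.

Lemma dfun_snd T U {dT : dtype R T} {dU : dtype R U} :
  dfun (fun z : T * U => z.2).
Proof.
by apply: (@dfun_coord (T * U) U _ _ _ (@rshift _ _)) => z i; rewrite row_mxEr.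
Qed.

Lemma dfun_cst T U {dT : dtype R T} {dU : dtype R U} (c : U) :
  dfun (fun _ : T => c).
Proof.
apply: (@def_snd T U _ _ (fun u => u = c)); rewrite /def.
apply: (omin_ext (omin_forall_fin
  (fun i : 'I_(dim R U) => omin_cst_coord i (enc c 0 i)))) => v /=; split.
  by move=> h; apply: (can_inj encK); rewrite decK; apply/rowP.
by move=> <- i; rewrite decK.
Qed.

Let dfun_shuffle1 T U V {dT : dtype R T} {dU : dtype R U} {dV : dtype R V} :
  dfun (fun z : T * (U * V) => (z.1, z.2.1)).
Proof.
pose (phi := (fun (i : 'I_(dim R T + dim R U)) => match fintype.split i with
  | inl i => lshift _ i | inr i => rshift _ (lshift _ i) end) : _ -> 'I_(dim R T + (dim R U + dim R V))).
apply: (@dfun_coord _ _ (dtype_prod dT (dtype_prod dU dV)) (dtype_prod dT dU) (fun z => (z.1, z.2.1)) phi) => z i /=.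
rewrite /phi mxE.
by case: splitP => j _; rewrite ?row_mxEl ?row_mxEr ?row_mxEl.
Qed.

Let dfun_shuffle2 T U V {dT : dtype R T} {dU : dtype R U} {dV : dtype R V} :
  dfun (fun z : T * (U * V) => (z.1, z.2.2)).
Proof.
pose (phi := (fun (i : 'I_(dim R T + dim R V)) => match fintype.split i with
  | inl i => lshift _ i | inr i => rshift _ (rshift _ i) end) : _ -> 'I_(dim R T + (dim R U + dim R V))).
apply: (@dfun_coord _ _ (dtype_prod dT (dtype_prod dU dV)) (dtype_prod dT dV) (fun z => (z.1, z.2.2)) phi) => z i /=.
rewrite /phi mxE.
by case: splitP => j _; rewrite ?row_mxEl ?row_mxEr ?row_mxEr.
Qed.

Lemma dfun_pair T U V {dT : dtype R T} {dU : dtype R U} {dV : dtype R V}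
  (f : T -> U) (g : T -> V) : dfun f -> dfun g -> dfun (fun t => (f t, g t)).
Proof.
move=> df dg.
have d1 : def (fun z : T * (U * V) => z.2.1 = f z.1).
  exact: (def_sub df (@dfun_shuffle1 T U V _ _ _)).
have d2 : def (fun z : T * (U * V) => z.2.2 = g z.1).
  exact: (def_sub dg (@dfun_shuffle2 T U V _ _ _)).
apply: (def_ext (def_and d1 d2)) => -[t [u v]] /=.
by split=> [[-> ->]|[]].
Qed.

Lemma dfun_comp T U V {dT : dtype R T} {dU : dtype R U} {dV : dtype R V}
  (g : U -> V) (f : T -> U) : dfun g -> dfun f -> dfun (fun t => g (f t)).
Proof.
move=> dg df; apply: (def_sub (f := fun z : T * V => (f z.1, z.2)) dg).
apply: dfun_pair; last exact: dfun_snd.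
apply: (def_sub (f := fun z : (T * V) * U => (z.1.1, z.2)) df).
apply: dfun_pair; last exact: dfun_snd.
pose (phi := (fun (i : 'I_(dim R T)) => lshift _ (lshift _ i)) : _ -> 'I_(dim R T + dim R V + dim R U)).
apply: (@dfun_coord _ _ (dtype_prod (dtype_prod dT dV) dU) dT (fun z => z.1.1) phi) => z i /=.
by rewrite !row_mxEl.
Qed.

Lemma dfun_comp2 T U V W {dT : dtype R T} {dU : dtype R U} {dV : dtype R V}
  {dW : dtype R W} (g : U -> V -> W) (f : T -> U) (h : T -> V) :
  dfun (fun z : U * V => g z.1 z.2) -> dfun f -> dfun h ->
  dfun (fun t => g (f t) (h t)).
Proof.
by move=> dg df dh; exact: (dfun_comp (f := fun t => (f t, h t)) dg (dfun_pair df dh)).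
Qed.

Lemma def_sub2 T U V {dT : dtype R T} {dU : dtype R U} {dV : dtype R V}
  (P : U -> V -> Prop) (f : T -> U) (h : T -> V) :
  def (fun z : U * V => P z.1 z.2) -> dfun f -> dfun h ->
  def (fun t => P (f t) (h t)).
Proof.
by move=> dg df dh; exact: (def_sub (f := fun t => (f t, h t)) dg (dfun_pair df dh)).
Qed.

Lemma def_eq T U {dT : dtype R T} {dU : dtype R U} (f g : T -> U) :
  dfun f -> dfun g -> def (fun t => f t = g t).
Proof.
move=> df dg; apply: (def_sub2 (P := fun a b : U => a = b)) => //.
by apply: (def_ext (dfun_id (T := U))) => z; split=> ->.
Qed.

Lemma dfun_add T {dT : dtype R T} (f g : T -> R) :
  dfun f -> dfun g -> dfun (fun t => f t + g t).
Proof.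
apply: dfun_comp2.
apply: (omin_ext (omin_add_coord (lshift 1 (lshift 1 0)) (lshift 1 (rshift 1 0)) (rshift (1 + 1) 0))).
by move=> v /=; rewrite !mxE.
Qed.

Lemma dfun_mul T {dT : dtype R T} (f g : T -> R) :
  dfun f -> dfun g -> dfun (fun t => f t * g t).
Proof.
apply: dfun_comp2.
apply: (omin_ext (omin_mul_coord (lshift 1 (lshift 1 0)) (lshift 1 (rshift 1 0)) (rshift (1 + 1) 0))).
by move=> v /=; rewrite !mxE.
Qed.

Lemma dfun_opp T {dT : dtype R T} (f : T -> R) :
  dfun f -> dfun (fun t => - f t).
Proof.
move=> df; apply: (def_ext (dfun_mul (dfun_cst (T:=T) (- 1)) df)) => z.
by rewrite mulN1r.
Qed.

Lemma dfun_expr T {dT : dtype R T} (f : T -> R) m :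
  dfun f -> dfun (fun t => f t ^+ m).
Proof.
move=> df; elim: m => [|m IH]; first exact: dfun_cst.
by apply: (def_ext (dfun_mul df IH)) => z; rewrite exprS.
Qed.

Lemma dfun_sum T {dT : dtype R T} (I : Type) (s : seq I) (f : I -> T -> R) :
  (forall i, dfun (f i)) -> dfun (fun t => \sum_(i <- s) f i t).
Proof.
move=> df; elim: s => [|i s IH].
  by apply: (def_ext (dfun_cst (T:=T) 0)) => z; rewrite big_nil.
by apply: (def_ext (dfun_add (df i) IH)) => z; rewrite big_cons.
Qed.

(** The order is not primitive: [g - f] is nonnegative exactly when it is a square. *)
Lemma def_le T {dT : dtype R T} (f g : T -> R) :
  dfun f -> dfun g -> def (fun t => f t <= g t).
Proof.
move=> df dg; apply: (@def_eqv _ _ (fun t => exists r : R, g t = f t + r ^+ 2)).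
  move=> t; split=> [[r ->]|fg]; first by rewrite lerDl sqr_ge0.
  by exists (Num.sqrt (g t - f t)); rewrite sqr_sqrtr ?subr_ge0// subrKC.
apply: def_ex; apply: def_eq; first exact: (dfun_comp dg (@dfun_fst _ _ _ _)).
apply: dfun_add; first exact: (dfun_comp df (@dfun_fst _ _ _ _)).
by apply: dfun_expr; exact: dfun_snd.
Qed.

Lemma def_lt T {dT : dtype R T} (f g : T -> R) :
  dfun f -> dfun g -> def (fun t => f t < g t).
Proof.
move=> df dg; apply: (@def_eqv _ _ (fun t => ~ (g t <= f t))).
  by move=> t; rewrite ltNge; split => /negP.
by apply: def_not; exact: def_le.
Qed.

Lemma dfun_graph T U {dT : dtype R T} {dU : dtype R U} (f : T -> U)
  (G : T -> U -> Prop) : (forall t u, G t u <-> u = f t) ->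
  def (fun z : T * U => G z.1 z.2) -> dfun f.
Proof. by move=> Gf dG; apply: (def_ext dG) => z. Qed.

Lemma dfun_inv T {dT : dtype R T} (f : T -> R) :
  dfun f -> dfun (fun t => (f t)^-1).
Proof.
apply: (dfun_comp (g := fun x : R => x^-1)).
apply: (@dfun_graph _ _ _ _ _ (fun x y : R => x * y = 1 \/ x = 0 /\ y = 0)).
  move=> x y; have [->|x0] := eqVneq x 0.
    rewrite invr0 mul0r; split=> [[/eqP|[]//]|->]; last by right.
    by rewrite eq_sym oner_eq0.
  split=> [[xy|[x00]]|->]; last by left; rewrite divff.
    by rewrite -[LHS](mulKf x0) xy mulr1.
  by rewrite x00 eqxx in x0.
apply: def_or; first apply: def_eq.
- by apply: dfun_mul; [exact: dfun_fst|exact: dfun_snd].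
- exact: dfun_cst.
- by apply: def_and; apply: def_eq; (exact: dfun_cst || exact: dfun_fst || exact: dfun_snd).
Qed.

Lemma dfun_coord_rV T {dT : dtype R T} n (f : T -> 'rV[R]_n) (i : 'I_n) j :
  dfun f -> dfun (fun t => f t j i).
Proof.
move=> df; have dg : dfun (fun v : 'rV[R]_n => v j i).
  pose (phi := (fun (_ : 'I_1) => i) : _ -> 'I_n).
  by apply: (@dfun_coord 'rV[R]_n R _ _ _ phi) => t k; rewrite !ord1 !mxE.
exact: (dfun_comp dg df).
Qed.

Lemma dfun_coord_mx T {dT : dtype R T} m n (f : T -> 'M[R]_(m, n)) i j :
  dfun f -> dfun (fun t => f t i j).
Proof.
move=> df; have dg : dfun (fun v : 'M[R]_(m, n) => v i j).
  pose (phi := (fun (_ : 'I_1) => mxvec_index i j) : _ -> 'I_(m * n)).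
  by apply: (@dfun_coord 'M[R]_(m, n) R _ _ _ phi) => t k; rewrite !ord1 !mxE mxvecE.
exact: (dfun_comp dg df).
Qed.

Lemma dfun_rV T {dT : dtype R T} n (f : T -> 'rV[R]_n) :
  (forall i, dfun (fun t => f t 0 i)) -> dfun f.
Proof.
move=> df; refine (dfun_graph (G := fun t (v : 'rV[R]_n) => forall i, v 0 i = f t 0 i) _ _).
  by move=> t u; split=> [h|->//]; apply/rowP.
apply: def_forall_fin => i; apply: def_eq.
  by apply: dfun_coord_rV; exact: dfun_snd.
exact: (dfun_comp (df i) (@dfun_fst _ _ _ _)).
Qed.

Lemma dfun_mx T {dT : dtype R T} m n (f : T -> 'M[R]_(m, n)) :
  (forall i j, dfun (fun t => f t i j)) -> dfun f.
Proof.
move=> df; refine (dfun_graph (G := fun t (v : 'M[R]_(m, n)) => forall i, forall j, v i j = f t i j) _ _).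
  by move=> t u; split=> [h|->//]; apply/matrixP.
apply: def_forall_fin => i; apply: def_forall_fin => j; apply: def_eq.
  by apply: dfun_coord_mx; exact: dfun_snd.
exact: (dfun_comp (df i j) (@dfun_fst _ _ _ _)).
Qed.

End Definability.

Section DefinabilityMore.
Context (R : realType) (D : set_family R) (omD : o_minimal D).
Notation def := (@def R D _ _).
Notation dfun := (@dfun R D _ _ _ _).

Lemma dfun_fst_of T U V {dT : dtype R T} {dU : dtype R U} {dV : dtype R V}
  (f : T -> U * V) : dfun f -> dfun (fun t => (f t).1).
Proof. exact: (dfun_comp omD (dfun_fst (T := U) (U := V) omD)). Qed.

Lemma dfun_snd_of T U V {dT : dtype R T} {dU : dtype R U} {dV : dtype R V}
  (f : T -> U * V) : dfun f -> dfun (fun t => (f t).2).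
Proof. exact: (dfun_comp omD (dfun_snd (T := U) (U := V) omD)). Qed.

Lemma dfun_eq T U {dT : dtype R T} {dU : dtype R U} (f g : T -> U) :
  dfun f -> f =1 g -> dfun g.
Proof. by move=> df fg; apply: (def_ext df) => z; rewrite fg. Qed.

Lemma dfun_addM T {dT : dtype R T} m n (f g : T -> 'M[R]_(m, n)) :
  dfun f -> dfun g -> dfun (fun t => f t + g t).
Proof.
move=> df dg; apply: (dfun_mx omD) => i j.
apply: (dfun_eq (f := fun t => f t i j + g t i j)); last by move=> t; rewrite mxE.
by apply: (dfun_add omD); exact: (dfun_coord_mx omD).
Qed.

Lemma dfun_addV T {dT : dtype R T} n (f g : T -> 'rV[R]_n) :
  dfun f -> dfun g -> dfun (fun t => f t + g t).
Proof.
move=> df dg; apply: (dfun_rV omD) => j.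
apply: (dfun_eq (f := fun t => f t 0 j + g t 0 j)); last by move=> t; rewrite mxE.
by apply: (dfun_add omD); exact: (dfun_coord_rV omD).
Qed.

Lemma dfun_oppM T {dT : dtype R T} m n (f : T -> 'M[R]_(m, n)) :
  dfun f -> dfun (fun t => - f t).
Proof.
move=> df; apply: (dfun_mx omD) => i j.
apply: (dfun_eq (f := fun t => - f t i j)); last by move=> t; rewrite mxE.
by apply: (dfun_opp omD); exact: (dfun_coord_mx omD).
Qed.

Lemma dfun_oppV T {dT : dtype R T} n (f : T -> 'rV[R]_n) :
  dfun f -> dfun (fun t => - f t).
Proof.
move=> df; apply: (dfun_rV omD) => j.
apply: (dfun_eq (f := fun t => - f t 0 j)); last by move=> t; rewrite mxE.
by apply: (dfun_opp omD); exact: (dfun_coord_rV omD).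
Qed.

Lemma dfun_scaleV T {dT : dtype R T} n (c : T -> R) (f : T -> 'rV[R]_n) :
  dfun c -> dfun f -> dfun (fun t => c t *: f t).
Proof.
move=> dc df; apply: (dfun_rV omD) => j.
apply: (dfun_eq (f := fun t => c t * f t 0 j)); last by move=> t; rewrite mxE.
by apply: (dfun_mul omD) => //; exact: (dfun_coord_rV omD).
Qed.

Lemma dfun_mulV T {dT : dtype R T} m n (f : T -> 'rV[R]_m)
  (g : T -> 'M[R]_(m, n)) :
  dfun f -> dfun g -> dfun (fun t => f t *m g t).
Proof.
move=> df dg; apply: (dfun_rV omD) => j.
apply: (dfun_eq (f := fun t => \sum_i f t 0 i * g t i j)).
  apply: (dfun_sum omD) => i; apply: (dfun_mul omD).
    exact: (dfun_coord_rV omD).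
  exact: (dfun_coord_mx omD).
by move=> t; rewrite mxE.
Qed.

Lemma dfun_mulM T {dT : dtype R T} m n p (f : T -> 'M[R]_(m, n))
  (g : T -> 'M[R]_(n, p)) :
  dfun f -> dfun g -> dfun (fun t => f t *m g t).
Proof.
move=> df dg; apply: (dfun_mx omD) => i j.
apply: (dfun_eq (f := fun t => \sum_k f t i k * g t k j)).
  by apply: (dfun_sum omD) => k; apply: (dfun_mul omD); exact: (dfun_coord_mx omD).
by move=> t; rewrite mxE.
Qed.

Lemma dfun_trM T {dT : dtype R T} m n (f : T -> 'M[R]_(m, n)) :
  dfun f -> dfun (fun t => (f t)^T).
Proof.
move=> df; apply: (dfun_mx omD) => i j.
apply: (dfun_eq (f := fun t => f t j i)); last by move=> t; rewrite mxE.
exact: (dfun_coord_mx omD).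
Qed.

Lemma dfun_mxvec T {dT : dtype R T} m n (f : T -> 'M[R]_(m, n)) :
  dfun f -> dfun (fun t => mxvec (f t)).
Proof.
move=> df; apply: (dfun_rV omD) => i; case/mxvec_indexP: i => i j.
apply: (dfun_eq (f := fun t => f t i j)); last by move=> t; rewrite mxvecE.
exact: (dfun_coord_mx omD).
Qed.

Lemma dfun_colsub T {dT : dtype R T} n m (io : 'I_m -> 'I_n) (f : T -> 'rV[R]_n) :
  dfun f -> dfun (fun t => colsub io (f t)).
Proof.
move=> df; apply: (dfun_rV omD) => i.
apply: (dfun_eq (f := fun t => f t 0 (io i))); last by move=> t; rewrite mxE.
exact: (dfun_coord_rV omD).
Qed.

Lemma def_sub3 T U V W {dT : dtype R T} {dU : dtype R U} {dV : dtype R V}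
  {dW : dtype R W} (P : U -> V -> W -> Prop) (f : T -> U) (g : T -> V)
  (h : T -> W) :
  def (fun z : U * V * W => P z.1.1 z.1.2 z.2) -> dfun f -> dfun g -> dfun h ->
  def (fun t => P (f t) (g t) (h t)).
Proof.
move=> dP df dg dh; exact: (def_sub omD (f := fun t => (f t, g t, h t)) dP
  (dfun_pair omD (dfun_pair omD df dg) dh)).
Qed.

Lemma dfun_abs T {dT : dtype R T} (f : T -> R) :
  dfun f -> dfun (fun t => `|f t|).
Proof.
apply: (dfun_comp omD (g := fun x : R => `|x|)).
refine (dfun_graph (G := fun x y : R => 0 <= y /\ y ^+ 2 = x ^+ 2) _ _).
  move=> x y; split=> [[y0 /eqP]|->]; last by rewrite normr_ge0 real_normK// num_real.
  rewrite eqf_sqr => /orP[]/eqP yx; move: y0; rewrite yx => ?.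
    by rewrite ger0_norm.
  by rewrite -normrN ger0_norm.
apply: (def_and omD); first by apply: (def_le omD); [exact: dfun_cst|exact: dfun_snd].
by apply: (def_eq omD); apply: (dfun_expr omD); [exact: dfun_snd|exact: dfun_fst].
Qed.

Lemma rV_norm_le n (x : 'rV[R]_n) (r : R) :
  `|x| <= r <-> 0 <= r /\ forall i, `|x 0 i| <= r.
Proof.
split=> [xr|[r0 xr]].
  split=> [|i]; first exact: le_trans xr.
  apply: le_trans xr; rewrite /Num.norm/= mx_normrE.
  exact: (le_bigmax _ (fun ij : 'I_1 * 'I_n => `|x ij.1 ij.2|) (0, i)).
rewrite /Num.norm/= mx_normrE; apply/bigmax_leP; split=> // -[i j] _ /=.
by rewrite ord1.
Qed.

Lemma rV_norm_lt n (x : 'rV[R]_n) (r : R) :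
  `|x| < r <-> 0 < r /\ forall i, `|x 0 i| < r.
Proof.
split=> [xr|[r0 xr]].
  split=> [|i]; first exact: le_lt_trans xr.
  by apply: le_lt_trans xr; have /rV_norm_le[_] := lexx `|x|; apply.
rewrite /Num.norm/= mx_normrE; apply/bigmax_ltP; split=> // -[i j] _ /=.
by rewrite ord1.
Qed.

Lemma rV_norm_coord n (x : 'rV[R]_n) i : `|x 0 i| <= `|x|.
Proof. by have /rV_norm_le[_] := lexx `|x|; apply. Qed.

Lemma dfun_norm T {dT : dtype R T} n (f : T -> 'rV[R]_n) :
  dfun f -> dfun (fun t => `|f t|).
Proof.
apply: (dfun_comp omD (g := fun x : 'rV[R]_n => `|x|)).
have dc i : dfun (fun z : 'rV[R]_n * R => `|z.1 0 i|).
  by apply: dfun_abs; apply: (dfun_coord_rV omD); exact: dfun_fst.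
refine (dfun_graph (G := fun (x : 'rV[R]_n) (y : R) => (0 <= y /\ forall i, `|x 0 i| <= y)
  /\ forall r, (0 <= r /\ forall i, `|x 0 i| <= r) -> y <= r) _ _).
  move=> x y; split=> [[/rV_norm_le xy yr]|->].
    by apply/eqP; rewrite eq_le xy andbT; apply: yr; exact/rV_norm_le.
  by split; [exact/rV_norm_le|move=> r /rV_norm_le].
apply: (def_and omD); last apply: (def_all omD).
  apply: (def_and omD); first by apply: (def_le omD); [exact: dfun_cst|exact: dfun_snd].
  by apply: (def_forall_fin omD) => i; apply: (def_le omD) => //; exact: dfun_snd.
apply: (def_imp omD); last first.
  apply: (def_le omD); last exact: dfun_snd.
  by apply: dfun_snd_of; exact: dfun_fst.
apply: (def_and omD); first by apply: (def_le omD); [exact: dfun_cst|exact: dfun_snd].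
apply: (def_forall_fin omD) => i; apply: (def_le omD); last exact: dfun_snd.
exact: (dfun_comp omD (dc i) (dfun_fst (T := 'rV[R]_n * R) (U := R) omD)).
Qed.

Lemma dfun_enorm T {dT : dtype R T} n (f : T -> 'rV[R]_n) :
  dfun f -> dfun (fun t => enorm (f t)).
Proof.
apply: (dfun_comp omD (g := @enorm R n)).
refine (dfun_graph (G := fun (x : 'rV[R]_n) (y : R) => 0 <= y /\ y ^+ 2 = \sum_i x 0 i ^+ 2) _ _).
  move=> x y; split=> [[y0 yx]|->].
    by rewrite /enorm -yx sqrtr_sqr ger0_norm.
  by rewrite sqrtr_ge0 sqr_sqrtr// sumr_ge0// => i _; exact: sqr_ge0.
apply: (def_and omD); first by apply: (def_le omD); [exact: dfun_cst|exact: dfun_snd].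
apply: (def_eq omD); first by apply: (dfun_expr omD); exact: dfun_snd.
apply: (dfun_sum omD) => i; apply: (dfun_expr omD).
by apply: (dfun_coord_rV omD); exact: dfun_fst.
Qed.

End DefinabilityMore.

(** The shape of a formula or term selects the closure lemma; at an atom a definability hypothesis
    is looked up. For this reason limits, suprema and derivatives are spelled out below as
    first-order conditions over R, R^n and matrices whenever they have to be definable. *)
Ltac def_step :=
  match goal with
  | H : o_minimal ?D |- @def _ ?D _ _ ?P => lazymatch P with
    | (fun t => @?A t /\ @?B t) => refine (def_and H _ _)
    | (fun t => @?A t \/ @?B t) => refine (def_or H _ _)
    | (fun t => @?A t <-> @?B t) => refine (def_iff H _ _)
    | (fun t => ~ @?A t) => refine (def_not H _)
    | (fun t => @?A t -> @?B t) => refine (def_imp H _ _)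
    | (fun t => exists u, @?A t u) => refine (def_ex H _)
    | (fun t => exists2 u, @?A t u & @?B t u) =>
        refine (def_ext (P := fun t => exists u, A t u /\ B t u) _ _);
        [|let t := fresh in move=> t; split; [move=> [? []]; by eexists; eassumption|move=> [? ? ?]; eexists; split; by eassumption]]
    | (fun t => forall i : ordinal _, @?A t i) => refine (def_forall_fin H _); let i := fresh "i" in intro i
    | (fun t => forall u, @?A t u) => refine (def_all H _)
    | (fun t => is_true (@?f t <= @?g t)%R) => refine (def_le H _ _)
    | (fun t => is_true (@?f t < @?g t)%R) => refine (def_lt H _ _)
    | (fun t => is_true ((@?f t <= @?g t)%R && (@?h t <= @?k t)%R)) =>
       refine (def_ext (P := fun t => f t <= g t /\ h t <= k t) _ _); [|let t := fresh in move=> t; split; [case=> -> ->|move/andP]; done]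
    | (fun t => is_true ((@?f t < @?g t)%R && (@?h t < @?k t)%R)) =>
       refine (def_ext (P := fun t => f t < g t /\ h t < k t) _ _); [|let t := fresh in move=> t; split; [case=> -> ->|move/andP]; done]
    | (fun t => @?f t = @?g t) => refine (def_eq H _ _)
    | (fun _ => ?P) => refine (def_cst H P)
    | _ => match goal with
       | HP : @def _ D _ _ P |- _ => exact HP
       | HP : @def _ D _ _ ?A |- @def _ D _ _ (fun t => ?A (@?f t)) => refine (def_sub H HP _)
       | HP : @def _ D _ _ (fun z => ?A z.1 z.2) |- @def _ D _ _ (fun t => ?A (@?f t) (@?g t)) =>
          refine (def_sub2 H (P := A) HP _ _)
       | HP : @def _ D _ _ (fun z => ?A z.1.1 z.1.2 z.2) |- @def _ D _ _ (fun t => ?A (@?f t) (@?g t) (@?h t)) =>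
          refine (def_sub3 H (P := A) HP _ _ _)
       end
    end
  | H : o_minimal ?D |- @dfun _ ?D _ _ _ _ ?F => lazymatch F with
    | (fun t => t) => refine (dfun_id H)
    | (fun _ => ?c) => refine (dfun_cst H c)
    | GRing.inv => refine (dfun_inv H (dfun_id H))
    | GRing.opp => first [refine (dfun_opp H (dfun_id H))|refine (dfun_oppV H (dfun_id H))|refine (dfun_oppM H (dfun_id H))]
    | Num.norm => first [refine (dfun_abs H (dfun_id H))|refine (dfun_norm H (dfun_id H))]
    | @enorm _ _ => refine (dfun_enorm H (dfun_id H))
    | fst => refine (dfun_fst H)
    | snd => refine (dfun_snd H)
    | (fun t => (@?f t).1) => refine (dfun_fst_of H _)
    | (fun t => (@?f t).2) => refine (dfun_snd_of H _)
    | (fun t => (@?f t, @?g t)) => refine (dfun_pair H _ _)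
    | (fun t => (@?f t + @?g t)%R) => first [refine (dfun_add H _ _)|refine (dfun_addV H _ _)|refine (dfun_addM H _ _)]
    | (fun t => (- @?f t)%R) => first [refine (dfun_opp H _)|refine (dfun_oppV H _)|refine (dfun_oppM H _)]
    | (fun t => (@?f t * @?g t)%R) => refine (dfun_mul H _ _)
    | (fun t => (@?f t ^+ _)%R) => refine (dfun_expr H _ _)
    | (fun t => (@?f t)^-1%R) => refine (dfun_inv H _)
    | (fun t => (@?f t *: @?g t)%R) => refine (dfun_scaleV H _ _)
    | (fun t => (@?f t *m @?g t)%R) => first [refine (dfun_mulV H _ _)|refine (dfun_mulM H _ _)]
    | (fun t => (@?f t)^T%R) => refine (dfun_trM H _)
    | (fun t => mxvec (@?f t)) => refine (dfun_mxvec H _)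
    | (fun t => colsub ?io (@?f t)) => refine (dfun_colsub H _ _)
    | (fun t => enorm (@?f t)) => refine (dfun_enorm H _)
    | (fun t => (`| @?f t |)%R) => first [refine (dfun_abs H _)|refine (dfun_norm H _)]
    | (fun t => fun_of_matrix (@?f t) _ _) => first [refine (dfun_coord_rV H _ _ _)|refine (dfun_coord_mx H _ _ _)]
    | _ => match goal with
       | HP : @dfun _ D _ _ _ _ F |- _ => exact HP
       | HP : @dfun _ D _ _ _ _ ?A |- @dfun _ D _ _ _ _ (fun t => ?A (@?f t)) => refine (dfun_comp H HP _)
       | HP : @dfun _ D _ _ _ _ (fun z => ?A z.1 z.2) |- @dfun _ D _ _ _ _ (fun t => ?A (@?f t) (@?g t)) =>
          refine (dfun_comp2 H (g := A) HP _ _)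
       end
    end
  end; cbv beta.
Ltac deft := repeat def_step.

(** * Tameness and definable choice *)

Section Tame.
Context (R : realType) (D : set_family R) (omD : o_minimal D).
Notation def := (@def R D _ _).
Notation dfun := (@dfun R D _ _ _ _).

(** A constant default where [G t] is empty keeps the graph definable. *)
Lemma dfun_skolem T U {dT : dtype R T} {dU : dtype R U} (G : T -> U -> Prop) :
  def (fun z : T * U => G z.1 z.2) ->
  (forall t u u', G t u -> G t u' -> u = u') ->
  exists f : T -> U, dfun f /\ forall t, (exists u, G t u) -> G t (f t).
Proof.
move=> dG uG; have [u0 _] : exists u0 : U, True by exists (dec 0).
pose f t := if pselect (exists u, G t u) is left h then projT1 (cid h) else u0.
exists f; split; last first.
  by move=> t h; rewrite /f; case: pselect => // h'; case: cid.
refine (dfun_graph (G := fun t u => G t u \/ ((~ exists u', G t u') /\ u = u0)) _ _).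
  move=> t u; rewrite /f; case: pselect => h; last first.
    by split=> [[gu|[_ ->//]]|->]; [case: h; exists u|right].
  case: cid => u' /= gu'; split=> [[gu|[/(_ h)//]]|->]; last by left.
  exact: uG gu gu'.
deft.
Qed.

(** An interval contains or misses a right neighbourhood of [a]; for finitely many intervals the
    least tau serves. All one-sided limits and monotone germs below come from this alternative. *)
Lemma tame_germ (P : R -> Prop) (a : R) : def P ->
  exists2 tau, 0 < tau & (forall t, a < t -> t < a + tau -> P t) \/
                         (forall t, a < t -> t < a + tau -> ~ P t).
Proof.
move=> /(omin_tame omD)[s Ps].
have {}Ps t : P t <-> exists2 i, i \in s & t \in (i : interval R).
  have := congr1 (fun S : set 'rV[R]_1 => S (t%:M)) Ps => /=.
  by rewrite !mxE eqxx mulr1n => ->.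
have germ (i : interval R) : exists2 tau, 0 < tau &
    (forall t, a < t -> t < a + tau -> t \in i) \/
    (forall t, a < t -> t < a + tau -> t \notin i).
  have [[t0 [at0 t0i]]|no] := pselect (exists t0, a < t0 /\ t0 \in i); last first.
    by exists 1 => //; right=> t at_ _; apply/negP => ti; apply: no; exists t.
  have [[t1 [at1 [t10 t1i]]]|no1] := pselect (exists t1, a < t1 /\ t1 < t0 /\ t1 \notin i).
    exists (t1 - a); first by rewrite subr_gt0.
    right=> t at_; rewrite addrCA subrr addr0 => tt1; apply/negP => ti.
    have := @interval_is_interval _ i _ _ ti t0i t1.
    by rewrite (ltW tt1) (ltW t10) => /(_ erefl); apply/negP.
  exists (t0 - a); first by rewrite subr_gt0.
  left=> t at_; rewrite addrCA subrr addr0 => tt1; apply: contrapT => /negP ti.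
  by apply: no1; exists t.
have [tau tau0 H] : exists2 tau, 0 < tau &
    (exists2 i, i \in s & forall t, a < t -> t < a + tau -> t \in (i : interval R)) \/
    (forall i, i \in s -> forall t, a < t -> t < a + tau -> t \notin (i : interval R)).
  elim: s {Ps} => [|i s [tau tau0 IH]]; first by exists 1 => //; right.
  have [tau' tau'0 H] := germ i.
  have m1 t : t < a + Num.min tau tau' -> t < a + tau /\ t < a + tau'.
    by move=> /lt_le_trans h; split; apply: h; rewrite lerD2l ge_min lexx ?orbT.
  exists (Num.min tau tau'); first by rewrite lt_min tau0.
  case: H => H; first by left; exists i; rewrite ?mem_head// => t at_ /m1[_]; exact: H.
  case: IH => [[j js IH]|IH].
    by left; exists j; rewrite ?inE ?js ?orbT// => t at_ /m1[+ _]; exact: IH.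
  right=> j; rewrite inE => /predU1P[->|js] t at_ /m1[t1 t2]; first exact: H.
  exact: IH.
exists tau => //; case: H => [[i is_ H]|H]; [left|right] => t at_ ta.
  by apply/Ps; exists i => //; exact: H.
by move=> /Ps[i is_]; apply/negP; exact: H.
Qed.

Lemma tame_finite (P : R -> Prop) : def P ->
  (exists c d, c < d /\ forall t, c < t -> t < d -> P t) \/
  exists s : seq R, forall t, P t -> t \in s.
Proof.
move=> /(omin_tame omD)[s Ps].
have {}Ps t : P t <-> exists2 i, i \in s & t \in (i : interval R).
  have := congr1 (fun S : set 'rV[R]_1 => S (t%:M)) Ps => /=.
  by rewrite !mxE eqxx mulr1n => ->.
have [[c [d [i [is_ [cd ci di]]]]]|no] := pselect (exists c d i, i \in s /\
    [/\ c < d, c \in (i : interval R) & d \in i]).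
  left; exists c, d; split=> // t ct td; apply/Ps; exists i => //.
  by apply: (@interval_is_interval _ i _ _ ci di t); rewrite (ltW ct) (ltW td).
right; have H : exists s' : seq R, forall t i, i \in s -> t \in (i : interval R) -> t \in s'.
  elim: s no {Ps} => [|i s IH] no; first by exists [::].
  have [|s' Hs'] := IH; first by move=> [c [d [j [js h]]]]; apply: no; exists c, d, j; rewrite inE js orbT.
  have [[t0 t0i]|no0] := pselect (exists t0, t0 \in i).
    exists (t0 :: s') => t j; rewrite !inE => /predU1P[->|js] tj; last by rewrite (Hs' t j)// orbT.
    apply/orP; left; apply/eqP; apply: contrapT => /eqP; rewrite neq_lt => /orP[] h; apply: no.
      by exists t, t0, i; rewrite mem_head.
    by exists t0, t, i; rewrite mem_head.
  exists s' => t j; rewrite inE => /predU1P[->|js] tj; last exact: Hs' tj.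
  by case: no0; exists t.
by have [s' Hs'] := H; exists s' => t /Ps[i]; exact: Hs'.
Qed.

(** Otherwise every [S i] would meet (a, b) in a finite set by [tame_finite], and (a, b) would be
    countable, hence of Lebesgue measure 0. *)
Lemma countable_cover_interval (I : countType) (S : I -> R -> Prop) (a b : R) :
  (forall i, def (S i)) -> a < b ->
  (forall t, a < t -> t < b -> exists i, S i t) ->
  exists i c d, [/\ a <= c, c < d, d <= b & forall t, c < t -> t < d -> S i t].
Proof.
move=> dS ab cov; apply: contrapT => no.
have fin i : exists s : seq R, forall t, a < t -> t < b -> S i t -> t \in s.
  have dSi := dS i.
  have : def (fun t => S i t /\ a < t /\ t < b) by deft.
  move=> /tame_finite[[c [d [cd H]]]|[s Hs]]; last first.
    by exists s => t at_ tb St; exact: Hs.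
  exfalso; apply: no; exists i, c, d; split=> //.
  - rewrite leNgt; apply/negP => ca; pose e := Num.min a d.
    have e1 : c < e by rewrite lt_min ca.
    have e2 : e <= d by rewrite ge_min lexx orbT.
    have e3 : e <= a by rewrite ge_min lexx.
    by have [] : S i ((c + e) / 2) /\ a < (c + e) / 2 /\ (c + e) / 2 < b; [apply: H|]; lra.
  - rewrite leNgt; apply/negP => ca; pose e := Num.max b c.
    have e1 : c <= e by rewrite le_max lexx orbT.
    have e2 : e < d by rewrite gt_max ca.
    have e3 : b <= e by rewrite le_max lexx.
    by have [] : S i ((d + e) / 2) /\ a < (d + e) / 2 /\ (d + e) / 2 < b; [apply: H|]; lra.
  - by move=> t ct td; have [] := H _ ct td.
have [s Hs] := choice fin.
have cU : countable (\bigcup_(i in [set: I]) [set` s i]).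
  apply: bigcup_countable => [|i _]; first exact: countableP.
  exact/finite_set_countable/finite_seq.
have := @countable_lebesgue_measure0 R _ cU.
have sub : `]a, b[%classic `<=` \bigcup_(i in [set: I]) [set` s i].
  move=> t /=; rewrite in_itv/= => /andP[at_ tb].
  by have [i Si] := cov t at_ tb; exists i => //; exact: Hs.
have cI : countable `]a, b[%classic := sub_countable (subset_card_le sub) cU.
move=> _; have := @countable_lebesgue_measure0 R _ cI.
rewrite lebesgue_measure_itv/= lte_fin ab => /eqP.
by rewrite -EFinB eqe subr_eq0 eq_sym lt_eqF.
Qed.
End Tame.

(** * Definable choice and the Baire property *)

Section Choice.
Context (R : realType) (D : set_family R) (omD : o_minimal D).
Notation def := (@def R D _ _).
Notation dfun := (@dfun R D _ _ _ _).

Lemma def_slice T U {dT : dtype R T} {dU : dtype R U} (P : T -> U -> Prop) t :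
  def (fun z : T * U => P z.1 z.2) -> def (P t).
Proof. by move=> dP; apply: (@def_sub2 R D omD _ _ _ _ _ _ P (fun=> t) id) => //; deft. Qed.

Let nonneg_inf (S : R -> Prop) r0 : S r0 -> (forall r, S r -> 0 <= r) ->
  exists m, (forall r, S r -> m <= r) /\
            (forall m', (forall r, S r -> m' <= r) -> m' <= m).
Proof.
move=> S0 Sge; have hi : has_inf S.
  by split; [exists r0|exists 0 => r; exact: Sge].
exists (inf S); split=> [r Sr|m' lb]; first exact: (ge_inf hi.2 Sr).
by apply: lb_le_inf => //; exists r0.
Qed.

(* From a nonempty tame set of nonnegative numbers pick its least element or
   else the midpoint of the first interval (m, b), with b <= m + 1, that it
   contains. *)
Lemma def_choice_R T {dT : dtype R T} (P : T -> R -> Prop) :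
  def (fun z : T * R => P z.1 z.2) ->
  exists e : T -> R, dfun e /\ forall t, (exists r, P t r) -> P t (e t).
Proof.
(* [S t] folds [P t] onto the nonnegative half line, where an infimum exists; the sign is restored
   in [e']. *)
move=> dP; pose S t r := 0 <= r /\ (P t r \/ P t (- r)).
have dS : def (fun z : T * R => S z.1 z.2) by rewrite /S; deft.
pose M t m := (forall r : R, S t r -> m <= r) /\
  (forall m' : R, (forall r : R, S t r -> m' <= r) -> m' <= m).
have dM : def (fun z : T * R => M z.1 z.2) by rewrite /M; deft.
have uM t m m' : M t m -> M t m' -> m = m'.
  by move=> [h1 h2] [h3 h4]; apply/eqP; rewrite eq_le h2//= h4.
pose B t m b := m < b /\ b <= m + 1 /\ (forall x : R, m < x -> x < b -> S t x).
have dB : def (fun z : T * R * R => B z.1.1 z.1.2 z.2) by rewrite /B; deft.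
pose B' t m b := B t m b /\ forall b' : R, B t m b' -> b' <= b.
have dB' : def (fun z : T * R * R => B' z.1.1 z.1.2 z.2) by rewrite /B'; deft.
have uB t m b b' : B' t m b -> B' t m b' -> b = b'.
  by move=> [h1 h2] [h3 h4]; apply/eqP; rewrite eq_le h2//= h4.
pose G t r := exists m : R, M t m /\ ((S t m /\ r = m) \/
  (~ S t m /\ exists b : R, B' t m b /\ r + r = m + b)).
have dG : def (fun z : T * R => G z.1 z.2) by rewrite /G; deft.
have [|e [de He]] := dfun_skolem omD dG.
  move=> t r r' [m [Mm H]] [m' [Mm' H']]; have mm' := uM _ _ _ Mm Mm'; subst m'.
  case: H => [[Sm ->]|[nS [b [Bb rb]]]]; first by case: H' => [[_ ->]|[//]].
  by case: H' => [[//]|[_ [b' [Bb' rb']]]]; have := uB _ _ _ _ Bb Bb'; lra.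
have SG t : (exists r, S t r) -> exists r, G t r /\ S t r.
  move=> [r0 Sr0]; have [|m Mm] := nonneg_inf Sr0; first by move=> r [].
  have [Sm|nSm] := pselect (S t m); first by exists m; split=> //; exists m; split=> //; left.
  have [tau tau0 [H|H]] := tame_germ omD m (def_slice t dS); last first.
    have [] : ~ (m + tau <= m) by lra.
    apply: Mm.2 => r Sr; rewrite leNgt; apply/negP => rm.
    have mr : m < r by rewrite lt_neqAle Mm.1// andbT; apply/eqP => mr; rewrite mr in nSm.
    exact: (H r mr rm Sr).
  have hs : has_sup [set b | B t m b].
    split; last by exists (m + 1) => b [_ []].
    exists (m + Num.min tau 1); split; first by rewrite ltrDl lt_min tau0/=.
    split; first by rewrite lerD2l ge_min lexx orbT.
    move=> x mx /lt_le_trans xm; apply: H => //; apply: xm.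
    by rewrite lerD2l ge_min lexx.
  pose b := sup [set b | B t m b].
  have Bb : B t m b.
    split; first by case: hs.1 => b0 Bb0; apply: lt_le_trans (ub_le_sup hs.2 Bb0); case: Bb0.
    split; first by apply: ge_sup => // [|b' [_ []//]]; exact: hs.1.
    by move=> x mx /(sup_gt hs.1)[b' [_ [_ Hb']] xb']; exact: Hb'.
  exists ((m + b) / 2); split.
    exists m; split=> //; right; split=> //; exists b; split; last by lra.
    by split=> // b' Bb'; exact: (ub_le_sup hs.2 Bb').
  by case: Bb => mb [_]; apply; lra.
pose e' t := if pselect (P t (e t)) then e t else - e t.
exists e'; split.
  refine (dfun_graph (G := fun t r => (P t (e t) /\ r = e t) \/ (~ P t (e t) /\ r = - e t)) _ _).
    by move=> t r; rewrite /e'; case: pselect => h; split=> [[[]|[]]|->] //; [left|right].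
  deft.
move=> t [r Pr]; have /SG[r' [Gr' Sr']] : exists r, S t r.
  exists `|r|; split=> //; have [r0|r0] := leP 0 r; first by rewrite ger0_norm//; left.
  by rewrite ltr0_norm// opprK; right.
have -> : e' t = if pselect (P t (e t)) then e t else - e t by [].
have Ge := He t (ex_intro _ _ Gr').
have : S t (e t).
  case: (Ge) => m [Mm [[Sm ->//]|[nS [b [Bb rb]]]]].
  by case: (Bb) => -[mb [_ Hb]] _; apply: Hb; lra.
by case: pselect => // nP [_ []].
Qed.

Lemma dfun_row_mx T {dT : dtype R T} m n (f : T -> 'rV[R]_m) (g : T -> 'rV[R]_n) :
  dfun f -> dfun g -> dfun (fun t => row_mx (f t) (g t)).
Proof.
move=> df dg; apply: (dfun_rV omD) => i; case: (splitP i) => j ij.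
  have -> : i = lshift n j by exact: val_inj.
  by apply: (dfun_eq (f := fun t => f t 0 j)); [deft|move=> t; rewrite row_mxEl].
have -> : i = rshift m j by exact: val_inj.
by apply: (dfun_eq (f := fun t => g t 0 j)); [deft|move=> t; rewrite row_mxEr].
Qed.

Lemma dfun_scalar T {dT : dtype R T} (f : T -> R) :
  dfun f -> dfun (fun t => (f t)%:M : 'rV[R]_1).
Proof.
move=> df; apply: (dfun_rV omD) => i; apply: (dfun_eq df) => t.
by rewrite ord1 !mxE eqxx mulr1n.
Qed.

(** Coordinates are chosen one at a time: by induction the tail, for which some first coordinate
    exists, and then that coordinate by [def_choice_R]. *)
Lemma def_choice T U {dT : dtype R T} {dU : dtype R U} (P : T -> U -> Prop) :
  def (fun z : T * U => P z.1 z.2) ->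
  exists e : T -> U, dfun e /\ forall t, (exists u, P t u) -> P t (e t).
Proof.
have rV n : forall T (dT : dtype R T) (P : T -> 'rV[R]_n -> Prop),
    def (fun z : T * 'rV[R]_n => P z.1 z.2) ->
    exists e : T -> 'rV[R]_n, dfun e /\ forall t, (exists u, P t u) -> P t (e t).
  elim: n => [|n IH] {}T {}dT {}P dP.
    exists (fun=> 0); split=> [|t [u]]; first by deft.
    by rewrite (thinmx0 u).
  pose Q t v := exists r : R, P t (row_mx (r%:M : 'rV_1) v : 'rV[R]_(1 + n)).
  have drow : dfun (fun z : R * 'rV[R]_n => row_mx (z.1%:M : 'rV_1) z.2 : 'rV[R]_n.+1).
    by refine (@dfun_row_mx _ _ 1 _ _ _ _ _); [apply: dfun_scalar|]; deft.
  have dQ : def (fun z : T * 'rV[R]_n => Q z.1 z.2).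
    apply: (def_ex omD); apply: (def_sub2 omD (P := P)) => //; first by deft.
    refine (dfun_comp omD (f := fun z : T * 'rV[R]_n * R => (z.2, z.1.2)) drow _).
    deft.
  have [e [de He]] := IH _ _ _ dQ.
  have dQ' : def (fun z : T * R => P z.1 (row_mx (z.2%:M : 'rV_1) (e z.1) : 'rV[R]_n.+1)).
    apply: (def_sub2 omD (P := P)) => //; first by deft.
    refine (dfun_comp omD (f := fun z : T * R => (z.2, e z.1)) drow _).
    deft.
  have [e2 [de2 He2]] := def_choice_R
    (P := fun t r => P t (row_mx (r%:M : 'rV_1) (e t) : 'rV[R]_n.+1)) dQ'.
  exists (fun t => row_mx ((e2 t)%:M : 'rV_1) (e t) : 'rV[R]_(1 + n)); split.
    refine (dfun_comp omD (f := fun t => (e2 t, e t)) drow _); deft.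
  move=> t [u Pu]; apply: He2; apply: He.
  exists (rsubmx (u : 'rV[R]_(1 + n))).
  exists (lsubmx (u : 'rV[R]_(1 + n)) 0 0).
  by rewrite [_%:M](_ : _ = lsubmx (u : 'rV[R]_(1 + n))) ?hsubmxK//; exact: scalar_decK.
move=> dP; have ddec : dfun (dec : 'rV[R]_(dim R U) -> U).
  apply: (@dfun_coord R D omD 'rV[R]_(dim R U) U _ _ dec id) => v i.
  by rewrite decK.
have [|e [de He]] := rV _ _ _ (fun t v => P t (dec v)).
  by apply: (def_sub2 omD (P := P)) => //; [deft|refine (dfun_comp omD ddec _); deft].
exists (fun t => dec (e t)); split; first by refine (dfun_comp omD ddec _); deft.
by move=> t [u Pu]; apply: He; exists (enc u); rewrite encK.
Qed.

Lemma rat_between (a b : R) : a < b ->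
  exists q1 q2 : rat, a < ratr q1 /\ ratr q1 < ratr q2 :> R /\ ratr q2 < b.
Proof.
move=> ab; have [q1 ] := rat_in_itvoo ab; rewrite in_itv/= => /andP[h1 h2].
have [q2 ] := rat_in_itvoo h2; rewrite in_itv/= => /andP[h3 h4].
by exists q1, q2.
Qed.

(* The o-minimal Baire property. *)
Lemma definable_baire d (I : countType) (S : I -> 'rV[R]_d -> Prop) x0 (r0 : R) :
  (forall i, def (S i)) -> 0 < r0 ->
  (forall x, `|x - x0| < r0 -> exists i, S i x) ->
  exists i y r, 0 < r /\
    forall x, `|x - y| < r -> `|x - x0| < r0 /\ S i x.
Proof.
elim: d I S x0 r0 => [|d IH] I S x0 r0 dS r00 cov.
  have [|i Si] := cov x0; first by rewrite subrr normr0.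
  by exists i, x0, r0; split=> // x xr; split=> //; rewrite (thinmx0 x) -(thinmx0 x0).
pose cons (t : R) (v : 'rV[R]_d) : 'rV[R]_d.+1 := row_mx (t%:M : 'rV_1) v.
have dcons : dfun (fun z : R * 'rV[R]_d => cons z.1 z.2).
  by refine (@dfun_row_mx _ _ 1 _ _ _ _ _); [apply: dfun_scalar|]; deft.
pose t0 := lsubmx (x0 : 'rV[R]_(1 + d)) 0 0.
pose v0 := rsubmx (x0 : 'rV[R]_(1 + d)).
have consE x : cons (lsubmx (x : 'rV[R]_(1 + d)) 0 0) (rsubmx (x : 'rV[R]_(1 + d))) = x.
  by rewrite /cons [_%:M](_ : _ = lsubmx (x : 'rV[R]_(1 + d))) ?hsubmxK//; exact: scalar_decK.
have consB t t' v v' (r : R) : `|cons t v - cons t' v'| < r <->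
    `|t - t'| < r /\ `|v - v'| < r.
  have -> : cons t v - cons t' v' = cons (t - t') (v - v').
    apply/rowP => i; rewrite /cons !mxE; case: splitP => j _; rewrite !mxE//.
    by rewrite ord1 eqxx !mulr1n.
  have consl a b : cons a b 0 (lshift d (0 : 'I_1)) = a.
    by apply: etrans (row_mxEl _ _ _ _) _; rewrite !mxE.
  have consr a b j : cons a b 0 (rshift 1 j) = b 0 j.
    exact: etrans (row_mxEr _ _ _ _) _.
  split=> [/rV_norm_lt[r1 H]|[H1 /rV_norm_lt[r1 H2]]].
    split; first by have := H (lshift d (0 : 'I_1)); rewrite consl.
    by apply/rV_norm_lt; split=> // i; have := H (rshift 1 i); rewrite consr.
  apply/rV_norm_lt; split=> // i; case: (splitP (i : 'I_(1 + d))) => j ij.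
    by rewrite (_ : i = lshift d (0 : 'I_1)) ?consl//; apply: val_inj; apply: etrans ij _; rewrite ord1.
  by rewrite (_ : i = rshift 1 j) ?consr//; exact: val_inj.
(* On every vertical line some [S i] contains an interval with rational ends. With these ends added
   the index is still countable, so the induction hypothesis makes index and ends constant for [v]
   in a box. *)
pose S' (k : I * (rat * rat)) (v : 'rV[R]_d) := forall t : R,
  ratr k.2.1 < t -> t < ratr k.2.2 ->
  ratr k.2.1 < ratr k.2.2 :> R /\ `|t - t0| < r0 /\ S k.1 (cons t v).
have dS' k : def (fun v => ratr k.2.1 < ratr k.2.2 :> R /\ S' k v).
  by rewrite /S'; have dSk := dS k.1; deft.
have [v vr0|k [v1 [r1 [r10 H]]]] := IH _ _ v0 r0 dS' r00.
  have dSt i : def (fun t => S i (cons t v)).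
    by have dSi := dS i; deft.
  have [|t th1 th2|i [c [d' [tc cd td H]]]] :=
      countable_cover_interval (a := t0 - r0) (b := t0 + r0) omD dSt.
  - lra.
  - apply: cov; rewrite -(consE x0); apply/consB; split=> //.
    by rewrite -/t0 ltr_norml; lra.
  have [q1 [q2 [cq1 [q12 q2d]]]] := rat_between cd.
  exists (i, (q1, q2)); split=> //= t qt tq; split=> //; split; last by apply: H; lra.
  by rewrite ltr_norml; lra.
have [] := H v1; first by rewrite subrr normr0.
move=> _ [q12 _].
pose q1 := ratr k.2.1 : R; pose q2 := ratr k.2.2 : R.
exists k.1, (cons ((q1 + q2) / 2) v1), (Num.min r1 ((q2 - q1) / 2)).
split; first by rewrite lt_min r10 /q1 /q2; lra.
move=> x; rewrite -(consE x) => /consB[].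
set t := lsubmx _ 0 0; set v := rsubmx _.
rewrite !lt_min => /andP[_ +] /andP[vr _].
rewrite ltr_norml => /andP[tq1 tq2].
have [vr0 [_ /(_ t)[||_ [tr0 St]]]] := H v vr.
- by rewrite -/q1; lra.
- by rewrite -/q2; lra.
by split=> //; rewrite -(consE x0); apply/consB.
Qed.
End Choice.

(** * Strict differentiability *)

Section StrictDifferentiability.
Context (R : realType).

Definition bounded_linear (V W : normedModType R) (L : V -> W) :=
  (forall a u v, L (a *: u + v) = a *: L u + L v) /\
  exists K, 0 <= K /\ forall u, `|L u| <= K * `|u|.

(* Strict differentiability; at all points of an open set this is the same as
   being C^1, and unlike the latter it makes sense pointwise. *)
Definition strict_diff (V W : normedModType R) (f : V -> W) (x : V) (L : V -> W) :=
  bounded_linear L /\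
  forall e, 0 < e -> exists2 r, 0 < r & forall a b, `|a - x| < r -> `|b - x| < r ->
    `|f b - f a - L (b - a)| <= e * `|b - a|.

Definition cont_at (V W : normedModType R) (f : V -> W) (x : V) :=
  forall e, 0 < e -> exists2 r, 0 < r & forall z, `|z - x| < r -> `|f z - f x| < e.

(** Takes the place of compactness of [a, b] in mean value inequalities and in arguments along arcs.
    Let m be the supremum of the t such that P holds on [a, t]: the left-hand condition gives P m,
    and the right-hand one excludes m < b. *)
Lemma real_induction (P : R -> Prop) (a b : R) : a <= b -> P a ->
  (forall t, a <= t -> t < b -> P t -> exists2 r, 0 < r & forall s, t < s -> s < t + r -> P s) ->
  (forall t, a < t -> t <= b -> (forall s, a <= s -> s < t -> P s) -> P t) ->
  P b.
Proof.
move=> ab Pa Pr Pl; pose S := [set t | a <= t /\ t <= b /\ forall s, a <= s -> s <= t -> P s].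
have Sa : S a by split=> //; split=> // s s1 s2; rewrite (_ : s = a)//; apply: le_anti; rewrite s1 s2.
have hS : has_sup S by split; [exists a|exists b => t [_ []]].
pose m := sup S; have am : a <= m by exact: (ub_le_sup hS.2 Sa).
have mb : m <= b by apply: ge_sup => [|t [_ []//]]; exact: hS.1.
have Plt s : a <= s -> s < m -> P s.
  by move=> as_ /(sup_gt hS.1)[t [_ [_ H]] st]; apply: H => //; exact: ltW.
have Pm : P m by have [<-//|am'] := eqVneq a m; apply: Pl => //; rewrite lt_neqAle am'.
have [<-//|mb'] := eqVneq m b; have {}mb' : m < b by rewrite lt_neqAle mb'.
have [r r0 H] := Pr m am mb' Pm.
pose t := Num.min b (m + r / 2).
have mt : m < t by rewrite lt_min mb'/=; lra.
have tr : t <= m + r / 2 by rewrite ge_min lexx orbT.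
have : S t.
  split; first by lra.
  split=> [|s as_ st]; first by rewrite ge_min lexx.
  have [sm|ms] := ltP s m; first exact: Plt.
  have [<-//|ms'] := eqVneq m s.
  by apply: H; [rewrite lt_neqAle ms'|lra].
by move=> /(ub_le_sup hS.2); rewrite -/m leNgt mt.
Qed.

(** Only right difference quotients are bounded, since tame germs provide one-sided limits only;
    continuity from the left closes the real induction. *)
Lemma dini_mean_value (phi : R -> R) (a b M : R) : a <= b ->
  (forall t, a < t -> t <= b -> forall e, 0 < e -> exists2 r, 0 < r &
     forall s, t - r < s -> s < t -> `|phi s - phi t| < e) ->
  (forall t, a <= t -> t < b -> exists2 r, 0 < r &
     forall s, t < s -> s < t + r -> phi s - phi t <= M * (s - t)) ->
  phi b - phi a <= M * (b - a).
Proof.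
move=> ab cphi dphi.
apply: (@real_induction (fun t => phi t - phi a <= M * (t - a)) a b) => //.
- by rewrite !subrr mulr0.
- move=> t at_ tb Pt; have [r r0 H] := dphi t at_ tb; exists r => // s ts sr.
  by have := H s ts sr; lra.
- move=> t at_ tb Ps; apply/ler_addgt0Pl => e e0.
  have e20 : 0 < e / 2 by lra.
  have [r r0 H] := cphi t at_ tb _ e20.
  have M0 : 0 < e / 2 / (`|M| + 1) by rewrite divr_gt0// ltr_wpDl.
  pose q := Num.min (Num.min r (t - a)) (e / 2 / (`|M| + 1)); pose s := t - q / 2.
  have q0 : 0 < q by rewrite !lt_min r0 subr_gt0 at_ M0.
  have q1 : q <= r by rewrite !ge_min lexx.
  have q2 : q <= t - a by rewrite !ge_min lexx orbT.
  have q3 : q * (`|M| + 1) <= e / 2 by rewrite -ler_pdivlMr ?ltr_wpDl// !ge_min lexx orbT.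
  have st : s < t by rewrite /s; lra.
  have : `|phi s - phi t| < e / 2 by apply: H => //; rewrite /s; lra.
  rewrite ltr_norml => /andP[h1 h2].
  have h3 : phi s - phi a <= M * (s - a) by apply: Ps => //; rewrite /s; lra.
  have h4 : M * (s - t) <= e / 2.
    apply: le_trans (ler_norm _) _; rewrite normrM.
    have -> : `|s - t| = q / 2 by rewrite /s distrC opprB addrCA subrr addr0 gtr0_norm//; lra.
    have := normr_ge0 M; nra.
  have -> : M * (t - a) = M * (s - a) - M * (s - t) by ring.
  have : - (e / 2) <= M * (t - s).
    rewrite lerNl -mulrN opprB//.
  lra.
Qed.
End StrictDifferentiability.

(** * Calculus of strict derivatives *)

Section StrictDiffCalculus.
Context (R : realType).
Implicit Types V W : normedModType R.

Lemma bounded_linear0 V W (L : V -> W) : bounded_linear L -> L 0 = 0.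
Proof.
move=> [lin _]; have := lin 1 0 0; rewrite !scale1r addr0 => /eqP.
by rewrite -subr_eq subrr eq_sym => /eqP.
Qed.

Lemma bounded_linearD V W (L : V -> W) u v : bounded_linear L -> L (u + v) = L u + L v.
Proof. by move=> [lin _]; have := lin 1 u v; rewrite !scale1r. Qed.

Lemma bounded_linearZ V W (L : V -> W) a u : bounded_linear L -> L (a *: u) = a *: L u.
Proof. by move=> bL; have := bL.1 a u 0; rewrite (bounded_linear0 bL) !addr0. Qed.

Lemma bounded_linearN V W (L : V -> W) u : bounded_linear L -> L (- u) = - L u.
Proof. by move=> bL; rewrite -scaleN1r (bounded_linearZ _ _ bL) scaleN1r. Qed.

Lemma bounded_linearB V W (L : V -> W) u v : bounded_linear L -> L (u - v) = L u - L v.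
Proof. by move=> bL; rewrite (bounded_linearD _ _ bL) (bounded_linearN _ bL). Qed.

Lemma strict_diff_lipschitz V W (f : V -> W) x L : strict_diff f x L ->
  exists K r, [/\ 0 < K, 0 < r & forall a b, `|a - x| < r -> `|b - x| < r ->
    `|f b - f a| <= K * `|b - a|].
Proof.
move=> [[lin [K [K0 LK]]] /(_ 1 ltr01)[r r0 H]]; exists (K + 1), r.
split=> //; first by lra.
move=> a b ax bx; rewrite -[f b - f a](subrK (L (b - a))).
apply: le_trans (ler_normD _ _) _.
by have := H a b ax bx; have := LK (b - a); lra.
Qed.

Lemma strict_diff_cont V W (f : V -> W) x L : strict_diff f x L -> cont_at f x.
Proof.
move=> /strict_diff_lipschitz[K [r [K0 r0 H]]] e e0.
exists (Num.min r (e / K)); first by rewrite lt_min r0 divr_gt0.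
move=> z; rewrite lt_min => /andP[zr ze].
apply: le_lt_trans (H x z _ zr) _; first by rewrite subrr normr0.
by rewrite mulrC -ltr_pdivlMr.
Qed.

Lemma bounded_linear_cst0 V W : bounded_linear (fun _ : V => 0 : W).
Proof.
split=> [a u v|]; first by rewrite scaler0 addr0.
by exists 0; split=> // u; rewrite normr0 mul0r.
Qed.

Lemma strict_diff_cst V W (c : W) (x : V) : strict_diff (fun=> c) x (fun=> 0).
Proof.
split; first exact: bounded_linear_cst0.
move=> e e0; exists 1 => // a b _ _; rewrite !subrr normr0.
by rewrite mulr_ge0// ltW.
Qed.

Lemma strict_diff_linear V W (L : V -> W) x : bounded_linear L -> strict_diff L x L.
Proof.
move=> bL; split=> // e e0; exists 1 => // a b _ _.
by rewrite (bounded_linearB _ _ bL) subrr normr0 mulr_ge0// ltW.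
Qed.

Lemma bounded_linear_id V : bounded_linear (fun u : V => u).
Proof. by split=> //; exists 1; split=> // u; rewrite mul1r. Qed.

Lemma strict_diff_id V (x : V) : strict_diff (fun x => x) x (fun u => u).
Proof. exact/strict_diff_linear/bounded_linear_id. Qed.

Lemma strict_diff_comp (U : normedModType R) V W (g : V -> W) (f : U -> V) x Lg Lf :
  strict_diff f x Lf -> strict_diff g (f x) Lg ->
  strict_diff (fun z => g (f z)) x (fun u => Lg (Lf u)).
Proof.
move=> dfx [bLg Hg]; have [K [r1 [K0 r10 lipf]]] := strict_diff_lipschitz dfx.
have cf := strict_diff_cont dfx; have [bLf Hf] := dfx.
have [Kg [Kg0 HKg]] := bLg.2; have [Kf [Kf0 HKf]] := bLf.2.
split.
  split=> [a u v|]; first by rewrite bLf.1 bLg.1.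
  exists (Kg * Kf); split=> [|u]; first exact: mulr_ge0.
  by apply: le_trans (HKg _) _; rewrite -mulrA ler_wpM2l.
move=> e e0.
have eK0 : 0 < e / 2 / K by rewrite divr_gt0// divr_gt0.
have eKg0 : 0 < e / 2 / (Kg + 1) by rewrite divr_gt0// ?divr_gt0//; lra.
have [r2 r20 H2] := Hg _ eK0; have [r3 r30 H3] := cf _ r20.
have [r4 r40 H4] := Hf _ eKg0.
exists (Num.min (Num.min r1 r3) r4); first by rewrite !lt_min r10 r30.
move=> a b; rewrite !lt_min => /andP[/andP[a1 a3] a4] /andP[/andP[b1 b3] b4].
have -> : g (f b) - g (f a) - Lg (Lf (b - a)) =
   (g (f b) - g (f a) - Lg (f b - f a)) + Lg (f b - f a - Lf (b - a)).
  by rewrite [Lg (_ - Lf _)](bounded_linearB _ _ bLg) addrA subrK.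
apply: le_trans (ler_normD _ _) _.
have h1 := H2 _ _ (H3 a a3) (H3 b b3).
have h2 := lipf a b a1 b1.
have h3 : `|Lg (f b - f a - Lf (b - a))| <= Kg * (e / 2 / (Kg + 1) * `|b - a|).
  by apply: le_trans (HKg _) _; rewrite ler_wpM2l//; exact: H4.
have h4 : e / 2 / K * `|f b - f a| <= e / 2 * `|b - a|.
  have -> : e / 2 * `|b - a| = e / 2 / K * (K * `|b - a|) by field; rewrite gt_eqF.
  by rewrite ler_pM2l.
have h5 : Kg * (e / 2 / (Kg + 1) * `|b - a|) <= e / 2 * `|b - a|.
  rewrite mulrA ler_wpM2r// mulrA -[leRHS]mul1r ler_pdivrMr; last by lra.
  have := mulr_gt0 e0 ltr01; nra.
lra.
Qed.

Lemma strict_diff_ext V W (f g : V -> W) x L r : 0 < r ->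
  (forall z, `|z - x| < r -> f z = g z) -> strict_diff f x L -> strict_diff g x L.
Proof.
move=> r0 fg [bL H]; split=> // e e0; have [r1 r10 H1] := H e e0.
exists (Num.min r r1); first by rewrite lt_min r0.
move=> a b; rewrite !lt_min => /andP[ar ar1] /andP[br br1].
by rewrite -!fg//; exact: H1.
Qed.

Lemma strict_diff_eqL V W (f : V -> W) x L L' : L =1 L' ->
  strict_diff f x L -> strict_diff f x L'.
Proof. by move=> /funext ->. Qed.

Lemma strict_diff_add V W (f g : V -> W) x Lf Lg :
  strict_diff f x Lf -> strict_diff g x Lg ->
  strict_diff (fun z => f z + g z) x (fun u => Lf u + Lg u).
Proof.
move=> [[lf [Kf [Kf0 HKf]]] Hf] [[lg [Kg [Kg0 HKg]]] Hg]; split.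
  split=> [a u v|]; first by rewrite lf lg scalerDr addrACA.
  exists (Kf + Kg); split=> [|u]; first by rewrite addr_ge0.
  by rewrite mulrDl (le_trans (ler_normD _ _))// lerD.
move=> e e0; have e20 : 0 < e / 2 by lra.
have [r1 r10 H1] := Hf _ e20; have [r2 r20 H2] := Hg _ e20.
exists (Num.min r1 r2); first by rewrite lt_min r10.
move=> a b; rewrite !lt_min => /andP[ar ar1] /andP[br br1].
have -> : f b + g b - (f a + g a) - (Lf (b - a) + Lg (b - a)) =
  (f b - f a - Lf (b - a)) + (g b - g a - Lg (b - a)).
  by rewrite !opprD !addrA [LHS](ACl (1*3*5*2*4*6)).
by apply: le_trans (ler_normD _ _) _; have := H1 a b ar br; have := H2 a b ar1 br1; lra.
Qed.

Lemma strict_diff_opp V W (f : V -> W) x L :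
  strict_diff f x L -> strict_diff (fun z => - f z) x (fun u => - L u).
Proof.
move=> dfx; apply: (@strict_diff_comp _ _ _ (fun w : W => - w) f x (fun w => - w)) => //.
apply: strict_diff_linear; split=> [a u v|]; first by rewrite opprD scalerN.
by exists 1; split=> // u; rewrite normrN mul1r.
Qed.

Lemma strict_diff_sub V W (f g : V -> W) x Lf Lg :
  strict_diff f x Lf -> strict_diff g x Lg ->
  strict_diff (fun z => f z - g z) x (fun u => Lf u - Lg u).
Proof. by move=> hf /strict_diff_opp; exact: strict_diff_add. Qed.

Definition bounded_bilinear (U : normedModType R) V W (B : U -> V -> W) :=
  [/\ forall u a v w, B u (a *: v + w) = a *: B u v + B u w,
      forall v a u w, B (a *: u + w) v = a *: B u v + B w v &
      exists K, 0 <= K /\ forall u v, `|B u v| <= K * `|u| * `|v|].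

(** One product rule for products of functions, scalings, dot products and products with
    matrices. *)
Lemma strict_diff_bilinear (T U : normedModType R) V W (B : U -> V -> W) (f : T -> U) (g : T -> V) x Lf Lg :
  bounded_bilinear B -> strict_diff f x Lf -> strict_diff g x Lg ->
  strict_diff (fun z => B (f z) (g z)) x (fun u => B (Lf u) (g x) + B (f x) (Lg u)).
Proof.
move=> [Br Bl [K [K0 BK]]] dfx dgx.
have Brb u v w : B u (v - w) = B u v - B u w.
  by have := Br u (-1) w v; rewrite !scaleN1r ![- _ + _]addrC.
have Blb u v w : B (u - w) v = B u v - B w v.
  by have := Bl v (-1) w u; rewrite !scaleN1r ![- _ + _]addrC.
have [K1 [r1 [K10 r10 H1]]] := strict_diff_lipschitz dfx.
have [K2 [r2 [K20 r20 H2]]] := strict_diff_lipschitz dgx.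
have cf := strict_diff_cont dfx; have cg := strict_diff_cont dgx.
case: dfx => [[lf [Kf [Kf0 HKf]]] Hf]; case: dgx => [[lg [Kg [Kg0 HKg]]] Hg].
split.
  split=> [a u v|]; first by rewrite lf lg Br Bl scalerDr addrACA.
  exists (K * Kf * `|g x| + K * `|f x| * Kg); split=> [|u].
    by rewrite addr_ge0// !mulr_ge0.
  apply: le_trans (ler_normD _ _) _; rewrite mulrDl lerD//.
    apply: le_trans (BK _ _) _; rewrite [leRHS]mulrAC ler_wpM2r//.
    by rewrite -mulrA ler_wpM2l.
  by apply: le_trans (BK _ _) _; rewrite -[leRHS]mulrA ler_wpM2l// mulr_ge0.
move=> e e0; pose c := `|g x| + 1 + Kf + (`|f x| + 1) + Kg.
have c0 : 0 <= c by rewrite /c !addr_ge0.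
have M0 : 0 < K * c + 1 by rewrite ltr_wpDl// mulr_ge0.
pose eta := e / (K * c + 1); have eta0 : 0 < eta by rewrite divr_gt0.
have [s1 s10 S1] := Hf _ eta0; have [s2 s20 S2] := Hg _ eta0.
have [s3 s30 S3] := cf _ eta0; have [s4 s40 S4] := cg _ eta0.
have [s5 s50 S5] := cf _ ltr01; have [s6 s60 S6] := cg _ ltr01.
exists (Num.min (Num.min (Num.min s1 s2) (Num.min s3 s4)) (Num.min s5 s6)).
  by rewrite !lt_min s10 s20 s30 s40 s50.
move=> a b; rewrite !lt_min => /andP[/andP[/andP[a1 a2] /andP[a3 a4]] /andP[a5 a6]].
move=> /andP[/andP[/andP[b1 b2] /andP[b3 b4]] /andP[b5 b6]].
set h := b - a.
have gb : `|g b| <= `|g x| + 1.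
  by rewrite -[g b](subrK (g x)) (le_trans (ler_normD _ _))// addrC lerD2l ltW// S6.
have fa : `|f a| <= `|f x| + 1.
  by rewrite -[f a](subrK (f x)) (le_trans (ler_normD _ _))// addrC lerD2l ltW// S5.
have -> : B (f b) (g b) - B (f a) (g a) - (B (Lf h) (g x) + B (f x) (Lg h)) =
   (B (f b - f a) (g b) - B (Lf h) (g x)) + (B (f a) (g b - g a) - B (f x) (Lg h)).
  rewrite addrACA -opprD; congr (_ - _).
  by rewrite Blb Brb addrA subrK.
have -> : B (f b - f a) (g b) - B (Lf h) (g x) =
    B (f b - f a - Lf h) (g b) + B (Lf h) (g b - g x).
  by rewrite [in RHS]Blb Brb addrA subrK.
have -> : B (f a) (g b - g a) - B (f x) (Lg h) =
    B (f a) (g b - g a - Lg h) + B (f a - f x) (Lg h).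
  by rewrite [in RHS]Brb [in RHS]Blb addrA subrK.
have T1 : `|B (f b - f a - Lf h) (g b)| <= K * eta * `|h| * (`|g x| + 1).
  apply: le_trans (BK _ _) _; apply: ler_pM => //; first exact: mulr_ge0.
  by rewrite -mulrA ler_wpM2l// S1.
have T2 : `|B (Lf h) (g b - g x)| <= K * eta * `|h| * Kf.
  apply: le_trans (BK _ _) _.
  have -> : K * eta * `|h| * Kf = K * (Kf * `|h|) * eta by ring.
  by apply: ler_pM; rewrite ?mulr_ge0 ?ler_wpM2l// ltW// S4.
have T3 : `|B (f a) (g b - g a - Lg h)| <= K * eta * `|h| * (`|f x| + 1).
  apply: le_trans (BK _ _) _.
  have -> : K * eta * `|h| * (`|f x| + 1) = K * (`|f x| + 1) * (eta * `|h|) by ring.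
  by apply: ler_pM; rewrite ?mulr_ge0 ?ler_wpM2l ?S2.
have T4 : `|B (f a - f x) (Lg h)| <= K * eta * `|h| * Kg.
  apply: le_trans (BK _ _) _.
  have -> : K * eta * `|h| * Kg = K * eta * (Kg * `|h|) by ring.
  by apply: ler_pM; rewrite ?mulr_ge0 ?ler_wpM2l// ltW// S3.
apply: le_trans (ler_normD _ _) _.
apply: le_trans (lerD (ler_normD _ _) (ler_normD _ _)) _.
apply: le_trans (lerD (lerD T1 T2) (lerD T3 T4)) _.
have -> : K * eta * `|h| * (`|g x| + 1) + K * eta * `|h| * Kf +
  (K * eta * `|h| * (`|f x| + 1) + K * eta * `|h| * Kg) = eta * (K * c) * `|h|.
  by rewrite /c; ring.
rewrite ler_wpM2r// /eta mulrAC ler_pdivrMr//.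
by have := ltW e0; nra.
Qed.

Lemma strict_diff_unique V W (f : V -> W) x L L' :
  strict_diff f x L -> strict_diff f x L' -> L =1 L'.
Proof.
move=> [bL H] [bL' H'] u; apply/eqP; rewrite -subr_eq0 -normr_le0.
apply/ler_addgt0Pl => e e0; rewrite addr0.
have u0 : 0 < `|u| + 1 by rewrite ltr_wpDl.
have e20 : 0 < e / 2 / (`|u| + 1) by rewrite !divr_gt0.
have [r r0 Hr] := H _ e20; have [r' r'0 Hr'] := H' _ e20.
pose t := Num.min r r' / 2 / (`|u| + 1).
have m0 : 0 < Num.min r r' by rewrite lt_min r0.
have t0 : 0 < t by rewrite !divr_gt0.
have tu : `|t *: u| < Num.min r r'.
  rewrite normrZ gtr0_norm// /t mulrAC ltr_pdivrMr//.
  by have := normr_ge0 u; nra.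
have h1 : `|f (x + t *: u) - f x - L (t *: u)| <= e / 2 / (`|u| + 1) * `|t *: u|.
  have := Hr x (x + t *: u); rewrite addrAC subrr add0r normr0; apply=> //.
  by apply: lt_le_trans tu _; rewrite ge_min lexx.
have h2 : `|f (x + t *: u) - f x - L' (t *: u)| <= e / 2 / (`|u| + 1) * `|t *: u|.
  have := Hr' x (x + t *: u); rewrite addrAC subrr add0r normr0; apply=> //.
  by apply: lt_le_trans tu _; rewrite ge_min lexx orbT.
have : `|L (t *: u) - L' (t *: u)| <= e / (`|u| + 1) * `|t *: u|.
  rewrite -[X in `|X|](subrKA (f (x + t *: u) - f x)).
  apply: le_trans (ler_normD _ _) _; rewrite distrC.
  have -> : e / (`|u| + 1) * `|t *: u| = e / 2 / (`|u| + 1) * `|t *: u| + e / 2 / (`|u| + 1) * `|t *: u|.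
    by field; rewrite gt_eqF.
  exact: lerD.
rewrite (bounded_linearZ _ _ bL) (bounded_linearZ _ _ bL') -scalerBr.
rewrite [`|t *: (_ - _)|]normrZ [`|t *: u|]normrZ (gtr0_norm t0) mulrCA ler_pM2l// => /le_trans; apply.
by rewrite mulrAC ler_pdivrMr// ler_pM2l// lerDl.
Qed.

(** The estimate at [x] already controls increments between points near [x]. On one small increment
    from [z] it is compared with the estimate at [z], which brings [L z] close to [L x]. *)
Lemma strict_diff_derivative_cont V W (f : V -> W) (L : V -> V -> W) x r :
  0 < r -> (forall z, `|z - x| < r -> strict_diff f z (L z)) ->
  forall e, 0 < e -> exists2 s, 0 < s & forall z, `|z - x| < s ->
    forall u, `|L z u - L x u| <= e * `|u|.
Proof.
move=> r0 H e e0; have [|bL /(_ (e / 2))[|s s0 Hs]] := H x; first by rewrite subrr normr0.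
  by lra.
exists (Num.min r s); first by rewrite lt_min r0.
move=> z; rewrite lt_min => /andP[zr zs] u.
have [bLz Hz] := H z zr.
apply/ler_addgt0Pl => d d0.
have u0 : 0 < `|u| + 1 by rewrite ltr_wpDl.
have d1 : 0 < d / (`|u| + 1) by rewrite divr_gt0.
have [s' s'0 Hs'] := Hz _ d1.
pose q := Num.min s' (s - `|z - x|).
have q0 : 0 < q by rewrite lt_min s'0 subr_gt0.
pose t := q / 2 / (`|u| + 1).
have t0 : 0 < t by rewrite !divr_gt0.
have tu : `|t *: u| < q.
  rewrite normrZ gtr0_norm// /t mulrAC ltr_pdivrMr//.
  by have := normr_ge0 u; nra.
have h1 : `|f (z + t *: u) - f z - L z (t *: u)| <= d / (`|u| + 1) * `|t *: u|.
  have := Hs' z (z + t *: u); rewrite addrAC subrr add0r normr0; apply=> //.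
  by apply: lt_le_trans tu _; rewrite ge_min lexx.
have h2 : `|f (z + t *: u) - f z - L x (t *: u)| <= e / 2 * `|t *: u|.
  have := Hs z (z + t *: u); rewrite [z + _ - z]addrAC subrr add0r; apply=> //.
  rewrite addrAC; apply: le_lt_trans (ler_normD _ _) _.
  have : `|t *: u| < s - `|z - x|.
    by apply: lt_le_trans tu _; rewrite ge_min lexx orbT.
  by lra.
have : `|L z (t *: u) - L x (t *: u)| <= (d / (`|u| + 1) + e / 2) * `|t *: u|.
  rewrite -[X in `|X|](subrKA (f (z + t *: u) - f z)).
  by apply: le_trans (ler_normD _ _) _; rewrite distrC mulrDl; exact: lerD.
rewrite (bounded_linearZ _ _ bL) (bounded_linearZ _ _ bLz) -scalerBr.
rewrite [`|t *: (_ - _)|]normrZ [`|t *: u|]normrZ (gtr0_norm t0) mulrCA ler_pM2l// mulrDl => /le_trans; apply.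
apply: lerD; first by rewrite mulrAC ler_pdivrMr// ler_pM2l// lerDl.
by rewrite ler_wpM2r//; lra.
Qed.
End StrictDiffCalculus.

(** * Generic differentiability *)

Section Generic.
Context (R : realType) (D : set_family R) (omD : o_minimal D).
Notation def := (@def R D _ _).
Notation dfun := (@dfun R D _ _ _ _).

(** An explicit ball instead of the neighbourhood filter, so that definability can be read off the
    formula. *)
Definition near_all d (x : 'rV[R]_d) (Q : 'rV[R]_d -> Prop) :=
  exists2 r, 0 < r & forall z, `|z - x| < r -> Q z.

(* [Q] holds on a dense open set. *)
Definition generic d (Q : 'rV[R]_d -> Prop) :=
  forall x0 r0, 0 < r0 -> exists y r, 0 < r /\
    forall x, `|x - y| < r -> `|x - x0| < r0 /\ Q x.

Lemma generic_and d (P Q : 'rV[R]_d -> Prop) :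
  generic P -> generic Q -> generic (fun x => P x /\ Q x).
Proof.
move=> gP gQ x0 r0 /(gP x0)[y [r [r1 H]]]; have [y' [r' [r'1 H']]] := gQ y r r1.
exists y', r'; split=> // x /H'[xy Qx]; have [] := H x xy.
by split.
Qed.

Lemma generic_mono d (P Q : 'rV[R]_d -> Prop) :
  (forall x, P x -> Q x) -> generic P -> generic Q.
Proof.
move=> PQ gP x0 r0 /(gP x0)[y [r [r1 H]]]; exists y, r; split=> // x /H[xr /PQ].
by split.
Qed.

Lemma generic_true d (Q : 'rV[R]_d -> Prop) : (forall x, Q x) -> generic Q.
Proof. by move=> allQ x0 r0 r00; exists x0, r0; split. Qed.

Lemma generic_forall_fin d (I : finType) (P : I -> 'rV[R]_d -> Prop) :
  (forall i, generic (P i)) -> generic (fun x => forall i, P i x).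
Proof.
move=> gP; have H : forall s : seq I, generic (fun x => forall i, i \in s -> P i x).
  elim=> [|i s IH]; first exact: generic_true.
  apply: generic_mono (generic_and (gP i) IH) => x [Pi Ps] j.
  by rewrite inE => /predU1P[->//|]; exact: Ps.
by apply: generic_mono (H (enum I)) => x Px i; apply: Px; rewrite mem_enum.
Qed.

Lemma ball_near d (y x : 'rV[R]_d) r : `|x - y| < r ->
  exists2 s, 0 < s & forall z, `|z - x| < s -> `|z - y| < r.
Proof.
move=> xy; exists (r - `|x - y|); first by rewrite subr_gt0.
move=> z zx; rewrite -(subrK x z) -addrA.
by apply: le_lt_trans (ler_normD _ _) _; lra.
Qed.

Lemma generic_near d (P : 'rV[R]_d -> Prop) :
  generic P -> generic (fun x => near_all x P).
Proof.
move=> gP x0 r0 /(gP x0)[y [r [r1 H]]]; exists y, r; split=> // x xy.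
split; first by have [] := H x xy.
have [s s0 Hs] := ball_near xy; exists s => // z /Hs /H[].
by [].
Qed.

Lemma generic_cover d (I : countType) (S : I -> 'rV[R]_d -> Prop) :
  (forall i, def (S i)) -> generic (fun x => exists i, S i x) ->
  generic (fun x => exists i, near_all x (S i)).
Proof.
move=> dS gS x0 r0 /(gS x0)[y [r [r1 H]]].
have [|i [y' [r' [r'0 H']]]] := definable_baire omD dS r1 (x0 := y).
  by move=> x /H[].
exists y', r'; split=> // x xy; split; first by have [/H[]] := H' x xy.
by exists i; have [s s0 Hs] := ball_near xy; exists s => // z /Hs /H'[].
Qed.

(** By the Baire property every box contains a box on which [Q] holds throughout or fails
    throughout; only the latter has to be excluded. *)
Lemma generic_def d (Q : 'rV[R]_d -> Prop) : def Q ->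
  (forall x0 r0, 0 < r0 -> (forall x, `|x - x0| < r0 -> ~ Q x) -> False) ->
  generic Q.
Proof.
move=> dQ H x0 r0 r00.
have [||[] [y [r [r1 Hr]]]] := @definable_baire R D omD d bool
   (fun b x => if b then Q x else ~ Q x) x0 r0 _ r00.
- by case; [|apply: (def_not omD)].
- by move=> x _; have [] := pselect (Q x); [exists true|exists false].
- by exists y, r.
- by exfalso; apply: (H y r r1) => x /Hr[].
Qed.

Lemma def_cont_atR d (g : 'rV[R]_d -> R) : dfun g ->
  def (fun x : 'rV[R]_d => cont_at (g : _ -> R^o) x).
Proof. by move=> dg; rewrite /cont_at; deft. Qed.

(** If [g] were discontinuous on a whole box, its jumps would be at least 1/(e+1) on a smaller one.
    Yet on a still smaller box [g] stays within half of that of a single rational number. *)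
Lemma generic_cont d (g : 'rV[R]_d -> R) : dfun g ->
  generic (fun x => cont_at (g : _ -> R^o) x).
Proof.
move=> dg; apply: generic_def; first exact: def_cont_atR.
move=> x0 r0 r00 ncont.
pose S (e : nat) (x : 'rV[R]_d) := forall r : R, 0 < r -> exists z : 'rV[R]_d,
  `|z - x| < r /\ e.+1%:R^-1 <= `|g z - g x|.
have dS e : def (S e) by rewrite /S; deft.
have [|e [y [r [r1 Hr]]]] := definable_baire omD dS r00 (x0 := x0).
  move=> x /ncont nc; apply: contrapT => nS; apply: nc => eps eps0.
  have [e0 he0] : exists e : nat, e.+1%:R^-1 < eps.
    have := @near_infty_natSinv_lt R (PosNum eps0).
    by case=> N _ /(_ N (leqnn N)) /= h; exists N.
  apply: contrapT => nr; apply: nS; exists e0 => r r1; apply: contrapT => nz.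
  apply: nr; exists r => // z zr; rewrite ltNge; apply/negP => h; apply: nz.
  by exists z; split=> //; exact: le_trans (ltW he0) h.
pose e1 : R := e.+1%:R^-1; have e10 : 0 < e1 by rewrite invr_gt0.
pose S' (q : rat) (x : 'rV[R]_d) := `|g x - ratr q| < e1 / 2.
have dS' q : def (S' q) by rewrite /S'; deft.
have [|q [y' [r' [r'1 Hr']]]] := definable_baire omD dS' r1 (x0 := y).
  move=> x _; have [|q] := @rat_in_itvoo R (g x - e1 / 2) (g x + e1 / 2); first lra.
  by rewrite in_itv/= => /andP[q1 q2]; exists q; rewrite /S' ltr_norml; lra.
have y'y' : `|y' - y'| < r' by rewrite subrr normr0.
have [y'y Sy'] := Hr' y' y'y'.
have [_ /(_ r' r'1)[z [zy' H]]] := Hr y' y'y.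
have [_ Sz] := Hr' z zy'.
move: Sz Sy'; rewrite /S' !ltr_norml => /andP[? ?] /andP[? ?].
have : `|g z - g y'| < e1 by rewrite ltr_norml; lra.
by rewrite ltNge H.
Qed.

(** By [tame_germ] the comparison of [h] with any constant is decided near [a]. The constants that
    end up below [h] form a half line [L]; it is everything, nothing, or its supremum is the
    limit. *)
Lemma tame_limit (h : R -> R) (a : R) : dfun h ->
  [\/ exists l, forall e, 0 < e -> exists2 r, 0 < r & forall t, a < t -> t < a + r -> `|h t - l| <= e,
      forall M, exists2 r, 0 < r & forall t, a < t -> t < a + r -> M <= h t |
      forall M, exists2 r, 0 < r & forall t, a < t -> t < a + r -> h t <= M].
Proof.
move=> dh; pose L c := exists2 r, 0 < r & forall t, a < t -> t < a + r -> c <= h t.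
have nL c : ~ L c -> exists2 r, 0 < r & forall t, a < t -> t < a + r -> h t <= c.
  move=> nLc; have [|r r0 [H|H]] := @tame_germ R D omD (fun t => c <= h t) a.
  - by deft.
  - by case: nLc; exists r.
  - by exists r => // t t1 t2; have /negP := H t t1 t2; rewrite -ltNge => /ltW.
have [allL|nall] := pselect (forall c, L c); first by constructor 2.
have [noL|someL] := pselect (forall c, ~ L c); first by constructor 3 => M; exact: nL.
have [c1 Lc1] : exists c, L c by apply: contrapT => h0; apply: someL => c Lc; apply: h0; exists c.
have [c2 nLc2] : exists c, ~ L c by apply: contrapT => h0; apply: nall => c; apply: contrapT => Lc; apply: h0; exists c.
have Lle c c' : L c -> c' <= c -> L c'.
  move=> [r r0 H] c'c; exists r => // t t1 t2; exact: le_trans c'c (H t t1 t2).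
have hs : has_sup L.
  split; first by exists c1.
  exists c2 => c Lc; rewrite leNgt; apply/negP => c2c; apply: nLc2.
  by apply: Lle Lc _; exact: ltW.
constructor 1; exists (sup L) => e e0.
have sLe : sup L - e < sup L by lra.
have [c Lc cs] := sup_gt hs.1 sLe.
have [r r0 H] := Lle _ _ Lc (ltW cs).
have [|r' r'0 H'] := nL (sup L + e).
  by move=> Lse; have := ub_le_sup hs.2 Lse; lra.
exists (Num.min r r'); first by rewrite lt_min r0.
move=> t t1 t2; have tr : t < a + r by apply: lt_le_trans t2 _; rewrite lerD2l ge_min lexx.
have tr' : t < a + r' by apply: lt_le_trans t2 _; rewrite lerD2l ge_min lexx orbT.
by rewrite ler_norml; have := H t t1 tr; have := H' t t1 tr'; lra.
Qed.
End Generic.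

(** * Partial derivatives and generic strict differentiability *)

Section GenericC1.
Context (R : realType) (D : set_family R) (omD : o_minimal D).
Notation def := (@def R D _ _).
Notation dfun := (@dfun R D _ _ _ _).

Lemma norm_scale_delta d (i : 'I_d) (t : R) : `|t *: (delta_mx 0 i : 'rV[R]_d)| <= `|t|.
Proof.
apply/rV_norm_le; split=> // j; rewrite !mxE eqxx/= normrM.
by case: (j == i); rewrite ?normr1 ?mulr1// normr0 mulr0.
Qed.

Definition right_partial d (g : 'rV[R]_d -> R) (i : 'I_d) (x : 'rV[R]_d) (l : R) :=
  forall e : R, 0 < e -> exists2 r : R, 0 < r & forall t : R, 0 < t -> t < r ->
    `|g (x + t *: delta_mx 0 i) - g x - l * t| <= e * t.

Lemma def_right_partial d (g : 'rV[R]_d -> R) i : dfun g ->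
  def (fun z : 'rV[R]_d * R => right_partial g i z.1 z.2).
Proof. by move=> dg; rewrite /right_partial; deft. Qed.

(** The factor [m], a sign in the applications, covers upper and lower bounds at once. *)
Lemma line_mean_value d (g : 'rV[R]_d -> R) i c (s m M : R) : 0 <= s ->
  (forall t, 0 <= t -> t <= s -> cont_at (g : _ -> R^o) (c + t *: delta_mx 0 i)) ->
  (forall t, 0 <= t -> t < s -> exists2 r, 0 < r & forall h, 0 < h -> h < r ->
     m * (g (c + t *: delta_mx 0 i + h *: delta_mx 0 i) - g (c + t *: delta_mx 0 i)) <= M * h) ->
  m * (g (c + s *: delta_mx 0 i) - g c) <= M * s.
Proof.
move=> s0 cg dg; pose phi t := m * g (c + t *: delta_mx 0 i).
have := @dini_mean_value R phi 0 s M s0; rewrite /phi subr0 scale0r addr0 -mulrBr; apply.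
- move=> t t0 ts e e0.
  have em : 0 < e / (`|m| + 1) by rewrite divr_gt0// ltr_wpDl.
  have [r r0 H] := cg t (ltW t0) ts _ em; exists r => // u ut tu.
  rewrite -mulrBr normrM; apply: le_lt_trans (_ : (`|m| + 1) * `|g (c + u *: delta_mx 0 i) - g (c + t *: delta_mx 0 i)| < _).
    by rewrite ler_wpM2r// lerDl.
  rewrite mulrC -ltr_pdivlMr ?ltr_wpDl//; apply: H.
  rewrite opprD addrACA subrr add0r -scalerBl.
  by apply: le_lt_trans (norm_scale_delta _ _) _; rewrite distrC gtr0_norm; lra.
- move=> t t0 ts; have [r r0 H] := dg t t0 ts; exists r => // u tu ur.
  have -> : c + u *: delta_mx 0 i = c + t *: delta_mx 0 i + (u - t) *: delta_mx 0 i.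
    by rewrite -addrA -scalerDl subrKC.
  by rewrite -mulrBr; apply: H; lra.
Qed.

Let not_steep d (g : 'rV[R]_d -> R) i y r (m : R) : 0 < r ->
  (forall x, `|x - y| < r -> cont_at (g : _ -> R^o) x) ->
  (forall x, `|x - y| < r -> forall M, exists2 s, 0 < s & forall h, 0 < h -> h < s ->
     m * (g (x + h *: delta_mx 0 i) - g x) <= M * h) -> False.
Proof.
move=> r0 cg sg; pose s := r / 2; have s0 : 0 < s by rewrite divr_gt0.
pose a := m * (g (y + s *: delta_mx 0 i) - g y).
have inb t : 0 <= t -> t <= s -> `|y + t *: delta_mx 0 i - y| < r.
  move=> t0 ts; rewrite addrAC subrr add0r.
  by apply: le_lt_trans (norm_scale_delta _ _) _; rewrite ger0_norm// /s in ts *; lra.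
(* Quotients are eventually below every [M]; the choice (a - 1) / s turns the mean value inequality
   into a <= a - 1. *)
have : a <= (a - 1) / s * s.
  apply: line_mean_value => [|t t0 ts|t t0 ts]; first exact: ltW.
    by apply: cg; exact: inb.
  by apply: sg; apply: inb => //; exact: ltW.
by rewrite divfK ?gt_eqF//; lra.
Qed.

(** Where no finite limit exists the difference quotient tends to plus or minus infinity by
    [tame_limit]. The Baire property fixes the sign on a box, and a mean value inequality on a
    segment refutes it. *)
Lemma generic_right_partial d (g : 'rV[R]_d -> R) i : dfun g ->
  generic (fun x => exists l, right_partial g i x l).
Proof.
move=> dg; apply: (generic_def omD).
  by have H := def_right_partial i dg; deft.
move=> x0 r0 /(generic_cont omD dg x0)[y [r [r1 Hr]]] nrd.
pose S (b : bool) (x : 'rV[R]_d) := forall M : R, exists2 s : R, 0 < s & forall h : R, 0 < h -> h < s ->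
   (-1) ^+ b * (g (x + h *: delta_mx 0 i) - g x) <= M * h.
have dS b : def (S b) by rewrite /S; deft.
have [|b [y' [r' [r'0 H]]]] := definable_baire omD dS r1 (x0 := y).
  move=> x /Hr[/nrd nx _].
  pose h (t : R) := (g (x + t *: delta_mx 0 i) - g x) / t.
  have dh : dfun h.
    rewrite /h; deft.
  have [[l Hl]|Hup|Hdn] := tame_limit omD 0 dh.
  - case: nx; exists l => e e0; have [s s0 Hs] := Hl e e0; exists s => // t t0 ts.
    have := Hs t t0; rewrite add0r => /(_ ts); rewrite /h => H.
    have -> : g (x + t *: delta_mx 0 i) - g x - l * t =
       ((g (x + t *: delta_mx 0 i) - g x) / t - l) * t by rewrite mulrBl divfK ?gt_eqF.
    by rewrite normrM (gtr0_norm t0) ler_pM2r.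
  - exists true => M; have [s s0 Hs] := Hup (- M); exists s => // t t0 ts.
    have := Hs t t0; rewrite add0r => /(_ ts); rewrite /h ler_pdivlMr//.
    by rewrite expr1 mulN1r; lra.
  - exists false => M; have [s s0 Hs] := Hdn M; exists s => // t t0 ts.
    have := Hs t t0; rewrite add0r => /(_ ts); rewrite /h ler_pdivrMr//.
    by rewrite expr0 mul1r.
apply: (@not_steep _ g i y' r' ((-1) ^+ b)) => // x xy.
  by have [xr _] := H x xy; have [] := Hr x xr.
by have [_] := H x xy.
Qed.

Lemma segment_mean_value d (g : 'rV[R]_d -> R) i c (s m e : R) : 0 <= s -> 0 < e ->
  (forall t, 0 <= t -> t <= s -> cont_at (g : _ -> R^o) (c + t *: delta_mx 0 i) /\
     exists l, right_partial g i (c + t *: delta_mx 0 i) l /\ `|l - m| <= e) ->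
  `|g (c + s *: delta_mx 0 i) - g c - m * s| <= 2 * e * s.
Proof.
move=> s0 e0 H.
have cg t : 0 <= t -> t <= s -> cont_at (g : _ -> R^o) (c + t *: delta_mx 0 i).
  by move=> t0 ts; have [] := H t t0 ts.
have step (b : bool) t : 0 <= t -> t < s -> exists2 r, 0 < r & forall h, 0 < h -> h < r ->
  (-1) ^+ b * (g (c + t *: delta_mx 0 i + h *: delta_mx 0 i) - g (c + t *: delta_mx 0 i)) <=
  ((-1) ^+ b * m + 2 * e) * h.
  move=> t0 /ltW ts; have [_ [l [Hl lm]]] := H t t0 ts.
  have [r r0 Hr] := Hl e e0; exists r => // h h0 hr; have := Hr h h0 hr.
  move: lm; rewrite !ler_norml => /andP[h1 h2] /andP[h3 h4].
  by case: b; rewrite ?expr1 ?expr0; nra.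
have := line_mean_value s0 cg (step true); have := line_mean_value s0 cg (step false).
by rewrite expr0 expr1 ler_norml; lra.
Qed.

(** Definable choice makes the right partial derivatives definable functions, and these are
    generically continuous; the classical argument along a staircase from [a] to [b] then
    applies. *)
Lemma generic_C1_fun d (g : 'rV[R]_d -> R) : dfun g ->
  generic (fun x => exists c : 'cV[R]_d,
    strict_diff (g : _ -> R^o) x (fun u => (u *m c) 0 0)).
Proof.
move=> dg; have ch i := def_choice omD (def_right_partial i dg).
have [G HG] := choice ch.
have dG i : dfun (G i) by have [] := HG i.
have G1 : generic (fun x => cont_at (g : _ -> R^o) x /\
   forall i, right_partial g i x (G i x) /\ cont_at (G i : _ -> R^o) x).
  apply: generic_and; first exact: (generic_cont omD).
  apply: generic_forall_fin => i; apply: generic_and; last exact: (generic_cont omD).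
  apply: generic_mono (generic_right_partial i dg) => x.
  by have [_] := HG i; exact.
apply: generic_mono (generic_near G1) => x [r r0 H].
have xr : `|x - x| < r by rewrite subrr normr0.
exists (\col_i G i x); have LE (u : 'rV[R]_d) : (u *m (\col_i G i x)) 0 0 = \sum_i u 0 i * G i x.
  by rewrite mxE; apply: eq_bigr => i _; rewrite mxE.
split.
  split=> [a u v|]; first by rewrite mulmxDl -scalemxAl !mxE.
  exists (\sum_i `|G i x|); split=> [|u]; first exact: sumr_ge0.
  rewrite LE mulr_suml; apply: le_trans (ler_norm_sum _ _ _) _.
  by apply: ler_sum => i _; rewrite normrM mulrC ler_wpM2l// rV_norm_coord.
(* Each of the [d] stairs costs 2 e1 |b - a|. *)
move=> e e0; pose e1 := e / 2 / (d%:R + 1).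
have d0 : 0 < d%:R + 1 :> R by rewrite ltr_wpDl.
have e10 : 0 < e1 by rewrite !divr_gt0.
have ex i : exists q, 0 < q /\ forall z, `|z - x| < q -> `|G i z - G i x| < e1.
  by have [_ /(_ i)[_ /(_ e1 e10)[q q0 Hq]]] := H x xr; exists q.
have [s Hs] := choice ex.
pose rho := Num.min r (\big[Num.min/1]_i s i).
have rho0 : 0 < rho.
  by rewrite lt_min r0; apply/bigmin_gtP; split=> // i _; have [] := Hs i.
exists rho => // a b ax bx.
(* The staircase: the first [j] coordinates are those of [b]. It stays in the ball around [x]
   because balls of the sup norm are boxes. *)
pose p (j : nat) : 'rV[R]_d := \row_i (if (i < j)%N then b 0 i else a 0 i).
have pS (i : 'I_d) : p i.+1 = p i + ((b - a) 0 i) *: delta_mx 0 i.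
  apply/rowP => j; rewrite !mxE eqxx/= ltnS leq_eqVlt.
  have [->|ji] := eqVneq j i; first by rewrite eqxx ltnn mulr1 subrKC.
  by rewrite (_ : (j == i :> nat) = false) ?mulr0 ?addr0//; apply/eqP => /val_inj/eqP; apply/negP.
have inb (c : 'rV[R]_d) (i : 'I_d) (t : R) : (forall j, c 0 j = a 0 j \/ c 0 j = b 0 j) ->
   (0 <= t /\ (c 0 i + t <= a 0 i \/ c 0 i + t <= b 0 i)) ->
   `|c + t *: delta_mx 0 i - x| < rho.
  move=> ca [t0 tc]; apply/rV_norm_lt; split=> // j; rewrite !mxE eqxx/=.
  have /rV_norm_lt[_ /(_ j)] := ax; have /rV_norm_lt[_ /(_ j)] := bx.
  rewrite !mxE !ltr_norml => /andP[b1 b2] /andP[a1 a2].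
  have [ji|ji] := eqVneq j i; last first.
    by rewrite mulr0 addr0; case: (ca j) => ->; apply/andP.
  by subst j; rewrite mulr1; case: (ca i) => cj; rewrite cj in tc *; case: tc => tc; apply/andP; lra.
have pab (i : nat) j : p i 0 j = a 0 j \/ p i 0 j = b 0 j.
  by rewrite mxE; case: ifP => _; [right|left].
have good c : `|c - x| < rho -> forall i, cont_at (g : _ -> R^o) c /\
    exists l, right_partial g i c l /\ `|l - G i x| <= e1.
  rewrite lt_min => /andP[cr cs] i.
  have [cg /(_ i)[Hr _]] := H c cr; split=> //; exists (G i c); split=> //.
  have [_ Hi] := Hs i; apply/ltW/Hi; apply: lt_le_trans cs _.
  exact: bigmin_le_cond.
have step (i : 'I_d) : `|g (p i.+1) - g (p i) - G i x * (b - a) 0 i| <= 2 * e1 * `|b - a|.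
  apply: le_trans (_ : 2 * e1 * `|(b - a) 0 i| <= _); last first.
    by rewrite ler_wpM2l ?rV_norm_coord// mulr_ge0// ltW.
  have [ba|ba] := leP 0 ((b - a) 0 i).
    rewrite (ger0_norm ba) pS; apply: (@segment_mean_value _ g i (p i) ((b - a) 0 i) (G i x) e1) => // t t0 ts; apply: good.
    apply: inb => //; split=> //; right; move: ts; rewrite !mxE ltnn; lra.
  (* Only right derivatives are available, so a stair with negative increment is walked backwards
     from [p i.+1]. *)
  have E : p i = p i.+1 + (- (b - a) 0 i) *: delta_mx 0 i.
    by rewrite pS -addrA -scalerDl subrr scale0r addr0.
  rewrite (ltr0_norm ba) {1}E -normrN.
  have -> : - (g (p i.+1) - g (p i.+1 + (- (b - a) 0 i) *: delta_mx 0 i) - G i x * (b - a) 0 i) =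
    g (p i.+1 + (- (b - a) 0 i) *: delta_mx 0 i) - g (p i.+1) - G i x * (- (b - a) 0 i) by ring.
  apply: (@segment_mean_value _ g i (p i.+1) (- (b - a) 0 i) (G i x) e1) => // [|t t0 ts]; first by lra.
  apply: good; apply: inb => //; split=> //; left; move: ts; rewrite !mxE ltnSn; lra.
have -> : g b - g a - ((b - a) *m (\col_i G i x)) 0 0 =
    \sum_(i < d) (g (p i.+1) - g (p i) - G i x * (b - a) 0 i).
  rewrite LE sumrB; congr (_ - _); last by apply: eq_bigr => i _; rewrite mulrC.
  rewrite -(big_mkord xpredT (fun i => g (p i.+1) - g (p i))) telescope_sumr//.
  have -> : p d = b by apply/rowP => i; rewrite mxE ltn_ord.
  by have -> : p 0%N = a by apply/rowP => i; rewrite mxE.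
apply: le_trans (ler_norm_sum _ _ _) _.
apply: le_trans (ler_sum _ (fun i _ => step i)) _.
rewrite sumr_const card_ord -[leLHS]mulr_natl [leLHS]mulrA ler_wpM2r//.
have -> : d%:R * (2 * e1) = e * (d%:R / (d%:R + 1)) by rewrite /e1; field; rewrite gt_eqF.
by apply: ler_piMr; [exact: ltW|rewrite ler_pdivrMr// mul1r lerDl].
Qed.

Lemma strict_diff_rowP (V : normedModType R) m (g : V -> 'rV[R]_m) x (L : V -> 'rV[R]_m) :
  (forall i, strict_diff (fun z => g z 0 i : R^o) x (fun u => L u 0 i : R^o)) ->
  strict_diff g x L.
Proof.
move=> H; split.
  split=> [a u v|].
    by apply/rowP => i; rewrite !mxE; have [[+ _] _] := H i; apply.
  have ex i : exists K, 0 <= K /\ forall u, `|L u 0 i| <= K * `|u|.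
    by have [[_ hK] _] := H i.
  have [K HK] := choice ex; exists (\sum_i K i); split.
    by apply: sumr_ge0 => i _; have [] := HK i.
  move=> u; apply/rV_norm_le; split.
    by rewrite mulr_ge0// sumr_ge0// => i _; have [] := HK i.
  move=> i; have [K0 Hi] := HK i; apply: le_trans (Hi u) _; rewrite ler_wpM2r//.
  by rewrite (bigD1 i)//= lerDl sumr_ge0// => j _; have [] := HK j.
move=> e e0; have ex i : exists q, 0 < q /\ forall a b, `|a - x| < q -> `|b - x| < q ->
    `|g b 0 i - g a 0 i - L (b - a) 0 i| <= e * `|b - a|.
  by have [_ /(_ e e0)[q q0 Hq]] := H i; exists q.
have [s Hs] := choice ex; exists (\big[Num.min/1]_i s i).
  by apply/bigmin_gtP; split=> // i _; have [] := Hs i.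
move=> a b ax bx; apply/rV_norm_le; split=> [|i]; first by rewrite mulr_ge0// ltW.
rewrite !mxE; have [_ Hi] := Hs i; apply: Hi.
  by apply: lt_le_trans ax _; exact: bigmin_le_cond.
by apply: lt_le_trans bx _; exact: bigmin_le_cond.
Qed.

Lemma generic_C1 d m (g : 'rV[R]_d -> 'rV[R]_m) : dfun g ->
  generic (fun x => exists J : 'M[R]_(d, m), strict_diff g x (fun u => u *m J)).
Proof.
move=> dg; have dgi (i : 'I_m) : dfun (fun x => g x 0 i) by deft.
apply: generic_mono (generic_forall_fin (fun i => generic_C1_fun (dgi i))) => x H.
have [c Hc] := choice H; exists (\matrix_(j, i) c i j 0).
apply: strict_diff_rowP => i; apply: strict_diff_eqL (Hc i) => u.
by rewrite !mxE; apply: eq_bigr => j _; rewrite mxE.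
Qed.
End GenericC1.

(** * Monotonicity in one variable *)

Section OneVariable.
Context (R : realType) (D : set_family R) (omD : o_minimal D).
Notation def := (@def R D _ _).
Notation dfun := (@dfun R D _ _ _ _).

Definition cont1 (g : R -> R) (s : R) :=
  forall e : R, 0 < e -> exists2 r : R, 0 < r & forall z : R, `|z - s| < r -> `|g z - g s| < e.

(* Near [s], [g] is continuous and nondecreasing (b = false) or nonincreasing
   (b = true). *)
Definition mono_at (b : bool) (g : R -> R) (s : R) :=
  exists2 r : R, 0 < r & forall t : R, `|t - s| < r -> cont1 g t /\
    forall t' : R, `|t' - s| < r -> t <= t' -> (-1) ^+ b * g t <= (-1) ^+ b * g t'.

Lemma strict_diff_interval (g : R -> R) (a b : R) : dfun g -> a < b ->
  exists y r, 0 < r /\ forall x, `|x - y| < r -> (a < x /\ x < b) /\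
    exists c, forall e, 0 < e -> exists2 d, 0 < d & forall u v,
      `|u - x| < d -> `|v - x| < d -> `|g v - g u - c * (v - u)| <= e * `|v - u|.
Proof.
move=> dg ab; have dg1 : dfun (fun v : 'rV[R]_1 => g (v 0 0)) by deft.
have scalarB (s t r : R) : `|s%:M - t%:M : 'rV[R]_1| < r <-> `|s - t| < r.
  rewrite -rmorphB/=; split=> [/rV_norm_lt[r0 /(_ 0)]|st]; first by rewrite mxE eqxx mulr1n.
  apply/rV_norm_lt; split=> [|i]; first exact: le_lt_trans st.
  by rewrite ord1 mxE eqxx mulr1n.
have r00 : 0 < (b - a) / 2 by lra.
have [y [r [r0 H]]] := generic_C1_fun omD dg1 (((a + b) / 2)%:M) r00.
exists (y 0 0), r; split=> // x xy; have {}xy : `|x%:M - y| < r.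
  by rewrite -(scalar_decK y); apply/scalarB.
have [xr [c [_ Hc]]] := H _ xy; split.
  by move: xr => /scalarB; rewrite ltr_norml; lra.
exists (c 0 0) => e e0; have [d d0 Hd] := Hc e e0; exists d => // u v ux vx.
have := Hd _ _ ((scalarB _ _ _).2 ux) ((scalarB _ _ _).2 vx).
have -> : ((v%:M - u%:M) *m c) 0 0 = c 0 0 * (v - u).
  by rewrite mxE big_ord1 !mxE eqxx !mulr1n mulrC.
rewrite !mxE eqxx !mulr1n -rmorphB/= => H1; apply: le_trans H1 _.
apply: ler_wpM2l; first exact: ltW.
apply/rV_norm_le; split=> // i; by rewrite ord1 mxE eqxx mulr1n.
Qed.

(** On a subinterval of strict differentiability either some derivative is nonzero, and its sign
    decides near that point, or all derivatives vanish and the mean value inequality makes [g]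
    nonincreasing. *)
Lemma mono_dense (g : R -> R) (a b : R) : dfun g -> a < b ->
  exists s c, a < s /\ s < b /\ mono_at c g s.
Proof.
move=> dg /(strict_diff_interval dg)[y [r [r0 H]]].
have cg x : `|x - y| < r -> cont1 g x.
  move=> /H[_ [c Hc]] e e0; have [d d0 Hd] := Hc 1 ltr01.
  have c0 : 0 < `|c| + 1 by rewrite ltr_wpDl.
  exists (Num.min d (e / (`|c| + 1))); first by rewrite lt_min d0 divr_gt0.
  move=> z; rewrite lt_min ltr_pdivlMr// => /andP[zd ze].
  have := Hd x z; rewrite subrr normr0 => /(_ d0 zd) h.
  apply: le_lt_trans ze; rewrite -(subrK (c * (z - x)) (g z - g x)).
  by apply: le_trans (ler_normD _ _) _; rewrite normrM; lra.
have near1 x : `|x - y| < r -> exists2 d, 0 < d & forall t, `|t - x| < d -> `|t - y| < r.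
  move=> xy; exists (r - `|x - y|); first by rewrite subr_gt0.
  move=> t tx; rewrite -(subrKA x); apply: le_lt_trans (ler_normD _ _) _; lra.
have [[x [c [xy [c0 Hc]]]]|no] := pselect (exists x c, `|x - y| < r /\ c != 0 /\
    forall e, 0 < e -> exists2 d, 0 < d & forall u v,
      `|u - x| < d -> `|v - x| < d -> `|g v - g u - c * (v - u)| <= e * `|v - u|).
  exists x, (c < 0); have [[ax xb] _] := H x xy; split=> //; split=> //.
  have [|d d0 Hd] := Hc (`|c| / 2); first by rewrite divr_gt0// normr_gt0.
  have [d' d'0 Hd'] := near1 x xy.
  exists (Num.min d d'); first by rewrite lt_min d0.
  move=> t; rewrite lt_min => /andP[td td']; split; first exact/cg/Hd'.
  move=> t'; rewrite lt_min => /andP[t'd _] tt'.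
  have := Hd t t' td t'd; have tt0 : 0 <= t' - t by rewrite subr_ge0.
  rewrite (ger0_norm tt0) ler_norml.
  case: ltP => cs; first by rewrite (ltr0_norm cs) expr1 => /andP[h1 h2]; nra.
  by rewrite (ger0_norm cs) expr0 => /andP[h1 h2]; nra.
have [[ay yb] _] : (a < y /\ y < b) /\ _ := H y ltac:(by rewrite subrr normr0).
exists y, true; split=> //; split=> //; exists r => // t ty; split; first exact: cg.
move=> t' t'y tt'; suff : g t' - g t <= 0 by rewrite expr1; lra.
apply/ler_addgt0Pl => e e0.
have e1 : 0 < e / (t' - t + 1) by rewrite divr_gt0//; lra.
have := @dini_mean_value R g t t' (e / (t' - t + 1)) tt'.
have inb u : t <= u -> u <= t' -> `|u - y| < r.
  by move: ty t'y; rewrite !ltr_norml; lra.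
move=> /(_ _ _)/wrap [||h].
- move=> u tu ut' eps eps0; have [|q q0 Hq] := cg u _ eps eps0; first by apply: inb => //; exact: ltW.
  exists q => // s us su; apply: Hq; rewrite ltr_norml; lra.
- move=> u tu ut'; have uy := inb u tu (ltW ut'); have [_ [c Hc]] := H u uy.
  have [c0|c0] := eqVneq c 0; last by case: no; exists u, c.
  have [d d0 Hd] := Hc _ e1; exists d => // s us sd.
  have := Hd u s; rewrite subrr normr0 c0 mul0r subr0 (gtr0_norm (_ : 0 < s - u)); last by lra.
  by move=> /(_ d0 _)/wrap[|h]; [lra|apply: le_trans (ler_norm _) _].
apply: le_trans h _; rewrite addr0 mulrAC ler_pdivrMr; last by lra.
by rewrite ler_pM2l//; lra.
Qed.

Lemma mono_interval (g : R -> R) b (u v : R) : u <= v ->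
  (forall s, u <= s -> s <= v -> mono_at b g s) -> (-1) ^+ b * g u <= (-1) ^+ b * g v.
Proof.
move=> uv H; apply: (@real_induction R (fun t => (-1) ^+ b * g u <= (-1) ^+ b * g t) u v) => //.
- move=> t ut tv Pt; have [r r0 Hr] := H t ut (ltW tv); exists r => // s ts sr.
  have [_ h] := Hr t ltac:(by rewrite subrr normr0).
  by apply: le_trans Pt _; apply: h; [rewrite ltr_norml; lra|lra].
- move=> t ut tv Ps; have [r r0 Hr] := H t (ltW ut) tv.
  pose s := Num.max u (t - r / 2).
  have us : u <= s by rewrite le_max lexx.
  have ts : t - r / 2 <= s by rewrite le_max lexx orbT.
  have st : s < t by rewrite gt_max ut/=; lra.
  apply: le_trans (Ps s us st) _; have [|_] := Hr s; first by rewrite ltr_norml; lra.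
  by apply; [rewrite subrr normr0|exact: ltW].
Qed.

Lemma def_mono_at b (g : R -> R) : dfun g -> def (mono_at b g).
Proof. by move=> dg; rewrite /mono_at /cont1; deft. Qed.

(** Each sign holds at all points of some right neighbourhood of [a] or at none; by [mono_dense] the
    two signs cannot both fail. *)
Lemma mono_germ (g : R -> R) (a : R) : dfun g ->
  exists2 tau, 0 < tau & exists b, forall s, a < s -> s < a + tau -> mono_at b g s.
Proof.
move=> dg.
have [t0 t00 [H0|H0]] := tame_germ omD a (def_mono_at false dg); first by exists t0 => //; exists false.
have [t1 t10 [H1|H1]] := tame_germ omD a (def_mono_at true dg); first by exists t1 => //; exists true.
have [|s [[] [as_ [sb Hs]]]] := @mono_dense g a (a + Num.min t0 t1) dg.
- by rewrite ltrDl lt_min t00.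
- exfalso; apply: (H1 s as_ _ Hs); apply: lt_le_trans sb _.
  by rewrite lerD2l ge_min lexx orbT.
- exfalso; apply: (H0 s as_ _ Hs); apply: lt_le_trans sb _.
  by rewrite lerD2l ge_min lexx.
Qed.

(** For each [s] the germ of [P s] at 0 is decided. The decision and a scale 1/(m+1) on which it is
    valid are countably many alternatives, hence constant for [s] in a subinterval. *)
Lemma dichotomy_box (P : R -> R -> Prop) (a b : R) :
  def (fun z : R * R => P z.1 z.2) -> a < b ->
  exists a' b' tau, [/\ a <= a', a' < b', b' <= b & 0 < tau] /\
    ((forall s t, a' < s -> s < b' -> 0 < t -> t < tau -> P s t) \/
     (forall s t, a' < s -> s < b' -> 0 < t -> t < tau -> ~ P s t)).
Proof.
move=> dP ab.
pose S (i : bool * nat) (s : R) := forall t : R, 0 < t -> t < i.2.+1%:R^-1 ->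
   if i.1 then P s t else ~ P s t.
have dS i : def (S i) by rewrite /S; case: i => -[] m /=; deft.
have [|i [c [d [ac cd db H]]]] := countable_cover_interval omD dS ab.
  move=> s _ _; have dPs : def (P s) by exact: (def_slice omD).
  have [tau tau0 H] := tame_germ omD 0 dPs.
  have [m Hm] : exists m : nat, m.+1%:R^-1 < tau.
    have := @near_infty_natSinv_lt R (PosNum tau0).
    by case=> N _ /(_ N (leqnn N)) /= h; exists N.
  case: H => H; [exists (true, m)|exists (false, m)] => t t0 /= tm; apply: H => //;
    by rewrite add0r; exact: lt_trans tm Hm.
exists c, d, (i.2.+1%:R^-1); split; first by split=> //; rewrite invr_gt0.
by case: i H => -[] m /= H; [left|right] => s t cs sd t0 tm; exact: H.
Qed.

(** Applied to a family of curves with parameter [s], indexed by small [t]: each coordinate becomes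
    continuous and monotone in [s] with a sign independent of [t]. If both signs failed on a box,
    the slice t = tau / 2 would contradict [mono_dense]. *)
Lemma mono_box (I : eqType) (l : seq I) (w : I -> R -> R -> R) (a b : R) :
  (forall i, dfun (fun z : R * R => w i z.1 z.2)) -> a < b ->
  exists a' b' tau, [/\ a <= a', a' < b', b' <= b & 0 < tau] /\
   forall i, i \in l -> exists c, forall s t, a' < s -> s < b' -> 0 < t -> t < tau ->
     mono_at c (w i ^~ t) s.
Proof.
move=> dw ab; elim: l => [|i l [a1 [b1 [t1 [[aa1 ab1 bb1 t10] IH]]]]].
  by exists a, b, 1; split.
have dm c : def (fun z : R * R => mono_at c (w i ^~ z.2) z.1).
  by have dwi := dw i; rewrite /mono_at /cont1; deft.
have [a2 [b2 [t2 [[a12 ab2 b12 t20] H2]]]] :=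
  dichotomy_box (P := fun s t => mono_at false (w i ^~ t) s) (dm false) ab1.
have [a3 [b3 [t3 [[a23 ab3 b23 t30] H3]]]] :=
  dichotomy_box (P := fun s t => mono_at true (w i ^~ t) s) (dm true) ab2.
pose tau := Num.min (Num.min t1 t2) t3.
have tt t : t < tau -> [/\ t < t1, t < t2 & t < t3].
  by rewrite !lt_min => /andP[/andP[? ?] ?].
have tau0 : 0 < tau by rewrite !lt_min t10 t20.
exists a3, b3, tau; split; first by split=> //; lra.
move=> j; rewrite inE => /predU1P[->|jl]; last first.
  have [c Hc] := IH j jl; exists c => s t as_ sb t0 /tt[? ? ?].
  by apply: Hc => //; lra.
case: H3 => H3; first by exists true => s t as_ sb t0 /tt[? ? ?]; exact: H3.
case: H2 => H2.
  by exists false => s t as_ sb t0 /tt[? ? ?]; apply: H2 => //; lra.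
have t0 : 0 < tau / 2 by lra.
have [? ? ?] := tt (tau / 2) ltac:(lra).
have dwt : dfun (w i ^~ (tau / 2)) by have dwi := dw i; deft.
have [s [[] [as_ [sb Hs]]]] := mono_dense dwt ab3.
  by exfalso; apply: (H3 s (tau / 2)).
by exfalso; apply: (H2 s (tau / 2)) => //; lra.
Qed.
End OneVariable.

(** * Euclidean norm and slope *)

Section EuclideanNorm.
Context (R : realType).

Definition dot n (u v : 'rV[R]_n) : R := \sum_i u 0 i * v 0 i.

Lemma dotC n (u v : 'rV[R]_n) : dot u v = dot v u.
Proof. by apply: eq_bigr => i _; rewrite mulrC. Qed.

Lemma dotDl n (u v w : 'rV[R]_n) : dot (u + v) w = dot u w + dot v w.
Proof. by rewrite /dot -big_split; apply: eq_bigr => i _; rewrite mxE mulrDl. Qed.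

Lemma dotZl n a (u v : 'rV[R]_n) : dot (a *: u) v = a * dot u v.
Proof. by rewrite /dot mulr_sumr; apply: eq_bigr => i _; rewrite mxE mulrA. Qed.

Lemma dotBl n (u v w : 'rV[R]_n) : dot (u - v) w = dot u w - dot v w.
Proof. by rewrite dotDl -scaleN1r dotZl mulN1r. Qed.

Lemma dotDr n (u v w : 'rV[R]_n) : dot w (u + v) = dot w u + dot w v.
Proof. by rewrite dotC dotDl !(dotC w). Qed.

Lemma dotZr n a (u v : 'rV[R]_n) : dot u (a *: v) = a * dot u v.
Proof. by rewrite dotC dotZl dotC. Qed.

Lemma dotBr n (u v w : 'rV[R]_n) : dot w (u - v) = dot w u - dot w v.
Proof. by rewrite dotC dotBl !(dotC w). Qed.

Lemma dot_ge0 n (u : 'rV[R]_n) : 0 <= dot u u.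
Proof. by apply: sumr_ge0 => i _; rewrite -expr2 sqr_ge0. Qed.

Lemma enormE n (u : 'rV[R]_n) : enorm u = Num.sqrt (dot u u).
Proof. by rewrite /enorm; congr Num.sqrt; apply: eq_bigr => i _; rewrite expr2. Qed.

Lemma enorm_sqr n (u : 'rV[R]_n) : enorm u ^+ 2 = dot u u.
Proof. by rewrite enormE sqr_sqrtr// dot_ge0. Qed.

Lemma enorm_ge0 n (u : 'rV[R]_n) : 0 <= enorm u.
Proof. exact: sqrtr_ge0. Qed.

Lemma enorm0 n : enorm (0 : 'rV[R]_n) = 0.
Proof. by rewrite enormE /dot big1 ?sqrtr0// => i _; rewrite mxE mul0r. Qed.

Lemma rV_norm_enorm n (u : 'rV[R]_n) : `|u| <= enorm u.
Proof.
apply/rV_norm_le; split=> [|i]; first exact: enorm_ge0.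
rewrite -sqrtr_sqr enormE ler_wsqrtr// /dot (bigD1 i)//= -expr2 lerDl.
by apply: sumr_ge0 => j _; rewrite -expr2 sqr_ge0.
Qed.

Lemma enorm_eq0 n (u : 'rV[R]_n) : enorm u = 0 -> u = 0.
Proof. by move=> u0; apply/eqP; rewrite -normr_le0 -u0 rV_norm_enorm. Qed.

Lemma enormN n (u : 'rV[R]_n) : enorm (- u) = enorm u.
Proof. by rewrite /enorm; congr Num.sqrt; apply: eq_bigr => i _; rewrite mxE sqrrN. Qed.

Lemma enormB n (u v : 'rV[R]_n) : enorm (u - v) = enorm (v - u).
Proof. by rewrite -enormN opprB. Qed.

Lemma enormZ n a (u : 'rV[R]_n) : enorm (a *: u) = `|a| * enorm u.
Proof.
rewrite !enormE dotZl dotZr mulrA -expr2 sqrtrM ?sqr_ge0//.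
by rewrite sqrtr_sqr.
Qed.

Lemma cauchy_schwarz n (u v : 'rV[R]_n) : `|dot u v| <= enorm u * enorm v.
Proof.
have [v0|v0] := eqVneq (dot v v) 0.
  have -> : v = 0 by apply: enorm_eq0; rewrite enormE v0 sqrtr0.
  by rewrite enorm0 mulr0 /dot big1 ?normr0// => i _; rewrite mxE mulr0.
have vv : 0 < dot v v by rewrite lt_neqAle eq_sym v0 dot_ge0.
rewrite -sqrtr_sqr !enormE -sqrtrM ?dot_ge0// ler_wsqrtr//.
have := dot_ge0 (dot v v *: u - dot u v *: v).
rewrite !(dotBl, dotBr, dotZl, dotZr) (dotC v u) => h.
have : 0 <= dot v v * (dot u u * dot v v - dot u v ^+ 2).
  by apply: le_trans h _; rewrite le_eqVlt; apply/orP; left; apply/eqP; ring.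
by rewrite pmulr_rge0// subr_ge0.
Qed.

Lemma enormD n (u v : 'rV[R]_n) : enorm (u + v) <= enorm u + enorm v.
Proof.
rewrite -ler_sqr ?nnegrE ?addr_ge0 ?enorm_ge0// enorm_sqr dotDl !dotDr sqrrD !enorm_sqr.
have := le_trans (ler_norm _) (cauchy_schwarz u v).
rewrite (dotC v u) -mulr_natl; lra.
Qed.

Lemma enorm_sum n (I : Type) (s : seq I) (F : I -> 'rV[R]_n) :
  enorm (\sum_(i <- s) F i) <= \sum_(i <- s) enorm (F i).
Proof.
elim: s => [|i s IH]; first by rewrite !big_nil enorm0.
by rewrite !big_cons; apply: le_trans (enormD _ _) _; rewrite lerD2l.
Qed.

Lemma enorm_le_sum n (u : 'rV[R]_n) : enorm u <= \sum_i `|u 0 i|.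
Proof.
rewrite {1}(matrix_sum_delta u) big_ord1; apply: le_trans (enorm_sum _ _) _.
apply: ler_sum => i _; rewrite enormZ -[leRHS]mulr1 ler_wpM2l//.
rewrite enormE /dot (bigD1 i)//= big1 ?addr0 ?mxE ?eqxx ?mulr1 ?sqrtr1//.
by move=> j ji; rewrite mxE eqxx (negbTE ji) mul0r.
Qed.

Lemma enorm_le_norm n (u : 'rV[R]_n) : enorm u <= n%:R * `|u|.
Proof.
apply: le_trans (enorm_le_sum u) _.
apply: le_trans (ler_sum _ (fun i _ => rV_norm_coord u i)) _.
by rewrite sumr_const card_ord mulr_natl.
Qed.

Lemma enorm_small n (e : R) : 0 < e -> exists2 d, 0 < d &
  forall u : 'rV[R]_n, `|u| < d -> enorm u < e.
Proof.
move=> e0; have n0 : 0 < n%:R + 1 :> R by rewrite ltr_wpDl.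
exists (e / (n%:R + 1)); first by rewrite divr_gt0.
move=> u; rewrite ltr_pdivlMr// => h; apply: le_lt_trans h.
by apply: le_trans (enorm_le_norm u) _; rewrite mulrC ler_wpM2l// lerDl.
Qed.

End EuclideanNorm.

Section DefinableMaps.
Context (R : realType) (D : set_family R) (omD : o_minimal D).
Notation def := (@def R D _ _).
Notation dfun := (@dfun R D _ _ _ _).

Lemma dfun_dot T {dT : dtype R T} n (f g : T -> 'rV[R]_n) :
  dfun f -> dfun g -> dfun (fun t => dot (f t) (g t)).
Proof.
by move=> df dg; rewrite /dot; apply: (dfun_sum omD) => i; deft.
Qed.

Lemma dfun_definable_map m n (A : set 'rV[R]_m) (f : 'rV[R]_m -> 'rV[R]_n) :
  def A -> dfun f -> definable_map D A f.
Proof.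
move=> dA df; have : def (fun z : 'rV[R]_m * 'rV[R]_n => A z.1 /\ z.2 = f z.1) by deft.
move=> H; apply: (omin_ext H) => v /=; split=> [[Av fv]|[x Ax <-]].
  by exists (lsubmx v) => //; rewrite -fv hsubmxK.
by rewrite row_mxKl row_mxKr.
Qed.

Lemma definable_map_dfun m n (A : set 'rV[R]_m) (f : 'rV[R]_m -> 'rV[R]_n) :
  def A -> definable_map D A f ->
  exists f0, dfun f0 /\ forall x, A x -> f0 x = f x.
Proof.
move=> dA df; pose f0 x := if pselect (A x) then f x else 0.
exists f0; split; last by move=> x Ax; rewrite /f0; case: pselect.
have dG : def (fun z : 'rV[R]_m * 'rV[R]_n => A z.1 /\ z.2 = f z.1).
  apply: (omin_ext df) => v /=; split=> [[x Ax <-]|[Av fv]].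
    by rewrite row_mxKl row_mxKr.
  by exists (lsubmx v) => //; rewrite -fv hsubmxK.
refine (dfun_graph (G := fun x y => (A x /\ y = f x) \/ (~ A x /\ y = 0)) _ _).
  move=> x y; rewrite /f0; case: pselect => Ax; last first.
    by split=> [[[]|[]]|->] //; right.
  by split=> [[[]|[]]|->] //; left.
by apply: (def_or omD) => //; deft.
Qed.
End DefinableMaps.

Section Slope.
Context (R : realType) (D : set_family R) (omD : o_minimal D).
Notation def := (@def R D _ _).
Notation dfun := (@dfun R D _ _ _ _).

(* [c] bounds the pointwise Lipschitz constant of [f|A] at [x]. *)
Definition slope_le n k (A : set 'rV[R]_n) (f : 'rV[R]_n -> 'rV[R]_k) (x : 'rV[R]_n) (c : R) :=
  0 <= c /\ forall c' : R, c < c' -> exists2 r : R, 0 < r &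
    forall x' : 'rV[R]_n, A x' -> `|x' - x| < r -> enorm (f x' - f x) <= c' * enorm (x' - x).

Lemma def_slope_le n k (A : set 'rV[R]_n) (f : 'rV[R]_n -> 'rV[R]_k) :
  def A -> dfun f -> def (fun z : 'rV[R]_n * R => slope_le A f z.1 z.2).
Proof. by move=> dA df; rewrite /slope_le; deft. Qed.

Lemma slope_le_mono n k (A : set 'rV[R]_n) (f : 'rV[R]_n -> 'rV[R]_k) x c c' :
  slope_le A f x c -> c <= c' -> slope_le A f x c'.
Proof.
move=> [c0 H] cc'; split=> [|c'' c'c'']; first exact: le_trans cc'.
by apply: H; exact: le_lt_trans c'c''.
Qed.
End Slope.

(** * Curve selection *)

Section CurveSelection.
Context (R : realType) (D : set_family R) (omD : o_minimal D).
Notation def := (@def R D _ _).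
Notation dfun := (@dfun R D _ _ _ _).

Lemma finite_pos_min (I : finType) (P : I -> R -> Prop) :
  (forall i, exists2 r, 0 < r & P i r) -> (forall i r r', r' <= r -> P i r -> P i r') ->
  exists2 r, 0 < r & forall i, P i r.
Proof.
move=> ex mono; have ex' i : exists r, 0 < r /\ P i r by have [r] := ex i; exists r.
have [s Hs] := choice ex'; exists (\big[Num.min/1]_i s i).
  by apply/bigmin_gtP; split=> // i _; have [] := Hs i.
by move=> i; have [_] := Hs i; apply: mono; exact: bigmin_le_cond.
Qed.

Lemma bounded_tame_limit (h : R -> R) (M : R) : dfun h ->
  (forall t, 0 < t -> `|h t| <= M) ->
  exists l, forall e, 0 < e -> exists2 r, 0 < r & forall t, 0 < t -> t < r -> `|h t - l| <= e.
Proof.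
move=> dh hM; have [[l Hl]|/(_ (M + 1))[r r0 H]|/(_ (- M - 1))[r r0 H]] := tame_limit omD 0 dh.
- exists l => e /Hl[r r0 Hr]; exists r => // t t0 tr; apply: Hr => //.
  by rewrite add0r.
- exfalso; have r20 : 0 < r / 2 by lra.
  have := hM (r / 2) r20; have := H (r / 2) r20 ltac:(lra).
  by rewrite ler_norml; lra.
- exfalso; have r20 : 0 < r / 2 by lra.
  have := hM (r / 2) r20; have := H (r / 2) r20 ltac:(lra).
  by rewrite ler_norml; lra.
Qed.

Lemma sum_option (I : finType) (F : option I -> R) :
  \sum_i F i = F None + \sum_i F (Some i).
Proof.
rewrite (bigD1 None)//=; congr (_ + _); rewrite (reindex_omap Some id); last by case.
by apply: eq_bigl => j; rewrite eqxx.
Qed.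

(* Coordinates of [v] along [u] and, redundantly, of the remainder. *)
Definition adapted n (u : 'rV[R]_n) (i : option 'I_n) (v : 'rV[R]_n) : R :=
  if i is Some i then v 0 i - u 0 i * dot u v else dot u v.

Lemma adaptedB n (u : 'rV[R]_n) i v w : adapted u i (v - w) = adapted u i v - adapted u i w.
Proof. by case: i => [i|] /=; rewrite dotBr// !mxE; ring. Qed.

Lemma dfun_adapted T {dT : dtype R T} n (u : 'rV[R]_n) i (g : T -> 'rV[R]_n) :
  dfun g -> dfun (fun t => adapted u i (g t)).
Proof.
move=> dg; have du : dfun (fun t => dot u (g t)) by apply: (dfun_dot omD) => //; deft.
by case: i => [i|] //=; deft.
Qed.

(** For [v] along [u] the remainders vanish and the bound is an equality, whereas the sum of the
    usual coordinates would lose a factor. Lengths of curves of direction close to [u] are therefore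
    estimated with a factor close to 1. *)
Lemma enorm_adapted n (u v : 'rV[R]_n) : enorm u = 1 ->
  enorm v <= \sum_i `|adapted u i v|.
Proof.
move=> u1; rewrite sum_option/= -[v in enorm v](subrKC (dot u v *: u)).
apply: le_trans (enormD _ _) _; rewrite enormZ u1 mulr1 lerD2l.
apply: le_trans (enorm_le_sum _) _; apply: ler_sum => i _.
by rewrite !mxE mulrC.
Qed.

Lemma adapted_le n (u v : 'rV[R]_n) i : enorm u = 1 -> `|adapted u i v| <= 2 * enorm v.
Proof.
move=> u1; have dv : `|dot u v| <= enorm v by have := cauchy_schwarz u v; rewrite u1 mul1r.
have v0 := enorm_ge0 v.
case: i => [i|] /=; last by lra.
apply: le_trans (ler_normB _ _) _; rewrite normrM.
have vi := le_trans (rV_norm_coord v i) (rV_norm_enorm v).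
have ui := le_trans (rV_norm_coord u i) (rV_norm_enorm u).
have : `|u 0 i| * `|dot u v| <= 1 * enorm v by apply: ler_pM => //; rewrite -u1.
by lra.
Qed.

(** * Length of a curve with monotone adapted coordinates *)

Section GoodCurve.
Variables (n : nat) (x u : 'rV[R]_n) (gam : R -> 'rV[R]_n) (tau : R).
Hypothesis dgam : dfun gam.
Hypothesis gam_x : forall t, 0 < t -> `|gam t - x| < t.
Hypothesis u1 : enorm u = 1.
Variable (b : option 'I_n -> bool).
Hypothesis tau0 : 0 < tau.
Hypothesis mono : forall i s, 0 < s -> s < tau ->
  mono_at (b i) (fun t => adapted u i (gam t - x)) s.

Let w i t := adapted u i (gam t - x).
Let gam0 t := if t <= 0 then x else gam t.
Let Phi t := if t <= 0 then 0 else \sum_i `|w i t|.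

Let w_small i e : 0 < e -> exists2 r, 0 < r & forall t, 0 < t -> t < r -> `|w i t| < e.
Proof.
move=> e0; have e20 : 0 < e / 2 by lra.
have [d d0 Hd] := enorm_small n e20; exists d => // t t0 td.
have := Hd _ (lt_trans (gam_x t0) td).
by have := adapted_le (gam t - x) i u1; rewrite -/(w i t); lra.
Qed.

Let w_mono i s t : 0 < s -> s <= t -> t < tau ->
  (-1) ^+ b i * w i s <= (-1) ^+ b i * w i t.
Proof.
move=> s0 st tt; apply: mono_interval => // r sr rt.
apply: mono; [exact: lt_le_trans sr|exact: le_lt_trans tt].
Qed.

(** The signed coordinate is nondecreasing and tends to 0 at 0, hence nonnegative. *)
Let w_norm i t : 0 < t -> t < tau -> `|w i t| = (-1) ^+ b i * w i t.
Proof.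
move=> t0 tt; suff H : 0 <= (-1) ^+ b i * w i t.
  by rewrite -(ger0_norm H) normrM normrX normrN1 expr1n mul1r.
rewrite leNgt; apply/negP => H.
have e0 : 0 < - ((-1) ^+ b i * w i t) by rewrite oppr_gt0.
have [r r0 Hr] := w_small i e0; pose s := Num.min t (r / 2).
have s0 : 0 < s by rewrite lt_min t0; lra.
have sr : s < r by have : s <= r / 2 by [rewrite ge_min lexx orbT]; lra.
have st : s <= t by rewrite ge_min lexx.
have := w_mono i s0 st tt; have := Hr s s0 sr.
have : - `|w i s| <= (-1) ^+ b i * w i s.
  have -> : `|w i s| = `|(-1) ^+ b i * w i s| by rewrite normrM normrX normrN1 expr1n mul1r.
  by rewrite lerNl -normrN ler_norm.
lra.
Qed.

Let gam0_incr s t : 0 <= s -> s <= t -> t < tau ->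
  enorm (gam0 s - gam0 t) <= Phi t - Phi s.
Proof.
move=> s0 st tt; rewrite /gam0 /Phi.
have [t0|t0] := leP t 0.
  have s00 : s <= 0 by lra.
  by rewrite s00 !subrr enorm0.
have [s00|s00] := leP s 0.
  by rewrite subr0 enormB enorm_adapted.
apply: le_trans (_ : \sum_i `|adapted u i (gam t - gam s)| <= _).
  by rewrite enormB enorm_adapted.
rewrite -sumrB; apply: ler_sum => i _.
have -> : gam t - gam s = (gam t - x) - (gam s - x) by rewrite opprB addrA subrK.
rewrite adaptedB -/(w i t) -/(w i s).
have := w_mono i s00 st tt; rewrite !w_norm//; last exact: le_lt_trans tt.
move=> h; rewrite -mulrBr -[leLHS](_ : `|(-1) ^+ b i * (w i t - w i s)| = _).
  by rewrite ger0_norm// mulrBr subr_ge0.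
by rewrite normrM normrX normrN1 expr1n mul1r.
Qed.

Let gam0_cont t e : 0 <= t -> t < tau -> 0 < e ->
  exists2 r, 0 < r & forall s, 0 <= s -> s < tau -> `|s - t| < r -> `|gam0 s - gam0 t| < e.
Proof.
move=> t0 tt e0; have [->|t00] := eqVneq t 0.
  exists e => // s s0 ss; rewrite subr0 => se; rewrite /gam0 lexx.
  have [s00|s00] := leP s 0; first by rewrite subrr normr0.
  by apply: lt_trans (gam_x s00) _; rewrite -(gtr0_norm s00).
have {t0}t00 : 0 < t by rewrite lt_neqAle eq_sym t00.
pose e1 := e / (#|{: option 'I_n}|%:R + 1).
have N0 : 0 < #|{: option 'I_n}|%:R + 1 :> R by rewrite ltr_wpDl.
have e10 : 0 < e1 by rewrite divr_gt0.
have [r r0 Hr] : exists2 r, 0 < r & forall i, forall s, `|s - t| < r -> `|w i s - w i t| < e1.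
  apply: finite_pos_min => [i|i r r' r'r H s sr]; last by apply: H; exact: lt_le_trans sr _.
  have [r r0 /(_ t)[|+ _]] := mono i t00 tt; first by rewrite subrr normr0.
  by move=> /(_ e1 e10)[q q0 Hq]; exists q.
exists (Num.min r t); first by rewrite lt_min r0.
move=> s s0 ss; rewrite lt_min => /andP[sr st].
have s00 : 0 < s by move: st; rewrite ltr_norml; lra.
rewrite /gam0 leNgt s00/= leNgt t00/=.
apply: le_lt_trans (rV_norm_enorm _) _; apply: le_lt_trans (enorm_adapted _ u1) _.
apply: le_lt_trans (_ : \sum_(i : option 'I_n) e1 < _).
  apply: ler_sum => i _.
  have -> : gam s - gam t = (gam s - x) - (gam t - x) by rewrite opprB addrA subrK.
  by rewrite adaptedB ltW// Hr.
rewrite sumr_const -mulr_natl /e1 mulrCA gtr_pMr//.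
by rewrite ltr_pdivrMr// mul1r ltrDl.
Qed.

(** Clamping at 1, together with the constant value of [gam0] on nonpositive numbers, makes the arc
    continuous on all of R for T < tau. *)
Let arc T th := gam0 (Num.min th 1 * T).

Let arc_definable T (A : set 'rV[R]_n) : 0 < T -> T < tau -> A x ->
  (forall t, 0 < t -> A (gam t)) -> definable_arc D A x (gam T) (arc T).
Proof.
move=> T0 TT Ax Agam; split.
- apply: continuous_subspaceT => th.
  apply/cvgrPdist_lt => e e0.
  pose cl (s : R) := Num.max 0 (Num.min s 1 * T).
  have cl0 s : 0 <= cl s by rewrite le_max lexx.
  have clt s : cl s < tau.
    rewrite gt_max tau0/=; apply: le_lt_trans TT.
    by rewrite ler_piMl// ?ge_min ?lexx ?orbT// ltW.
  have arcE s : arc T s = gam0 (cl s).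
    rewrite /arc /cl; case: (leP 0 (Num.min s 1 * T)) => // h.
    by rewrite /gam0 lexx (ltW h).
  have [r r0 Hr] := gam0_cont (cl0 th) (clt th) e0.
  have rT : 0 < r / T by rewrite divr_gt0.
  apply/nbhs_ballP; exists (r / T) => // s /=; rewrite /ball/= => ths.
  rewrite distrC !arcE; apply: Hr => //.
  apply: le_lt_trans (_ : T * `|th - s| < _); last by rewrite mulrC -ltr_pdivlMr.
  rewrite /cl.
  have lip_max (a c : R) : `|Num.max 0 a - Num.max 0 c| <= `|a - c|.
    rewrite ler_norml; have := ler_norm (a - c); have := ler_norm (c - a).
    by rewrite (distrC c); case: (leP 0 a); case: (leP 0 c); lra.
  have lip_min (a c : R) : `|Num.min a 1 - Num.min c 1| <= `|a - c|.
    rewrite ler_norml; have := ler_norm (a - c); have := ler_norm (c - a).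
    by rewrite (distrC c); case: (leP a 1); case: (leP c 1); lra.
  apply: le_trans (lip_max _ _) _; rewrite -mulrBl normrM (gtr0_norm T0) mulrC.
  by rewrite (distrC th) ler_pM2l.
- apply: (dfun_definable_map omD) => /=.
    by apply: (@def_ext R D 'rV[R]_1 _ (fun t => 0 <= t 0 0 /\ t 0 0 <= 1)); [deft|move=> t; split=> /andP].
  have dmin : dfun (fun s : R => Num.min s 1).
    refine (dfun_graph (G := fun s m : R => (s <= 1 /\ m = s) \/ (1 < s /\ m = 1)) _ _); last by deft.
    by move=> s m; case: leP => h; split=> [[[]|[]]|->]//; [left|right].
  have dg0 : dfun gam0.
    refine (dfun_graph (G := fun (s : R) (v : 'rV[R]_n) => (s <= 0 /\ v = x) \/ (0 < s /\ v = gam s)) _ _); last by deft.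
    by move=> s v; rewrite /gam0; case: leP => h; split=> [[[]|[]]|->]//; [left|right].
  by rewrite /arc; deft.
- by move=> t _; rewrite /arc /gam0; case: leP => [_|/Agam].
- by rewrite /arc /gam0 min_l ?mul0r ?lexx.
- by rewrite /arc /gam0 min_r ?mul1r// leNgt T0.
Qed.

Let arc_length_le T : 0 < T -> T < tau -> (arc_length (arc T) <= (Phi T)%:E)%E.
Proof.
move=> T0 TT; apply: ge_ereal_sup => _ [s [ps ls] <-]; rewrite lee_fin /arc_variation /=.
pose c i := nth 1 (0 :: s) i.
have cE i : (i <= size s)%N -> 0 <= c i /\ c i <= 1.
  move=> is_; have sorted_s : sorted <%R (0 :: s) by [].
  have le_s : sorted <=%R (0 :: s) := sub_sorted (fun _ _ => @ltW _ _ _ _) sorted_s.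
  have lastE : nth 1 (0 :: s) (size s) = 1.
    by rewrite -[size s]/(size (0 :: s)).-1 nth_last /=; exact/eqP.
  split.
    have := sorted_leq_nth (@le_trans _ R) (@lexx _ R) 1 le_s 0%N i.
    by rewrite !inE/= ltnS => /(_ erefl is_ (leq0n i)).
  apply: le_trans (_ : c i <= nth 1 (0 :: s) (size s)) _; last by rewrite lastE.
  have := sorted_leq_nth (@le_trans _ R) (@lexx _ R) 1 le_s i (size s).
  by rewrite !inE/= !ltnS leqnn => /(_ is_ erefl is_); exact.
have cS i : (i < size s)%N -> c i <= c i.+1.
  move=> is_; have /pathP := ps => /(_ 1 i is_) /ltW; exact.
apply: le_trans (_ : \sum_(0 <= i < size s) (Phi (c i.+1 * T) - Phi (c i * T)) <= _).
  rewrite !big_mkord; apply: ler_sum => -[i is_] _ /=.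
  have [h0 h1] := cE i (ltnW is_); have [h2 h3] := cE i.+1 is_.
  rewrite /arc min_l; last exact: h1.
  rewrite [X in gam0 X - _]/= min_l; last exact: h3.
  apply: gam0_incr; [by rewrite mulr_ge0// ltW| |].
    by rewrite ler_wpM2r ?cS// ltW.
  by apply: le_lt_trans TT; rewrite ler_piMl// ltW.
rewrite (telescope_sumr (fun i => Phi (c i * T)))//.
have -> : c (size s) = 1.
  by rewrite /c -[size s]/(size (0 :: s)).-1 nth_last /=; exact/eqP.
by rewrite /c/= mul0r mul1r /Phi lexx subr0.
Qed.

(** Along a curve that starts at x with monotone adapted coordinates, the bound on the length
    telescopes to the sum of their absolute values at the end point. *)
Lemma inner_dist_curve T (A : set 'rV[R]_n) : 0 < T -> T < tau -> A x ->
  (forall t, 0 < t -> A (gam t)) ->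
  (inner_dist D A x (gam T) <= (\sum_i `|adapted u i (gam T - x)|)%:E)%E.
Proof.
move=> T0 TT Ax Agam; have dA := arc_definable T0 TT Ax Agam.
rewrite /inner_dist; case: asboolP => [_|nc].
  apply: ereal_inf_le; exists (arc_length (arc T)); first by exists (arc T).
  apply: le_trans (arc_length_le T0 TT) _.
  by rewrite /Phi [T <= 0]leNgt T0.
exfalso; apply: nc; case: dA => cont _ inA a0 a1.
exists (arc T @` `[0, 1]); last first.
  by exists 1 => //=; rewrite in_itv/= lexx ler01.
split.
- by exists 0 => //=; rewrite in_itv/= lexx ler01.
- by move=> ? [t]; rewrite /= in_itv/= => h <-; exact: inA.
- by apply: connected_continuous_connected cont; exact: segment_connected.
Qed.
End GoodCurve.
End CurveSelection.

(** * Slope and inner Lipschitz constant *)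

Section SlopeInner.
Context (R : realType) (D : set_family R) (omD : o_minimal D).
Notation def := (@def R D _ _).
Notation dfun := (@dfun R D _ _ _ _).

(* A definable curve tends to its endpoint with a limit direction [u], so that
   its length is asymptotic to the distance of its endpoints. *)
Lemma inner_dist_asymptotic n (A : set 'rV[R]_n) x (gam : R -> 'rV[R]_n) (e : R) :
  dfun gam -> A x -> 0 < e ->
  (forall t, 0 < t -> A (gam t) /\ `|gam t - x| < t /\ gam t <> x) ->
  exists2 tau, 0 < tau & forall t, 0 < t -> t < tau ->
    (inner_dist D A x (gam t) <= ((1 + e) * enorm (gam t - x))%:E)%E.
Proof.
move=> dg Ax e0 Hg.
pose N t := enorm (gam t - x).
have N0 t : 0 < t -> 0 < N t.
  move=> /Hg[_ [_ gx]]; rewrite lt_neqAle enorm_ge0 andbT eq_sym; apply/eqP => /enorm_eq0 /eqP.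
  by rewrite subr_eq0 => /eqP.
pose del (i : 'I_n) t := (gam t - x) 0 i / N t.
have ddel i : dfun (del i) by rewrite /del /N; deft.
have del1 i t : 0 < t -> `|del i t| <= 1.
  move=> t0; rewrite /del normrM normfV (gtr0_norm (N0 t t0)) ler_pdivrMr ?N0// mul1r.
  exact: le_trans (rV_norm_coord _ _) (rV_norm_enorm _).
have [ul Hul] := choice (fun i => bounded_tame_limit omD (ddel i) (@del1 i)).
pose u : 'rV[R]_n := \row_i ul i.
have uni e1 : 0 < e1 -> exists2 r, 0 < r & forall t, 0 < t -> t < r ->
    forall i, `|del i t - u 0 i| <= e1.
  move=> e10; have [r r0 Hr] : exists2 r, 0 < r & forall i t, 0 < t -> t < r -> `|del i t - ul i| <= e1.
    apply: finite_pos_min => [i|i r r' r'r H t t0 tr]; first exact: Hul.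
    by apply: H => //; exact: lt_le_trans r'r.
  by exists r => // t t0 tr i; rewrite mxE; exact: Hr.
have sum_del t : 0 < t -> \sum_i del i t ^+ 2 = 1.
  move=> t0; have := enorm_sqr (gam t - x); rewrite -/(N t) => h.
  rewrite (eq_bigr (fun i => (N t ^- 2) * ((gam t - x) 0 i * (gam t - x) 0 i))).
    by rewrite -mulr_sumr -/(dot _ _) -h mulVf// expf_neq0// gt_eqF// N0.
  by move=> i _; rewrite /del expr_div_n mulrC expr2.
have n0 : 0 <= n%:R :> R by [].
have ui i : `|u 0 i| <= 1.
  apply/ler_addgt0Pl => e1 e10; have [r r0 Hr] := uni e1 e10.
  have r20 : 0 < r / 2 by lra.
  have := Hr (r / 2) r20 ltac:(lra) i; have := del1 i _ r20.
  rewrite !ler_norml => /andP[? ?] /andP[? ?]; apply/andP; lra.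
have uu : dot u u = 1.
  apply/eqP; rewrite -subr_eq0 -normr_le0; apply/ler_addgt0Pl => e1 e10.
  rewrite addr0.
  have e20 : 0 < e1 / (2 * (n%:R + 1)) by rewrite divr_gt0// mulr_gt0// ltr_wpDl.
  have [r r0 Hr] := uni _ e20; have r20 : 0 < r / 2 by lra.
  have {}Hr := Hr (r / 2) r20 ltac:(lra).
  rewrite -(sum_del _ r20) /dot -sumrB; apply: le_trans (ler_norm_sum _ _ _) _.
  apply: le_trans (_ : \sum_(i < n) (2 * (e1 / (2 * (n%:R + 1)))) <= _).
    apply: ler_sum => i _; rewrite -expr2 subr_sqr normrM mulrC distrC.
    apply: ler_pM => //.
    by apply: le_trans (ler_normD _ _) _; have := ui i; have := del1 i _ r20; lra.
  rewrite sumr_const card_ord -[leLHS]mulr_natl.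
  have -> : n%:R * (2 * (e1 / (2 * (n%:R + 1)))) = e1 * (n%:R / (n%:R + 1)).
    by field; rewrite gt_eqF// ltr_wpDl.
  by apply: ler_piMr; [exact: ltW|rewrite ler_pdivrMr ?ltr_wpDl// mul1r lerDl].
have u1 : enorm u = 1 by rewrite enormE uu sqrtr1.
have dw i : dfun (fun t => adapted u i (gam t - x)) by apply: (dfun_adapted omD); deft.
have ex i : exists c, exists2 tau, 0 < tau &
   forall s, 0 < s -> s < tau -> mono_at c (fun t => adapted u i (gam t - x)) s.
  have [tau tau0 [c H]] := mono_germ omD 0 (dw i).
  by exists c, tau => // s s0 st; apply: H => //; rewrite add0r.
have [b Hb] := choice ex.
have [tau tau0 Htau] := finite_pos_min (P := fun i tau => forall s, 0 < s -> s < tau ->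
    mono_at (b i) (fun t => adapted u i (gam t - x)) s) Hb
    (fun i r r' r'r H s s0 sr' => H s s0 (lt_le_trans sr' r'r)).
(* If the unit vector along gam t - x is within d of [u] in each coordinate, its adapted coordinates
   sum to at most 1 + n d + n (d + n d) = 1 + M d. *)
pose M := 2 * n%:R + n%:R * n%:R : R.
have M0 : 0 <= M by rewrite addr_ge0 ?mulr_ge0.
have e20 : 0 < e / (M + 1) by rewrite divr_gt0// ltr_wpDl.
have [r r0 Hr] := uni _ e20.
exists (Num.min tau r); first by rewrite lt_min tau0.
move=> t t0; rewrite lt_min => /andP[tt tr].
apply: le_trans (@inner_dist_curve R D omD n x u gam tau dg _ u1 b tau0 Htau t A t0 tt Ax _) _.
- by move=> s /Hg[_ []].
- by move=> s /Hg[].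
rewrite lee_fin sum_option /=.
have gE i : (gam t - x) 0 i = N t * del i t by rewrite /del mulrC divfK// gt_eqF// N0.
pose s := \sum_i u 0 i * del i t.
have sE : dot u (gam t - x) = N t * s.
  by rewrite /dot mulr_sumr; apply: eq_bigr => i _; rewrite gE; ring.
set d := e / (M + 1) in e20 Hr *.
have s1 : `|s - 1| <= n%:R * d.
  rewrite -[X in s - X]uu /dot /s -sumrB; apply: le_trans (ler_norm_sum _ _ _) _.
  apply: le_trans (_ : \sum_(i < n) d <= _); last by rewrite sumr_const card_ord -[leLHS]mulr_natl.
  apply: ler_sum => i _; rewrite -mulrBr normrM -[leRHS]mul1r.
  by apply: ler_pM => //; exact: Hr.
rewrite sE normrM (gtr0_norm (N0 t t0)).
rewrite (eq_bigr (fun i => N t * `|del i t - u 0 i * s|)); last first.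
  move=> i _; have := gE i; rewrite !mxE => ->; rewrite -[in RHS](gtr0_norm (N0 t t0)) -normrM.
  by congr `|_|; ring.
rewrite -mulr_sumr -mulrDr mulrC ler_wpM2r ?(ltW (N0 t t0))//.
apply: le_trans (_ : (1 + n%:R * d) + \sum_(i < n) (d + n%:R * d) <= _).
  apply: lerD.
    have -> : s = 1 + (s - 1) by rewrite subrKC.
    by apply: le_trans (ler_normD _ _) _; rewrite normr1 lerD2l.
  apply: ler_sum => i _.
  have -> : del i t - u 0 i * s = (del i t - u 0 i) - u 0 i * (s - 1) by ring.
  apply: le_trans (ler_normB _ _) _; apply: lerD; first exact: Hr.
  by rewrite normrM -[leRHS]mul1r; apply: ler_pM => //; exact: ui.
have -> : \sum_(i < n) (d + n%:R * d) = n%:R * (d + n%:R * d).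
  by rewrite sumr_const card_ord -[LHS]mulr_natl.
have -> : 1 + n%:R * d + n%:R * (d + n%:R * d) = 1 + M * d by rewrite /M; ring.
rewrite lerD2l /d mulrCA; apply: ler_piMr; first exact: ltW.
by rewrite ler_pdivrMr ?ltr_wpDl// mul1r lerDl.
Qed.

(** If the slope exceeded [C], definable choice would give a curve tending to [x] along which [f]
    grows by more than c' > C times the distance to [x]. Near [x] that distance is the inner
    distance up to a factor 1 + e, which contradicts the Lipschitz condition. *)
Lemma slope_le_inner n k (A : set 'rV[R]_n) (f : 'rV[R]_n -> 'rV[R]_k) x (C r : R) :
  def A -> dfun f -> A x -> 0 <= C -> 0 < r ->
  inner_lipschitz_on D A (eball x r `&` A) f C -> slope_le A f x C.
Proof.
move=> dA df Ax C0 r0 lip; split=> // c' Cc'; apply: contrapT => nr.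
pose P (t : R) (x' : 'rV[R]_n) := A x' /\ `|x' - x| < t /\
  c' * enorm (x' - x) < enorm (f x' - f x).
have dP : def (fun z : R * 'rV[R]_n => P z.1 z.2) by rewrite /P; deft.
have [gam [dg Hg]] := def_choice omD dP.
have {}Hg t : 0 < t -> P t (gam t).
  move=> t0; apply: Hg; apply: contrapT => nx; apply: nr; exists t => // x' Ax' x't.
  by rewrite leNgt; apply/negP => h; apply: nx; exists x'.
have gx t : 0 < t -> gam t <> x.
  by move=> /Hg[_ [_ +]] gx; rewrite gx !subrr !enorm0 mulr0 ltxx.
(* Chosen so that C (1 + e) <= c'. *)
pose e := (c' - C) / (C + 1).
have e0 : 0 < e by rewrite divr_gt0 ?subr_gt0//; lra.
have [|tau tau0 H] := inner_dist_asymptotic dg Ax e0.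
  by move=> t t0; have [? [? _]] := Hg t t0; split=> //; split=> //; exact: gx.
have [d d0 Hd] := enorm_small n r0.
pose t := Num.min tau d / 2.
have m0 : 0 < Num.min tau d by rewrite lt_min tau0.
have t0 : 0 < t by rewrite divr_gt0.
have tt : t < tau by have : Num.min tau d <= tau by [rewrite ge_min lexx]; rewrite /t; lra.
have td : t < d by have : Num.min tau d <= d by [rewrite ge_min lexx orbT]; rewrite /t; lra.
have [Ag [gt gf]] := Hg t t0.
have h := H t t0 tt.
have fin : (inner_dist D A x (gam t) < +oo)%E by apply: le_lt_trans h _; exact: ltry.
have := lip x (gam t) _ _ fin.
have bx : (eball x r `&` A) x by split=> //; rewrite /eball/= subrr enorm0.
have bg : (eball x r `&` A) (gam t) by split=> //; apply: Hd; exact: lt_trans gt td.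
move=> /(_ bx bg) lipg.
have : (C%:E * inner_dist D A x (gam t) <= C%:E * ((1 + e) * enorm (gam t - x))%:E)%E.
  by apply: lee_wpmul2l => //; rewrite lee_fin.
move=> /(le_trans lipg); rewrite -EFinM lee_fin enormB => le1.
have N0 := enorm_ge0 (gam t - x).
have : C * ((1 + e) * enorm (gam t - x)) <= c' * enorm (gam t - x).
  rewrite mulrA ler_wpM2r// mulrDr mulr1 -lerBrDl /e mulrA ler_pdivrMr; last by lra.
  by rewrite mulrC ler_wpM2l ?subr_ge0 ?(ltW Cc')//; lra.
by move=> le2; have := lt_le_trans gf (le_trans le1 le2); rewrite ltxx.
Qed.

Lemma slope_le_cont n k (A : set 'rV[R]_n) (f : 'rV[R]_n -> 'rV[R]_k) x c :
  slope_le A f x c -> forall e, 0 < e -> exists2 r, 0 < r &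
    forall x', A x' -> `|x' - x| < r -> enorm (f x' - f x) < e.
Proof.
move=> [c0 H0] e e0; have [|r r0 H] := H0 (c + 1); first lra.
have ec : 0 < e / (c + 1) by rewrite divr_gt0//; lra.
have [d d0 Hd] := enorm_small n ec.
exists (Num.min r d); first by rewrite lt_min r0.
move=> x' Ax'; rewrite lt_min => /andP[xr xd].
apply: le_lt_trans (H x' Ax' xr) _.
by have := Hd _ xd; rewrite ltr_pdivlMr; [rewrite mulrC|lra].
Qed.
End SlopeInner.

(** * Tangential derivatives and nearby slopes *)

Section Wing.
Context (R : realType) (D : set_family R) (omD : o_minimal D).
Notation def := (@def R D _ _).
Notation dfun := (@dfun R D _ _ _ _).

Lemma adaptedD n (u : 'rV[R]_n) i v w : adapted u i (v + w) = adapted u i v + adapted u i w.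
Proof. by case: i => [i|] /=; rewrite dotDr// !mxE; ring. Qed.

(** Near each t the increment of [f] is at most [q + e] times the sum of the absolute increments of
    the adapted coordinates. Monotonicity makes this sum equal to [Psi], which is additive in the
    interval, so real induction carries the bound from [t1] to [t2]. *)
Lemma slope_along_curve n k (A : set 'rV[R]_n) (f : 'rV[R]_n -> 'rV[R]_k)
  (u : 'rV[R]_n) (X : R -> 'rV[R]_n) (b : option 'I_n -> bool) (q e t1 t2 : R) :
  enorm u = 1 -> t1 <= t2 -> 0 < e ->
  (forall t, t1 <= t -> t <= t2 -> A (X t) /\ slope_le A f (X t) q /\
     forall i, mono_at (b i) (fun t => adapted u i (X t)) t) ->
  enorm (f (X t2) - f (X t1)) <=
  (q + e) * \sum_i (-1) ^+ b i * (adapted u i (X t2) - adapted u i (X t1)).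
Proof.
move=> u1 t12 e0 H.
pose Psi t t' := \sum_i (-1) ^+ b i * (adapted u i (X t') - adapted u i (X t)).
have PsiD r s t : Psi r s + Psi s t = Psi r t.
  by rewrite /Psi -big_split/=; apply: eq_bigr => i _; rewrite -mulrDr addrC addrA subrK.
have loc t : t1 <= t -> t <= t2 -> exists2 r, 0 < r & forall s,
    t1 <= s -> s <= t2 -> `|s - t| < r ->
    (t <= s -> enorm (f (X s) - f (X t)) <= (q + e) * Psi t s) /\
    (s <= t -> enorm (f (X t) - f (X s)) <= (q + e) * Psi s t).
  move=> t1t tt2; have [AX [[q0 slX] mX]] := H t t1t tt2.
  have [|d d0 Hd] := slX (q + e); first by lra.
  have [r r0 Hr] : exists2 r, 0 < r & forall i s, `|s - t| < r ->
      (t <= s -> (-1) ^+ b i * adapted u i (X t) <= (-1) ^+ b i * adapted u i (X s)) /\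
      (s <= t -> (-1) ^+ b i * adapted u i (X s) <= (-1) ^+ b i * adapted u i (X t)).
    apply: finite_pos_min => [i|i r r' r'r Hr s sr]; last by apply: Hr; exact: lt_le_trans r'r.
    have [r r0 Hr] := mX i; exists r => // s sr.
    have tr : `|t - t| < r by rewrite subrr normr0.
    by have [_ h1] := Hr t tr; have [_ h2] := Hr s sr; split; [exact: h1|exact: h2].
  have N0 : 0 < #|{: option 'I_n}|%:R + 1 :> R by rewrite ltr_wpDl.
  pose d1 := d / (#|{: option 'I_n}|%:R + 1); have d10 : 0 < d1 by rewrite divr_gt0.
  have [r' r'0 Hr'] : exists2 r, 0 < r & forall i s, `|s - t| < r ->
      `|adapted u i (X s) - adapted u i (X t)| < d1.
    apply: finite_pos_min => [i|i r2 r3 r'r H' s sr]; last by apply: H'; exact: lt_le_trans r'r.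
    have [r2 r20 /(_ t)[|+ _]] := mX i; first by rewrite subrr normr0.
    by move=> /(_ d1 d10)[r3 r30 Hr3]; exists r3.
  exists (Num.min r r'); first by rewrite lt_min r0.
  move=> s t1s st2; rewrite lt_min => /andP[sr sr'].
  have [AXs _] := H s t1s st2.
  have sumE : enorm (X s - X t) <= \sum_i `|adapted u i (X s) - adapted u i (X t)|.
    by apply: le_trans (enorm_adapted _ u1) _; apply: ler_sum => i _; rewrite adaptedB.
  have Xd : `|X s - X t| < d.
    apply: le_lt_trans (rV_norm_enorm _) _; apply: le_lt_trans sumE _.
    apply: le_lt_trans (_ : \sum_(i : option 'I_n) d1 < _).
      by apply: ler_sum => i _; rewrite ltW// Hr'.
    rewrite sumr_const -[ltLHS]mulr_natl /d1 mulrCA gtr_pMr//.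
    by rewrite ltr_pdivrMr// mul1r ltrDl.
  have fX : enorm (f (X s) - f (X t)) <= (q + e) * \sum_i `|adapted u i (X s) - adapted u i (X t)|.
    apply: le_trans (Hd _ AXs Xd) _; rewrite ler_wpM2l//; lra.
  split=> ts.
    apply: le_trans fX _; rewrite ler_wpM2l//; first by lra.
    apply: ler_sum => i _; have [/(_ ts) h _] := Hr i s sr.
    rewrite -[leLHS](_ : `|(-1) ^+ b i * (adapted u i (X s) - adapted u i (X t))| = _).
      by rewrite ger0_norm// mulrBr subr_ge0.
    by rewrite normrM normrX normrN1 expr1n mul1r.
  rewrite enormB; apply: le_trans fX _; rewrite ler_wpM2l//; first by lra.
  apply: ler_sum => i _; have [_ /(_ ts) h] := Hr i s sr.
  rewrite distrC -[leLHS](_ : `|(-1) ^+ b i * (adapted u i (X t) - adapted u i (X s))| = _).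
    by rewrite ger0_norm// mulrBr subr_ge0.
  by rewrite normrM normrX normrN1 expr1n mul1r.
apply: (@real_induction R (fun t => enorm (f (X t) - f (X t1)) <= (q + e) * Psi t1 t) t1 t2) => //.
- by rewrite subrr enorm0 /Psi big1 ?mulr0// => i _; rewrite subrr mulr0.
- move=> t t1t tt2 Pt; have [r r0 Hr] := loc t t1t (ltW tt2).
  exists (Num.min r (t2 - t)); first by rewrite lt_min r0 subr_gt0.
  move=> s ts sr; have [sr1 sr2] : s < t + r /\ s < t2.
    have := ge_min (t2 - t) r (t2 - t); have := ge_min r r (t2 - t).
    by rewrite !lexx orbT /=; lra.
  have [|||/(_ (ltW ts)) h _] := Hr s; [lra|exact: ltW|rewrite ltr_norml; lra|].
  rewrite -(PsiD t1 t s) mulrDr [leRHS]addrC -[X in enorm X](subrKA (f (X t))).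
  by apply: le_trans (enormD _ _) _; exact: lerD.
- move=> t t1t tt2 Ps; have [r r0 Hr] := loc t (ltW t1t) tt2.
  pose s := Num.max t1 (t - r / 2).
  have s1 : t1 <= s by rewrite le_max lexx.
  have s2 : t - r / 2 <= s by rewrite le_max lexx orbT.
  have st : s < t by rewrite gt_max t1t/=; lra.
  have [|||_ /(_ (ltW st)) h] := Hr s; [exact: s1|lra|rewrite ltr_norml; lra|].
  rewrite -(PsiD t1 s t) mulrDr [leRHS]addrC -[X in enorm X](subrKA (f (X s))).
  by apply: le_trans (enormD _ _) _; apply: lerD => //; exact: Ps.
Qed.

(** Asking for every bound [c] avoids naming the least one and keeps the condition first-order. *)
Definition bounded_by_slope n k (A : set 'rV[R]_n) (f : 'rV[R]_n -> 'rV[R]_k)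
    (mu : R) (J : 'M[R]_(n, k)) (x : 'rV[R]_n) :=
  forall c : R, slope_le A f x c -> forall u : 'rV[R]_n, enorm (u *m J) <= (c + mu) * enorm u.

Lemma norm_mulmx m n : exists2 K : R, 0 < K &
  forall (u : 'rV[R]_m) (M : 'M[R]_(m, n)), `|u *m M| <= K * `|u| * `|M|.
Proof.
exists (m%:R + 1) => [|u M]; first by rewrite ltr_wpDl.
apply/rV_norm_le; split=> [|j]; first by rewrite !mulr_ge0// addr_ge0.
rewrite mxE; apply: le_trans (ler_norm_sum _ _ _) _.
apply: le_trans (_ : \sum_(i < m) (`|u| * `|M|) <= _).
  apply: ler_sum => i _; rewrite normrM; apply: ler_pM => //; first exact: rV_norm_coord.
  rewrite /Num.norm/= mx_normrE.
  exact: (le_bigmax _ (fun ij : 'I_m * 'I_n => `|M ij.1 ij.2|) (i, j)).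
rewrite sumr_const card_ord -[leLHS]mulr_natl -mulrA ler_wpM2r ?mulr_ge0//.
by rewrite lerDl.
Qed.

(* If the slope of f near the points s(p) were smaller than the derivative of f
   along s, then s could be approximated by curves X(., t) in the region where
   the slope of f is at most q; along these f grows too slowly. *)
Lemma wing d n k (A : set 'rV[R]_n) (f : 'rV[R]_n -> 'rV[R]_k) (mu C0 : R)
  (s : 'rV[R]_d -> 'rV[R]_n) (M : 'rV[R]_d -> 'M[R]_(d, n))
  (m : 'rV[R]_d -> 'M[R]_(d, k)) (P : 'M[R]_(n, d)) p0 r0 :
  0 < mu -> def A -> dfun f -> dfun s -> dfun M -> dfun m -> 0 < r0 ->
  (forall x, A x -> slope_le A f x C0) ->
  (forall p, `|p - p0| < r0 -> [/\ A (s p), M p *m P = 1%:M,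
     strict_diff s p (fun u => u *m M p) &
     strict_diff (fun p => f (s p)) p (fun u => u *m m p)]) ->
  (forall p, `|p - p0| < r0 -> forall r, 0 < r -> exists x, A x /\ `|x - s p| < r /\
     exists c, slope_le A f x c /\ exists v, (c + mu) * enorm (v *m M p) < enorm (v *m m p)) ->
  False.
Proof.
move=> mu0 dA df ds dM dm r00 slA good bad.
have dsl := def_slope_le omD dA df.
pose L (q : R) (p : 'rV[R]_d) := forall r : R, 0 < r -> exists x : 'rV[R]_n,
  A x /\ `|x - s p| < r /\ slope_le A f x q.
pose S (q : rat) (p : 'rV[R]_d) := L (ratr q) p /\ exists v : 'rV[R]_d,
  (ratr q + mu / 2) * enorm (v *m M p) < enorm (v *m m p).
have dS q : def (S q) by rewrite /S /L; deft.
(* At p, let q be a rational less than mu / 2 above the infimum of the levels c with [L c p]. Near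
   [s p] no slope is then below q - mu / 2, so the bad inequality with [c + mu] persists with q + mu
   / 2. The Baire property makes q constant on a box. *)
have [|q [p1 [r1 [r10 H]]]] := definable_baire omD dS r00 (x0 := p0).
  move=> p pr; have [Asp _ _ _] := good p pr.
  pose T := [set c | L c p].
  have hT : has_inf T.
    split; first by exists C0 => r rr0; exists (s p); rewrite subrr normr0; split=> //; split=> //; exact: slA.
    by exists 0 => c /(_ 1 ltr01)[x [_ [_ []]]].
  have [q] := @rat_in_itvoo R (inf T) (inf T + mu / 2) ltac:(lra).
  rewrite in_itv/= => /andP[q1 q2]; exists q; split.
    have [c Tc cq] := inf_lt hT.1 q1; move=> r rr0; have [x [Ax [xr sx]]] := Tc r rr0.
    by exists x; split=> //; split=> //; exact: slope_le_mono sx (ltW cq).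
  have nL : ~ L (ratr q - mu / 2) p.
    by move=> Lq; have := ge_inf hT.2 Lq; lra.
  have [r rr0 nx] : exists2 r, 0 < r & forall x, A x -> `|x - s p| < r -> ~ slope_le A f x (ratr q - mu / 2).
    apply: contrapT => nr; apply: nL => r rr0; apply: contrapT => nx; apply: nr.
    by exists r => // x Ax xr sx; apply: nx; exists x.
  have [x [Ax [xr [c [sx [v Hv]]]]]] := bad p pr r rr0.
  have qc : ratr q - mu / 2 < c.
    by rewrite ltNge; apply/negP => cq; apply: (nx x Ax xr); exact: slope_le_mono sx cq.
  exists v; apply: le_lt_trans Hv; rewrite ler_wpM2r ?enorm_ge0//; lra.
pose q' : R := ratr q; rewrite -/q' in H.
have p1r : `|p1 - p1| < r1 by rewrite subrr normr0.
have [p1r0 [_ [v Hv]]] := H p1 p1r.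
have [As1 MP ds1 dm1] := good p1 p1r0.
have vM0 : 0 < enorm (v *m M p1).
  rewrite lt_neqAle enorm_ge0 andbT eq_sym; apply/eqP => /enorm_eq0 vM.
  have v0 : v = 0 by rewrite -(mulmx1 v) -MP mulmxA vM mul0mx.
  by move: Hv; rewrite v0 !mul0mx !enorm0 mulr0 ltxx.
pose v1 := (enorm (v *m M p1))^-1 *: v.
pose u := v1 *m M p1; pose w := v1 *m m p1.
have u1 : enorm u = 1.
  by rewrite /u /v1 -scalemxAl enormZ gtr0_norm ?invr_gt0// mulVf// gt_eqF.
have w1 : q' + mu / 2 < enorm w.
  rewrite /w /v1 -scalemxAl enormZ gtr0_norm ?invr_gt0// [ltRHS]mulrC ltr_pdivlMr//.
have q0 : 0 <= q' by have [_ [/(_ 1 ltr01)[x [_ [_ []]]]]] := H p1 p1r.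
pose a := `|v1|; have a0 : 0 <= a by exact: normr_ge0.
pose N : R := n%:R + k%:R + #|{: option 'I_n}|%:R.
have N0 : 0 <= N by rewrite !addr_ge0.
have nN : n%:R <= N by rewrite /N -addrA lerDl addr_ge0.
have kN : k%:R <= N by rewrite /N addrAC lerDr addr_ge0.
have oN : #|{: option 'I_n}|%:R <= N by rewrite /N lerDr addr_ge0.
(* Collects the errors of order [e]: in the end |w| <= q' + e K, whereas |w| > q' + mu / 2. *)
pose K := N * a + 1 + 2 * N * N * a * (q' + 1).
have q10 : 0 <= q' + 1 by rewrite addr_ge0.
have K0 : 0 < K.
  have h1 : 0 <= N * a by rewrite mulr_ge0.
  have h2 : 0 <= 2 * N * N * a * (q' + 1) by rewrite !mulr_ge0.
  by rewrite /K; move: h1 h2; clear; lra.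
pose e := Num.min 1 (mu / 2 / K).
have e0 : 0 < e by rewrite lt_min ltr01 divr_gt0// divr_gt0.
have e1 : e <= 1 by rewrite ge_min lexx.
have eK : e * K <= mu / 2 by rewrite -ler_pdivlMr// ge_min lexx orbT.
have [_ /(_ e e0)[rs rs0 Hs]] := ds1; have [_ /(_ e e0)[rm rm0 Hm]] := dm1.
pose al := Num.min r1 (Num.min rs rm) / (a + 1).
have al0 : 0 < al by rewrite divr_gt0 ?ltr_wpDl// !lt_min r10 rs0.
pose line t := p1 + t *: v1.
have lineB t : `|t| < al -> [/\ `|line t - p1| < r1, `|line t - p1| < rs & `|line t - p1| < rm].
  move=> tal; have : `|line t - p1| < Num.min r1 (Num.min rs rm).
    rewrite /line addrAC subrr add0r normrZ -/a.
    move: tal; rewrite /al ltr_pdivlMr ?ltr_wpDl//; apply: le_lt_trans.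
    by rewrite ler_wpM2l// lerDl.
  by rewrite !lt_min => /and3P[].
have lineD t t' : line t' - line t = (t' - t) *: v1.
  by rewrite /line opprD addrACA subrr add0r scalerBl.
(* For fixed h, t -> X (t, h) runs at distance less than h from the image of the line under [s],
   through points of slope at most q'. It is chosen without regard to continuity; [mono_box]
   provides that afterwards. *)
pose Q (z : R * R) (x : 'rV[R]_n) := A x /\ `|x - s (line z.1)| < z.2 /\ slope_le A f x q'.
have dQ : def (fun z : R * R * 'rV[R]_n => Q z.1 z.2) by rewrite /Q /line; deft.
have [X [dX HX]] := def_choice omD dQ.
have {}HX t h : `|t| < al -> 0 < h -> Q (t, h) (X (t, h)).
  move=> tal h0; apply: HX; have [tr1 _ _] := lineB t tal.
  by have [_ [/(_ h h0)[x Hx] _]] := H _ tr1; exists x.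
have dw i : dfun (fun z : R * R => adapted u i (X (z.1, z.2))).
  by apply: (dfun_adapted omD); deft.
have [|a' [b' [tau [[aa' ab' bb' tau0] Hw]]]] :=
   mono_box omD (index_enum {: option 'I_n}) (w := fun i t h => adapted u i (X (t, h))) dw (a := - al) (b := al).
  by move: al0; clear; lra.
have {}Hw i : exists c, forall t h, a' < t -> t < b' -> 0 < h -> h < tau ->
     mono_at c (fun t => adapted u i (X (t, h))) t.
  by apply: Hw; rewrite mem_index_enum.
have [b Hb] := choice Hw.
pose t1 := (2 * a' + b') / 3; pose t2 := (a' + 2 * b') / 3; pose dt := t2 - t1.
have dt0 : 0 < dt by rewrite /dt /t1 /t2; move: ab'; clear; lra.
have t1al : `|t1| < al by rewrite ltr_norml /t1; move: aa' ab' bb'; clear; lra.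
have t2al : `|t2| < al by rewrite ltr_norml /t2; move: aa' ab' bb'; clear; lra.
have [t1r1 t1rs t1rm] := lineB t1 t1al; have [t2r1 t2rs t2rm] := lineB t2 t2al.
pose s1 := s (line t1); pose s2 := s (line t2).
have As11 : A s1 by have [+ _] := H _ t1r1; move=> /good[].
have As22 : A s2 by have [+ _] := H _ t2r1; move=> /good[].
pose RHS := (q' + e) * \sum_i `|adapted u i (s2 - s1)|.
(* The bound along X (., h) is passed to the limit h -> 0, [f] being continuous on A at both end
   points. It then contradicts the derivatives of [s] and of f along [s] in the direction [v1]. *)
have key : enorm (f s2 - f s1) <= RHS.
  apply/ler_addgt0Pl => eta eta0.
  have eta40 : 0 < eta / 4 by move: eta0; clear; lra.
  have [r2 r20 Hr2] := slope_le_cont (slA _ As22) eta40.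
  have [r3 r30 Hr3] := slope_le_cont (slA _ As11) eta40.
  have c40 : 0 < (q' + e) * #|{: option 'I_n}|%:R * 4 + 1.
    by rewrite ltr_wpDl// !mulr_ge0// addr_ge0// ltW.
  have eta5 : 0 < eta / 2 / ((q' + e) * #|{: option 'I_n}|%:R * 4 + 1) by rewrite !divr_gt0.
  have [r4 r40 Hr4] := enorm_small n eta5.
  pose h := Num.min (Num.min r2 r3) (Num.min r4 tau) / 2.
  have hm0 : 0 < Num.min (Num.min r2 r3) (Num.min r4 tau) by rewrite !lt_min r20 r30 r40.
  have h0 : 0 < h by rewrite divr_gt0.
  have : h < Num.min (Num.min r2 r3) (Num.min r4 tau) by rewrite /h; move: hm0; clear; lra.
  rewrite !lt_min => /andP[/andP[h2 h3] /andP[h4 htau]].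
  have [AX1 [X1 _]] := HX t1 h t1al h0; have [AX2 [X2 _]] := HX t2 h t2al h0.
  rewrite /= -/s1 -/s2 in X1 X2.
  have t12 : t1 <= t2 by move: dt0; rewrite /dt subr_gt0 => /ltW.
  have := @slope_along_curve n k A f u (fun t => X (t, h)) b q' e t1 t2 u1 t12 e0.
  move=> /(_ _)/wrap[|along].
    move=> t tt1 tt2; have tal : `|t| < al by rewrite ltr_norml; move: tt1 tt2 aa' ab' bb'; rewrite /t1 /t2; clear; lra.
    have [? [_ ?]] := HX t h tal h0; split=> //; split=> // i.
    by apply: Hb => //; move: tt1 tt2 ab'; rewrite /t1 /t2; clear; lra.
  have f2 := Hr2 _ AX2 (lt_trans X2 h2); have f1 := Hr3 _ AX1 (lt_trans X1 h3).
  have ad i : (-1) ^+ b i * (adapted u i (X (t2, h)) - adapted u i (X (t1, h))) <=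
      `|adapted u i (s2 - s1)| + 4 * (eta / 2 / ((q' + e) * #|{: option 'I_n}|%:R * 4 + 1)).
    apply: le_trans (ler_norm _) _; rewrite normrM normrX normrN1 expr1n mul1r -adaptedB.
    have -> : X (t2, h) - X (t1, h) = (s2 - s1) + ((X (t2, h) - s2) - (X (t1, h) - s1)).
      by apply/rowP => j; rewrite !mxE; ring.
    rewrite adaptedD [X in _ + X]adaptedB.
    apply: le_trans (ler_normD _ _) _; rewrite lerD2l.
    apply: le_trans (ler_normB _ _) _.
    have := adapted_le (X (t2, h) - s2) i u1; have := adapted_le (X (t1, h) - s1) i u1.
    have := Hr4 _ (lt_trans X2 h4); have := Hr4 _ (lt_trans X1 h4).
    by clear; lra.
  have sum_ad : (q' + e) * \sum_i (-1) ^+ b i * (adapted u i (X (t2, h)) - adapted u i (X (t1, h))) <= RHS + eta / 2.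
    have qe0 : 0 <= q' + e by rewrite addr_ge0// ltW.
    apply: le_trans (ler_wpM2l qe0 (ler_sum _ (fun i _ => ad i))) _.
    rewrite big_split/= mulrDr lerD2l sumr_const -[X in _ * X]mulr_natl.
    set D0 := _ + 1 in c40 *.
    have -> : (q' + e) * (#|{: option 'I_n}|%:R * (4 * (eta / 2 / D0))) = eta / 2 * (((q' + e) * #|{: option 'I_n}|%:R * 4) / D0) by ring.
    apply: ler_piMr; first by move: eta0; clear; lra.
    by rewrite ler_pdivrMr// mul1r /D0 lerDl.
  have -> : f s2 - f s1 = (f (X (t2, h)) - f (X (t1, h))) + ((f s2 - f (X (t2, h))) + (f (X (t1, h)) - f s1)).
    by apply/rowP => j; rewrite !mxE; ring.
  apply: le_trans (enormD _ _) _.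
  have := enormD (f s2 - f (X (t2, h))) (f (X (t1, h)) - f s1).
  by rewrite (enormB (f s2)); move: f1 f2 along sum_ad; clear; lra.
have dfs : `|f s2 - f s1 - dt *: w| <= e * (dt * a).
  have := Hm _ _ t1rm t2rm; rewrite lineD -scalemxAl -/w -/dt normrZ -/a -/s1 -/s2.
  by rewrite (gtr0_norm dt0).
have dss : `|s2 - s1 - dt *: u| <= e * (dt * a).
  have := Hs _ _ t1rs t2rs; rewrite lineD -scalemxAl -/u -/dt normrZ -/a -/s1 -/s2.
  by rewrite (gtr0_norm dt0).
have da0 : 0 <= e * (dt * a) by rewrite !mulr_ge0// ltW.
have lower : dt * enorm w - N * (e * (dt * a)) <= enorm (f s2 - f s1).
  have h1 : enorm (f s2 - f s1 - dt *: w) <= N * (e * (dt * a)).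
    apply: le_trans (enorm_le_norm _) _; apply: ler_pM => //.
  have := enormD (f s2 - f s1) (- (f s2 - f s1 - dt *: w)).
  rewrite enormN opprB addrCA subrr addr0 enormZ (gtr0_norm dt0).
  by move: h1; clear; lra.
have upper : \sum_i `|adapted u i (s2 - s1)| <= dt * (1 + 2 * N * N * a * e).
  have ad0 i : `|adapted u i (s2 - s1)| <= `|adapted u i (dt *: u)| + 2 * (N * (e * (dt * a))).
    rewrite -[s2 - s1](subrK (dt *: u)) adaptedD.
    apply: le_trans (ler_normD _ _) _; rewrite addrC lerD2l.
    apply: le_trans (adapted_le _ i u1) _; rewrite ler_pM2l//.
    apply: le_trans (enorm_le_norm _) _; apply: ler_pM => //.
  apply: le_trans (ler_sum _ (fun i _ => ad0 i)) _.
  rewrite big_split/= sum_option /=.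
  have uu : dot u u = 1 by rewrite -enorm_sqr u1 expr1n.
  rewrite dotZr uu mulr1 (gtr0_norm dt0) big1 => [|j _]; last first.
    by rewrite mxE mulrC subrr normr0.
  rewrite addr0 sumr_const -[X in _ + X]mulr_natl.
  rewrite mulrDr mulr1 lerD2l.
  have -> : dt * (2 * N * N * a * e) = N * (2 * (N * (e * (dt * a)))) by ring.
  by apply: ler_wpM2r => //; apply: mulr_ge0 => //; exact: mulr_ge0.
have final : dt * enorm w - N * (e * (dt * a)) <= dt * ((q' + e) * (1 + 2 * N * N * a * e)).
  apply: le_trans lower _; apply: le_trans key _.
  rewrite /RHS mulrCA; apply: ler_wpM2l => //.
  by rewrite addr_ge0// ltW.
have : enorm w - N * e * a <= (q' + e) * (1 + 2 * N * N * a * e).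
  rewrite -(ler_pM2l dt0); apply: le_trans final; rewrite mulrBr lerD2l lerN2.
  by rewrite le_eqVlt; apply/orP; left; apply/eqP; ring.
have h2 : (q' + e) * (1 + 2 * N * N * a * e) <= q' + e * (1 + 2 * N * N * a * (q' + 1)).
  have : 0 <= 2 * N * N * a * e * (1 - e) by rewrite !mulr_ge0 ?subr_ge0// ltW.
  by clear; lra.
have h3 : e * K = N * e * a + e * (1 + 2 * N * N * a * (q' + 1)) by rewrite /K; ring.
by move: h2 h3 eK w1; clear; lra.
Qed.
End Wing.

(** * Pieces *)

Section Fibres.
Context (R : realType) (D : set_family R) (omD : o_minimal D).
Notation def := (@def R D _ _).
Notation dfun := (@dfun R D _ _ _ _).

Definition proj_interior n d (io : 'I_d -> 'I_n) (B : set 'rV[R]_n) :=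
  exists p0 r0, 0 < r0 /\ forall p, `|p - p0| < r0 -> exists x, B x /\ colsub io x = p.

Lemma colsubB n d (io : 'I_d -> 'I_n) (x y : 'rV[R]_n) :
  colsub io (x - y) = colsub io x - colsub io y.
Proof. by apply/rowP => i; rewrite !mxE. Qed.

Lemma norm_colsub n d (io : 'I_d -> 'I_n) (x : 'rV[R]_n) : `|colsub io x| <= `|x|.
Proof. by apply/rV_norm_le; split=> // i; rewrite mxE rV_norm_coord. Qed.

Lemma colsubE n d (io : 'I_d -> 'I_n) (x : 'rV[R]_n) :
  colsub io x = x *m (\matrix_(i, j) (i == io j)%:R).
Proof.
apply/rowP => j; rewrite !mxE (bigD1 (io j))//= mxE eqxx mulr1 big1 ?addr0//.
by move=> i ij; rewrite mxE (negbTE ij) mulr0.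
Qed.

Lemma seq_separated (s : seq R) : exists2 d, 0 < d &
  forall t t', t \in s -> t' \in s -> t <> t' -> d <= `|t - t'|.
Proof.
have one t (s' : seq R) : exists2 d, 0 < d & forall t', t' \in s' -> t <> t' -> d <= `|t - t'|.
  elim: s' => [|t' s' [d d0 H]]; first by exists 1.
  have [tt'|tt'] := eqVneq t t'.
    by subst t'; exists d => // t2; rewrite inE => /predU1P[->|]//; exact: H.
  exists (Num.min d `|t - t'|); first by rewrite lt_min d0 normr_gt0 subr_eq0.
  move=> t2; rewrite inE => /predU1P[->|t2s] n; first by rewrite ge_min lexx orbT.
  by rewrite ge_min H.
elim: s => [|t s [d d0 H]]; first by exists 1.
have [d' d'0 H'] := one t s; exists (Num.min d d'); first by rewrite lt_min d0.
move=> t1 t2; rewrite !inE => /predU1P[->|t1s] /predU1P[->|t2s] n //.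
- by rewrite ge_min H' ?orbT.
- by rewrite ge_min distrC H' ?orbT//; apply: nesym.
- by rewrite ge_min H.
Qed.

(** If over a whole box some coordinate of the fibre filled an interval, then on a smaller box this
    would be one coordinate and one rational interval, and a projection to d + 1 coordinates would
    have interior. So generic fibres have finitely many values in each coordinate, and the Baire
    property makes their separation locally uniform. *)
Lemma fibres_separated n d (io : 'I_d -> 'I_n) (B : set 'rV[R]_n) : def B ->
  (forall io' : 'I_d.+1 -> 'I_n, ~ proj_interior io' B) ->
  generic (fun p => exists m : nat, near_all p (fun p' => forall x x', B x -> B x' ->
    colsub io x = p' -> colsub io x' = p' -> x <> x' -> m.+1%:R^-1 <= `|x - x'|)).
Proof.
move=> dB noint.
pose Fin (p : 'rV[R]_d) := forall j : 'I_n, forall a b : R, a < b -> exists t : R,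
  a < t /\ t < b /\ ~ exists x : 'rV[R]_n, B x /\ colsub io x = p /\ x 0 j = t.
apply: (generic_cover omD (S := fun m p' => forall x x' : 'rV[R]_n, B x -> B x' ->
    colsub io x = p' -> colsub io x' = p' -> x <> x' -> m.+1%:R^-1 <= `|x - x'|)).
  by move=> m; deft.
have gF : generic Fin.
  apply: (generic_def omD); first by rewrite /Fin; deft.
  move=> x0 r0 r00 nF.
  pose S (i : 'I_n * (rat * rat)) (p : 'rV[R]_d) := forall t : R, ratr i.2.1 < t -> t < ratr i.2.2 ->
    exists x : 'rV[R]_n, B x /\ colsub io x = p /\ x 0 i.1 = t.
  have dS i : def (fun p => (ratr i.2.1 < ratr i.2.2 :> R) /\ S i p) by rewrite /S; deft.
  have [|[j [q1 q2]] [y [r [r1 H]]]] := definable_baire omD dS r00 (x0 := x0).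
    move=> p /nF nFp; apply: contrapT => nS; apply: nFp => j a b ab.
    apply: contrapT => nt; have [q1 [q2 [aq1 [q12 q2b]]]] := rat_between ab.
    apply: nS; exists (j, (q1, q2)); split=> // t q1t tq2.
    apply: contrapT => nx; apply: nt; exists t.
    by split; [exact: lt_trans q1t|split; [exact: lt_trans tq2 _|]].
  have [_ [/= q12 _]] := H y ltac:(by rewrite subrr normr0).
  (* The coordinate [j] is put in front of those selected by [io]. *)
  pose io' (i : 'I_d.+1) := oapp io j (unlift ord0 i).
  apply: (noint io'); pose c := (ratr q1 + ratr q2) / 2 : R.
  exists (\row_i oapp (y 0) c (unlift ord0 i)), (Num.min r ((ratr q2 - ratr q1) / 2)).
  split; first by rewrite lt_min r1/=; lra.
  move=> p /rV_norm_lt[_ Hp].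
  have Hp0 := Hp ord0; have HpS i := Hp (lift ord0 i).
  have Hp00 : `|p 0 ord0 - c| < (ratr q2 - ratr q1) / 2.
    by move: Hp0; rewrite !mxE unlift_none /= => /lt_le_trans; apply; rewrite ge_min lexx orbT.
  pose p' := \row_i p 0 (lift ord0 i).
  have [|_ [_ /(_ (p 0 ord0))[||x [Bx [xp xj]]]]] := H p'.
  - apply/rV_norm_lt; split=> // i; have := HpS i.
    by rewrite !mxE liftK /= lt_min => /andP[].
  - by move: Hp00; rewrite ltr_norml /c; clear; lra.
  - by move: Hp00; rewrite ltr_norml /c; clear; lra.
  exists x; split=> //; apply/rowP => i; rewrite !mxE /io'.
  case: unliftP => [i' ->|->] /=; last exact: xj.
  by have := congr1 (fun v : 'rV_d => v 0 i') xp; rewrite !mxE.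
apply: generic_mono gF => p Fp.
have ex j : exists2 dl, 0 < dl & forall t t', (exists x, B x /\ colsub io x = p /\ x 0 j = t) ->
   (exists x, B x /\ colsub io x = p /\ x 0 j = t') -> t <> t' -> dl <= `|t - t'|.
  have [|[a [b [ab H]]]|[s Hs]] := @tame_finite R D omD (fun t => exists x : 'rV[R]_n, B x /\ colsub io x = p /\ x 0 j = t).
  - by deft.
  - by exfalso; have [t [at_ [tb nt]]] := Fp j a b ab; apply: nt; exact: H.
  have [dl dl0 H] := seq_separated s; exists dl => // t t' /Hs ts /Hs t's.
  exact: H.
have [dl dl0 Hdl] := finite_pos_min ex (fun j r r' r'r H t t' h h' n => le_trans r'r (H t t' h h' n)).
have [m Hm] : exists m : nat, m.+1%:R^-1 < dl.
  have := @near_infty_natSinv_lt R (PosNum dl0).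
  by case=> N _ /(_ N (leqnn N)) /= h; exists N.
exists m => x x' Bx Bx' xp x'p xx'; apply/ltW/(lt_le_trans Hm).
have [j xj] : exists j, x 0 j <> x' 0 j.
  by apply: contrapT => nj; apply: xx'; apply/rowP => j; apply: contrapT => h; apply: nj; exists j.
apply: le_trans (_ : `|(x - x') 0 j| <= _); last exact: rV_norm_coord.
rewrite !mxE; apply: (Hdl j); [by exists x|by exists x'|exact: xj].
Qed.

(** A repeated index would confine the image to a diagonal. Injectivity is what bounds d by n. *)
Lemma proj_interior_inj n d (io : 'I_d -> 'I_n) (B : set 'rV[R]_n) :
  proj_interior io B -> injective io.
Proof.
move=> [p0 [r0 [r00 H]]] i j ij; apply: contrapT => /eqP inj.
pose p := p0 + (r0 / 2) *: delta_mx 0 i : 'rV[R]_d.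
have p0r : `|p0 - p0| < r0 by rewrite subrr normr0.
have [x [_ xp]] := H p0 p0r.
have pr : `|p - p0| < r0.
  rewrite /p addrAC subrr add0r; apply: le_lt_trans (norm_scale_delta _ _) _.
  by rewrite gtr0_norm; lra.
have [x' [_ xp']] := H p pr.
have e1 : p0 0 i = p0 0 j by rewrite -xp !mxE ij.
have e2 : p 0 i = p 0 j by rewrite -xp' !mxE ij.
by move: e2; rewrite /p !mxE !eqxx /= (eq_sym j) (negbTE inj) e1 mulr1n mulr0n; lra.
Qed.

Lemma gram_unit d n (M : 'M[R]_(d, n)) (P : 'M[R]_(n, d)) : M *m P = 1%:M ->
  M *m M^T \in unitmx.
Proof.
move=> MP; rewrite -row_free_unit -kermx_eq0; apply/rowV0P => v /sub_kermxP vG.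
have vM : v *m M = 0.
  apply: enorm_eq0; rewrite enormE.
  have -> : dot (v *m M) (v *m M) = (v *m M *m (v *m M)^T) 0 0.
    by rewrite mxE; apply: eq_bigr => i _; rewrite !mxE.
  by rewrite trmx_mul mulmxA -(mulmxA v) vG mul0mx mxE sqrtr0.
by rewrite -(mulmx1 v) -MP mulmxA vM mul0mx.
Qed.

(** [v *m M] is the orthogonal projection of [u] onto the row space of [M], the tangent space;
    [Lam], of the form M^T X, vanishes on the orthogonal complement. So the norm of [Lam] is already
    seen on tangent vectors. *)
Lemma gram_projection d n k (M : 'M[R]_(d, n)) (P : 'M[R]_(n, d)) (m X : 'M[R]_(d, k))
  (Lam : 'M[R]_(n, k)) : M *m P = 1%:M -> M *m Lam = m -> Lam = M^T *m X ->
  forall u, exists v, u *m Lam = v *m m /\ enorm (v *m M) <= enorm u.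
Proof.
move=> MP ML LX u; have GU := gram_unit MP.
pose G := M *m M^T; pose v := u *m M^T *m invmx G; exists v.
have vG : v *m G = u *m M^T by rewrite /v mulmxKV.
split; first by rewrite -ML LX !mulmxA -(mulmxA v M) -/G vG.
have orth : dot (u - v *m M) (v *m M) = 0.
  have -> : dot (u - v *m M) (v *m M) = ((u - v *m M) *m (v *m M)^T) 0 0.
    by rewrite mxE; apply: eq_bigr => i _; rewrite !mxE.
  by rewrite trmx_mul mulmxA mulmxBl -(mulmxA v M) -/G vG subrr mul0mx mxE.
rewrite -ler_sqr ?nnegrE ?enorm_ge0// !enorm_sqr.
have pyth (w z : 'rV[R]_n) : dot w z = 0 -> dot (w + z) (w + z) = dot z z + dot w w.
  by move=> wz; rewrite dotDl !dotDr (dotC z w) wz; ring.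
have := pyth _ _ orth; rewrite subrK => ->.
by rewrite lerDl dot_ge0.
Qed.

Lemma gram_solution d n k (M : 'M[R]_(d, n)) (P : 'M[R]_(n, d)) (m : 'M[R]_(d, k)) :
  M *m P = 1%:M -> exists (Lam : 'M[R]_(n, k)) (X : 'M[R]_(d, k)), M *m Lam = m /\ Lam = M^T *m X.
Proof.
move=> /gram_unit GU; exists (M^T *m (invmx (M *m M^T) *m m)), (invmx (M *m M^T) *m m).
by split=> //; rewrite mulmxA mulKVmx.
Qed.
End Fibres.

(** * A piece and the affine extension of f from it *)

Section Piece.
Context (R : realType) (D : set_family R) (omD : o_minimal D).
Notation def := (@def R D _ _).
Notation dfun := (@dfun R D _ _ _ _).

(* Strict differentiability of g|B at x with respect to the coordinates io. *)
Definition chart_diff n d m (io : 'I_d -> 'I_n) (B : set 'rV[R]_n)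
    (g : 'rV[R]_n -> 'rV[R]_m) (x : 'rV[R]_n) (M : 'M[R]_(d, m)) :=
  forall e : R, 0 < e -> exists2 r : R, 0 < r & forall a b : 'rV[R]_n, B a -> B b ->
    `|a - x| < r -> `|b - x| < r ->
    `|g b - g a - (colsub io b - colsub io a) *m M| <= e * `|colsub io b - colsub io a|.

Lemma bounded_linear_mulmx m n (M : 'M[R]_(m, n)) : bounded_linear (fun u : 'rV[R]_m => u *m M).
Proof.
split=> [a u v|]; first by rewrite mulmxDl -scalemxAl.
have [K K0 H] := @norm_mulmx R m n; exists (K * `|M|); split=> [|u]; first by rewrite mulr_ge0// ltW.
by rewrite mulrAC.
Qed.

Lemma bounded_linear_comp (U V W : normedModType R) (g : V -> W) (f : U -> V) :
  bounded_linear g -> bounded_linear f -> bounded_linear (fun u => g (f u)).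
Proof.
move=> [lg [K [K0 HK]]] [lf [K' [K'0 HK']]]; split=> [a u v|]; first by rewrite lf lg.
exists (K * K'); split=> [|u]; first exact: mulr_ge0.
by apply: le_trans (HK _) _; rewrite -mulrA ler_wpM2l.
Qed.

(** The coordinates [psi] of [b] are linear and [b] takes its values in B, so the derivative in the
    chart suffices; differentiability of [b] itself is the special case where [g] is the
    identity. *)
Lemma chart_diff_comp (V : normedModType R) n d m (io : 'I_d -> 'I_n) (B : set 'rV[R]_n)
    (g : 'rV[R]_n -> 'rV[R]_m) (b : V -> 'rV[R]_n) (psi : V -> 'rV[R]_d) z M :
  bounded_linear psi ->
  (forall e, 0 < e -> exists2 r, 0 < r & forall z', `|z' - z| < r ->
     [/\ B (b z'), colsub io (b z') = psi z' & `|b z' - b z| < e]) ->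
  chart_diff io B g (b z) M -> strict_diff (fun z => g (b z)) z (fun u => psi u *m M).
Proof.
move=> bpsi Hb cg; split; first exact: (bounded_linear_comp (bounded_linear_mulmx M) bpsi).
move=> e e0; have [lpsi [K [K0 HK]]] := bpsi.
have e10 : 0 < e / (K + 1) by rewrite divr_gt0//; lra.
have [r r0 Hr] := cg _ e10; have [r' r'0 Hr'] := Hb r r0.
exists r' => // a c ar cr; have [Ba pa ba] := Hr' a ar; have [Bc pc bc] := Hr' c cr.
have := Hr _ _ Ba Bc ba bc; rewrite pa pc -(bounded_linearB _ _ bpsi).
move=> /le_trans; apply.
apply: le_trans (ler_wpM2l (ltW e10) (HK _)) _.
rewrite mulrA ler_wpM2r// mulrAC ler_pdivrMr; last by lra.
by rewrite ler_wpM2l//; [exact: ltW|lra].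
Qed.

Lemma section_chart_diff n d m (io : 'I_d -> 'I_n) (B : set 'rV[R]_n)
    (g : 'rV[R]_n -> 'rV[R]_m) (s : 'rV[R]_d -> 'rV[R]_n) p M rho :
  0 < rho -> colsub io (s p) = p ->
  (forall x, B x -> `|x - s p| < rho -> x = s (colsub io x)) ->
  strict_diff (fun p => g (s p)) p (fun u => u *m M) -> chart_diff io B g (s p) M.
Proof.
move=> rho0 sp loc [_ H] e e0; have [r r0 Hr] := H e e0.
exists (Num.min r rho); first by rewrite lt_min r0.
move=> a b Ba Bb; rewrite !lt_min => /andP[ar ad] /andP[br bd].
have := Hr (colsub io a) (colsub io b).
rewrite -(loc a)// -(loc b)//; apply; rewrite -[X in _ - X]sp -colsubB.
  exact: le_lt_trans (norm_colsub _ _) ar.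
exact: le_lt_trans (norm_colsub _ _) br.
Qed.

Lemma strict_diff_matrix m n (f : 'rV[R]_m -> 'rV[R]_n) x L : strict_diff f x L ->
  exists J : 'M[R]_(m, n), strict_diff f x (fun u => u *m J) /\ forall u, L u = u *m J.
Proof.
move=> df; have bL := df.1; pose J : 'M[R]_(m, n) := \matrix_(i, j) L (delta_mx 0 i) 0 j.
have LE u : L u = u *m J.
  rewrite {1}(matrix_sum_delta u) big_ord1.
  have Lsum (I : Type) (s : seq I) (F : I -> 'rV[R]_m) : L (\sum_(i <- s) F i) = \sum_(i <- s) L (F i).
    elim: s => [|i s IH]; first by rewrite !big_nil (bounded_linear0 bL).
    by rewrite !big_cons (bounded_linearD _ _ bL) IH.
  rewrite Lsum; apply/rowP => j; rewrite summxE mxE; apply: eq_bigr => i _.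
  by rewrite (bounded_linearZ _ _ bL) !mxE.
by exists J; split=> //; exact: strict_diff_eqL df.
Qed.

Section OnePiece.
Variables (n k : nat) (A : set 'rV[R]_n) (f : 'rV[R]_n -> 'rV[R]_k) (mu C0 : R).
Hypotheses (mu0 : 0 < mu) (dA : def A) (df : dfun f).
Hypothesis slA : forall x, A x -> slope_le A f x C0.
Variables (B : set 'rV[R]_n) (d : nat) (io : 'I_d -> 'I_n).
Hypotheses (dB : def B) (BA : forall x, B x -> A x).
Hypothesis noint : forall io' : 'I_d.+1 -> 'I_n, ~ proj_interior io' B.

Definition proj_mx : 'M[R]_(n, d) := \matrix_(i, j) (i == io j)%:R.
Notation P := proj_mx.

(* Lam is the tangential derivative of f|B at x, extended by 0 on the normal
   space. *)
Definition tangential (x : 'rV[R]_n) (Lam : 'M[R]_(n, k)) :=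
  exists M : 'M[R]_(d, n), exists m : 'M[R]_(d, k), exists X : 'M[R]_(d, k),
    chart_diff io B id x M /\ chart_diff io B f x m /\ M *m P = 1%:M /\
    M *m Lam = m /\ Lam = M^T *m X.

Variable Lam : 'rV[R]_n -> 'M[R]_(n, k).
Hypothesis dLam : dfun Lam.
Hypothesis Lam_tangential : forall x, (exists L, tangential x L) -> tangential x (Lam x).

(** Openness of the projection of B at [x]. It gives M P = 1 in [chart_diff_proj] and, in
    [base_near], a base point for every nearby point. *)
Definition opened (x : 'rV[R]_n) := forall r : R, 0 < r -> exists2 e : R, 0 < e &
  forall p : 'rV[R]_d, `|p - colsub io x| < e ->
    exists x' : 'rV[R]_n, B x' /\ `|x' - x| < r /\ colsub io x' = p.

(** The derivative [N] of [Lam] is required because the affine extension of f contains [Lam] and has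
    to be C^1. *)
Definition good_point (x : 'rV[R]_n) := tangential x (Lam x) /\ opened x /\
  (exists N : 'M[R]_(d, n * k), chart_diff io B (fun x => mxvec (Lam x)) x N) /\
  exists2 r : R, 0 < r & forall x' : 'rV[R]_n, A x' -> `|x' - x| < r ->
    bounded_by_slope A f mu (Lam x) x'.

Lemma def_tangential : def (fun z : 'rV[R]_n * 'M[R]_(n, k) => tangential z.1 z.2).
Proof. by rewrite /tangential /chart_diff; deft. Qed.

Lemma def_good_point : def good_point.
Proof.
have dsl := def_slope_le omD dA df; have dt := def_tangential.
rewrite /good_point /opened /chart_diff /bounded_by_slope; deft.
Qed.

Definition piece : set 'rV[R]_n := fun y => B y /\ exists2 r : R, 0 < r & forall x : 'rV[R]_n,
  B x -> `|x - y| < r -> good_point x.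

Lemma def_piece : def piece.
Proof. by rewrite /piece; have dg := def_good_point; deft. Qed.

Lemma chart_diff_proj x M : opened x -> chart_diff io B id x M -> B x -> M *m P = 1%:M.
Proof.
move=> ox cM Bx; apply/row_matrixP => i; rewrite row_mul row1.
apply/eqP; rewrite -subr_eq0 -normr_le0; apply/ler_addgt0Pl => e e0; rewrite addr0.
have [r r0 Hr] := cM e e0; have [q q0 Hq] := ox r r0.
pose p := colsub io x + (q / 2) *: delta_mx 0 i : 'rV[R]_d.
have pB : p - colsub io x = (q / 2) *: delta_mx 0 i by rewrite /p addrAC subrr add0r.
have [|x' [Bx' [x'r x'p]]] := Hq p.
  rewrite pB; apply: le_lt_trans (norm_scale_delta _ _) _; rewrite gtr0_norm; lra.
have := Hr x x' Bx Bx'; rewrite subrr normr0 x'p pB => /(_ r0 x'r) h.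
have : `|(x' - x - (q / 2) *: delta_mx 0 i *m M) *m P| <= e * (q / 2).
  rewrite -colsubE; apply: le_trans (norm_colsub _ _) _; apply: le_trans h _.
  rewrite ler_wpM2l ?(ltW e0)//; apply: le_trans (norm_scale_delta _ _) _.
  by rewrite gtr0_norm; lra.
rewrite mulmxBl -[(x' - x) *m P]colsubE colsubB x'p pB -!scalemxAl -rowE -scalerBr normrZ.
rewrite gtr0_norm; last by lra.
by rewrite mulrC ler_pM2r ?divr_gt0// distrC.
Qed.

Section LocalSection.
Variables (s : 'rV[R]_d -> 'rV[R]_n) (p0 : 'rV[R]_d) (r0 : R).
Hypotheses (ds : dfun s) (r00 : 0 < r0).
Hypothesis sB : forall p, `|p - p0| < r0 -> B (s p) /\ colsub io (s p) = p.

(** Generically s, f o s and Lam o s are strictly differentiable and the fibres of B are separated,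
    so that B is locally the graph of s. Every condition on a good point then holds except the bound
    by nearby slopes, and if that failed on a whole box, [wing] would give a contradiction. *)
Lemma section_meets_piece : exists p, `|p - p0| < r0 /\ piece (s p).
Proof.
have dfs : dfun (fun p => f (s p)) by deft.
have dLs : dfun (fun p => mxvec (Lam (s p))) by deft.
have g := generic_and (fibres_separated omD io dB noint) (generic_and
  (generic_near (generic_C1 omD ds)) (generic_and (generic_near (generic_C1 omD dfs))
  (generic_near (generic_C1 omD dLs)))).
have [p1 [r1 [r10 H]]] := g p0 r0 r00.
(* By continuity of [s], [x] and the point of [s] in its fibre are closer than the separation
   1/(m+1) of that fibre, hence equal. *)
have loc p : `|p - p1| < r1 -> exists2 rho, 0 < rho &
    forall x, B x -> `|x - s p| < rho -> x = s (colsub io x).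
  move=> pr; have [pr0 [[m [q q0 Hq]] [[q' q'0 Hq'] _]]] := H p pr.
  have [|J sJ] := Hq' p; first by rewrite subrr normr0.
  have cs := strict_diff_cont sJ.
  have m0 : 0 < m.+1%:R^-1 / 2 :> R by rewrite divr_gt0// invr_gt0.
  have [q2 q20 Hq2] := cs _ m0; have [q3 q30 Hq3] := ball_near pr0.
  exists (Num.min (Num.min q q2) (Num.min q3 (m.+1%:R^-1 / 2))).
    by rewrite !lt_min q0 q20 q30.
  move=> x Bx; rewrite !lt_min => /andP[/andP[xq xq2] /andP[xq3 xm]].
  have pip : `|colsub io x - p| <= `|x - s p|.
    by have [_ {1}<-] := sB pr0; rewrite -colsubB norm_colsub.
  have [Bs ps] := sB (Hq3 _ (le_lt_trans pip xq3)).
  apply: contrapT => xs.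
  have := Hq _ (le_lt_trans pip xq) x (s (colsub io x)) Bx Bs erefl ps xs.
  rewrite leNgt => /negP; apply.
  rewrite -(subrKA (s p)); apply: le_lt_trans (ler_normD _ _) _.
  have h := Hq2 _ (le_lt_trans pip xq2); rewrite [X in _ + X]distrC.
  apply: lt_le_trans (ltrD xm h) _; by rewrite -splitr.
have sdiff p : `|p - p1| < r1 -> [/\ exists J : 'M[R]_(d, n), strict_diff s p (fun u => u *m J),
    exists J : 'M[R]_(d, k), strict_diff (fun p => f (s p)) p (fun u => u *m J) &
    exists J : 'M[R]_(d, n * k), strict_diff (fun p => mxvec (Lam (s p))) p (fun u => u *m J)].
  move=> pr; have [_ [_ [[q q0 Hq] [[q' q'0 Hq'] [q2 q20 Hq2]]]]] := H p pr.
  by split; [apply: Hq|apply: Hq'|apply: Hq2]; rewrite subrr normr0.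
have sBp p : `|p - p1| < r1 -> B (s p) /\ colsub io (s p) = p.
  by move=> /H[pr _]; exact: sB.
have sop p : `|p - p1| < r1 -> opened (s p).
  move=> pr r rr; have [[J sJ] _ _] := sdiff p pr.
  have [q q0 Hq] := strict_diff_cont sJ rr; have [q' q'0 Hq'] := ball_near pr.
  exists (Num.min q q'); first by rewrite lt_min q0.
  have [_ sp] := sBp p pr; rewrite sp.
  move=> p'; rewrite lt_min => /andP[pq pq']; exists (s p').
  by have [? ?] := sBp p' (Hq' _ pq'); split=> //; split=> //; exact: Hq.
have stan p : `|p - p1| < r1 -> tangential (s p) (Lam (s p)).
  move=> pr; have [[M sM] [m sm] _] := sdiff p pr; have [rho rho0 Hrho] := loc p pr.
  have [Bsp psp] := sBp p pr.
  have cM : chart_diff io B id (s p) M by exact: (section_chart_diff rho0 psp Hrho).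
  have cm : chart_diff io B f (s p) m by exact: (section_chart_diff rho0 psp Hrho).
  have MP := chart_diff_proj (sop p pr) cM Bsp.
  have [L [X [ML LX]]] := gram_solution m MP.
  by apply: Lam_tangential; exists L, M, m, X.
have sN p : `|p - p1| < r1 -> exists N : 'M[R]_(d, n * k), chart_diff io B (fun x => mxvec (Lam x)) (s p) N.
  move=> pr; have [_ _ [N HN]] := sdiff p pr; have [rho rho0 Hrho] := loc p pr.
  by exists N; apply: (section_chart_diff rho0 (sBp p pr).2 Hrho).
pose Wg (p : 'rV[R]_d) := exists2 r : R, 0 < r & forall x' : 'rV[R]_n, A x' -> `|x' - s p| < r ->
    bounded_by_slope A f mu (Lam (s p)) x'.
have dsl := def_slope_le omD dA df.
have dW : def Wg by rewrite /Wg /bounded_by_slope; deft.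
have [[p2 [r2 [r20 H2]]]|noW] := pselect (exists p2 r2, 0 < r2 /\
    forall p, `|p - p2| < r2 -> `|p - p1| < r1 /\ Wg p).
  have p22 : `|p2 - p2| < r2 by rewrite subrr normr0.
  have [p21 _] := H2 p2 p22; exists p2; split; first by have [] := H p2 p21.
  split; first by have [] := sBp p2 p21.
  have [rho rho0 Hrho] := loc p2 p21.
  exists (Num.min rho r2); first by rewrite lt_min rho0.
  move=> x Bx; rewrite lt_min => /andP[xrho xr2].
  have xp2 : `|colsub io x - p2| < r2.
    have [_ {1}<-] := sBp p2 p21; rewrite -colsubB.
    exact: le_lt_trans (norm_colsub _ _) xr2.
  have [xp1 Wx] := H2 _ xp2; rewrite (Hrho x Bx xrho).
  by split; [exact: stan|split; [exact: sop|split; [exact: sN|exact: Wx]]].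
(* otherwise the wing lemma applies on a smaller ball *)
exfalso; have [[] [p2 [r2 [r20 H2]]]] := @definable_baire R D omD d bool
   (fun b p => if b then Wg p else ~ Wg p) p1 r1 ltac:(by case; [|apply: (def_not omD)]) r10
   ltac:(by move=> p _; have [] := pselect (Wg p); [exists true|exists false]).
  by apply: noW; exists p2, r2.
(* The linear part of [strict_diff] is automatic for matrices, so the derivative is chosen definably
   from the estimate alone. *)
have dgM : def (fun z : 'rV[R]_d * 'M[R]_(d, n) => forall e : R, 0 < e -> exists2 r : R, 0 < r &
    forall a b : 'rV[R]_d, `|a - z.1| < r -> `|b - z.1| < r -> `|s b - s a - (b - a) *m z.2| <= e * `|b - a|).
  by deft.
have [M [dM HM]] := def_choice omD (P := fun p M => forall e : R, 0 < e -> exists2 r : R, 0 < r &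
    forall a b : 'rV[R]_d, `|a - p| < r -> `|b - p| < r -> `|s b - s a - (b - a) *m M| <= e * `|b - a|) dgM.
have dgm : def (fun z : 'rV[R]_d * 'M[R]_(d, k) => forall e : R, 0 < e -> exists2 r : R, 0 < r &
    forall a b : 'rV[R]_d, `|a - z.1| < r -> `|b - z.1| < r -> `|f (s b) - f (s a) - (b - a) *m z.2| <= e * `|b - a|).
  by deft.
have [m [dm Hm]] := def_choice omD (P := fun p m => forall e : R, 0 < e -> exists2 r : R, 0 < r &
    forall a b : 'rV[R]_d, `|a - p| < r -> `|b - p| < r -> `|f (s b) - f (s a) - (b - a) *m m| <= e * `|b - a|) dgm.
have sM p : `|p - p1| < r1 -> strict_diff s p (fun u => u *m M p).
  move=> pr; split; first exact: bounded_linear_mulmx.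
  by apply: HM; have [[J [_ HJ]] _ _] := sdiff p pr; exists J.
have sm p : `|p - p1| < r1 -> strict_diff (fun p => f (s p)) p (fun u => u *m m p).
  move=> pr; split; first exact: bounded_linear_mulmx.
  by apply: Hm; have [_ [J [_ HJ]] _] := sdiff p pr; exists J.
have mulmx_inj a b (M1 M2 : 'M[R]_(a, b)) : (forall u : 'rV[R]_a, u *m M1 = u *m M2) -> M1 = M2.
  by move=> h; apply/row_matrixP => i; rewrite !rowE.
apply: (wing omD (A := A) (f := f) (s := s) (M := M) (m := m) (P := P) (mu := mu) (C0 := C0)
   (p0 := p2) (r0 := r2)) => // p /H2[pr nW].
  have [Bs ps] := sBp p pr; split.
  - exact: BA.
  - have [rho rho0 Hrho] := loc p pr.
    apply: (chart_diff_proj (sop p pr)) => //.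
    exact: (section_chart_diff rho0 ps Hrho (sM p pr)).
  - exact: sM.
  - exact: sm.
move=> r rr.
have [M' [m' [X [cM' [cm' [M'P [M'L LX]]]]]]] := stan p pr.
have sec e : 0 < e -> exists2 q, 0 < q & forall p', `|p' - p| < q ->
     [/\ B (s p'), colsub io (s p') = p' & `|s p' - s p| < e].
  move=> e0; have [q q0 Hq] := strict_diff_cont (sM p pr) e0.
  have [q' q'0 Hq'] := ball_near pr.
  exists (Num.min q q'); first by rewrite lt_min q0.
  move=> p'; rewrite lt_min => /andP[pq pq'].
  by have [? ?] := sBp p' (Hq' _ pq'); split=> //; exact: Hq.
have eM : M p = M'.
  apply: mulmx_inj => u.
  exact: (strict_diff_unique (sM p pr) (chart_diff_comp (bounded_linear_id _) sec cM') u).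
have em : m p = m'.
  apply: mulmx_inj => u.
  exact: (strict_diff_unique (sm p pr) (chart_diff_comp (bounded_linear_id _) sec cm') u).
apply: contrapT => nx; apply: nW; exists r => // x Ax xr c sx u; rewrite leNgt; apply/negP => h.
apply: nx; exists x; split=> //; split=> //; exists c; split=> //.
have [v [uL vM]] := gram_projection M'P M'L LX u.
exists v; rewrite eM em -uL; apply: le_lt_trans h.
by apply: ler_wpM2l => //; rewrite addr_ge0 ?(ltW mu0)//; case: sx.
Qed.
End LocalSection.

(** Definable choice would turn a box in the projection into a section of B avoiding the piece,
    against [section_meets_piece]. *)
Lemma piece_complement : ~ proj_interior io (fun x => B x /\ ~ piece x).
Proof.
move=> [p0 [r0 [r00 H]]].
have dQ : def (fun z : 'rV[R]_d * 'rV[R]_n => (B z.2 /\ ~ piece z.2) /\ colsub io z.2 = z.1).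
  by have dp := def_piece; deft.
have [s [ds Hs]] := def_choice omD (P := fun p x => (B x /\ ~ piece x) /\ colsub io x = p) dQ.
have [|p [pr Ps]] := @section_meets_piece s p0 r0 ds r00.
  by move=> p /H /Hs[[? _] ?].
by have [[_ ]] := Hs p (H p pr).
Qed.

Lemma piece_open y : piece y -> exists2 r, 0 < r & forall x, B x -> `|x - y| < r -> piece x.
Proof.
move=> [By [r r0 Hr]]; exists r => // x Bx xy; split=> //.
by have [q q0 Hq] := ball_near xy; exists q => // z Bz zx; apply: Hr => //; exact: Hq.
Qed.

Lemma piece_good_point y : piece y -> good_point y.
Proof. by move=> [By [r r0 Hr]]; apply: Hr => //; rewrite subrr normr0. Qed.

(** [x] is the base point of [z], its projection to the piece along the fibre. Injectivity on the
    ball of radius 4 r, rather than r, makes it unique: of two candidates, the one with the smaller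
    radius lies in the larger ball of the other. *)
Definition base_rel (z x : 'rV[R]_n) := piece x /\ exists2 r : R, 0 < r &
  (forall a b : 'rV[R]_n, B a -> B b -> `|a - x| < 4 * r -> `|b - x| < 4 * r ->
     colsub io a = colsub io b -> a = b) /\ colsub io z = colsub io x /\ `|z - x| < r.

Lemma def_base_rel : def (fun z : 'rV[R]_n * 'rV[R]_n => base_rel z.1 z.2).
Proof. by rewrite /base_rel; have dp := def_piece; deft. Qed.

Lemma base_unique z x x' : base_rel z x -> base_rel z x' -> x = x'.
Proof.
have wlogH x1 x2 r1 r2 : piece x1 -> piece x2 -> r1 <= r2 -> 0 < r2 ->
  (forall a b : 'rV[R]_n, B a -> B b -> `|a - x2| < 4 * r2 -> `|b - x2| < 4 * r2 ->
     colsub io a = colsub io b -> a = b) -> colsub io z = colsub io x1 -> colsub io z = colsub io x2 ->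
  `|z - x1| < r1 -> `|z - x2| < r2 -> x1 = x2.
  move=> [B1 _] [B2 _] r12 r20 inj p1 p2 z1 z2; apply: inj => //; last by rewrite -p1.
    rewrite -(subrKA z); apply: le_lt_trans (ler_normD _ _) _.
    by rewrite (distrC x1); move: z1 z2 r12 r20; lra.
  by rewrite subrr normr0 mulr_gt0.
move=> [px [r r0 [inj [p1 z1]]]] [px' [r' r'0 [inj' [p1' z1']]]].
have [rr'|/ltW r'r] := leP r r'; first exact: (wlogH x x' r r').
by apply/esym; exact: (wlogH x' x r' r).
Qed.

Lemma base_self y : piece y -> base_rel y y.
Proof.
move=> py; split=> //; have [[M [m [X [cM _]]]] _] := piece_good_point py.
have [r r0 Hr] := cM 1 ltr01; exists (r / 4); first by rewrite divr_gt0.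
split; last by rewrite subrr normr0 divr_gt0.
move=> a b Ba Bb; rewrite mulrC divfK// => ar br ab; have := Hr a b Ba Bb ar br.
by rewrite ab subrr mul0mx subr0 normr0 mulr0 normr_le0 subr_eq0 => /eqP.
Qed.

Lemma base_near z x e : base_rel z x -> 0 < e -> exists2 q, 0 < q & forall z', `|z' - z| < q ->
  exists x', base_rel z' x' /\ `|x' - x| < e.
Proof.
move=> [px [r r0 [inj [zx zr]]]] e0; have [_ [ox _]] := piece_good_point px.
have [r1 r10 Hr1] := piece_open px.
pose c := (r - `|z - x|) / 4; have c0 : 0 < c by rewrite divr_gt0// subr_gt0.
have [q q0 Hq] := ox (Num.min (Num.min e r1) c) ltac:(by rewrite !lt_min e0 r10 c0).
exists (Num.min q c); first by rewrite lt_min q0.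
move=> z'; rewrite lt_min => /andP[zq zc].
have [|x' [Bx' []]] := Hq (colsub io z').
  by rewrite -zx -colsubB; exact: le_lt_trans (norm_colsub _ _) zq.
rewrite !lt_min => /andP[/andP[xe xr1] xc] x'p; exists x'; split=> //; split; first exact: Hr1.
exists (r - c); first by rewrite /c; move: (normr_ge0 (z - x)) r0; lra.
have tri a : `|a - x'| < 4 * (r - c) -> `|a - x| < 4 * r.
  move=> h; rewrite -(subrKA x'); apply: le_lt_trans (ler_normD _ _) _.
  by move: h xc c0; lra.
split; first by move=> a b Ba Bb /tri ar /tri br; exact: inj.
split=> //; rewrite -(subrKA z); apply: le_lt_trans (ler_normD _ _) _.
rewrite -[z - x'](subrKA x); apply: le_lt_trans (lerD (lexx _) (ler_normD _ _)) _.
rewrite (distrC x x'); move: zc xc; rewrite /c; lra.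
Qed.

Lemma bounded_linear_vec_mx p q : bounded_linear (@vec_mx R p q).
Proof.
split=> [a u v|]; first by rewrite linearP.
exists 1; split=> // u; rewrite mul1r [`|vec_mx u|]/Num.norm/= mx_normrE.
apply/bigmax_leP; split=> // -[i j] _ /=.
by rewrite mxE rV_norm_coord.
Qed.

(* On a neighbourhood of the piece, extend f|piece affinely in the fibres of the
   coordinate projection, with linear part Lam. *)
Lemma piece_extension : exists (N : set 'rV[R]_n) (F : 'rV[R]_n -> 'rV[R]_k),
  [/\ def N, forall z, N z -> near_all z N, forall y, piece y -> N y & dfun F] /\
  [/\ forall z, N z -> exists J : 'M[R]_(n, k), strict_diff F z (fun u => u *m J),
      forall y, piece y -> F y = f y &
      forall y, piece y -> exists J : 'M[R]_(n, k), strict_diff F y (fun u => u *m J) /\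
        near_all y (fun x => A x -> bounded_by_slope A f mu J x)].
Proof.
have [b [db Hb]] := def_choice omD def_base_rel.
pose N : set 'rV[R]_n := fun z => exists x : 'rV[R]_n, base_rel z x.
have bE z x : base_rel z x -> b z = x.
  by move=> zx; exact: (base_unique (Hb z (ex_intro _ x zx)) zx).
pose F z := f (b z) + (z - b z) *m Lam (b z).
have near_b z : N z -> forall e, 0 < e -> exists2 r, 0 < r & forall z', `|z' - z| < r ->
     [/\ B (b z'), colsub io (b z') = colsub io z' & `|b z' - b z| < e].
  move=> [x zx] e e0; have [q q0 Hq] := base_near zx e0; exists q => // z' /Hq[x' [z'x' xx']].
  rewrite (bE _ _ zx) (bE _ _ z'x'); split=> //; first by have [[]] := z'x'.
  by have [_ [r _ [_ [-> _]]]] := z'x'.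
have bl_pi : bounded_linear (fun u : 'rV[R]_n => colsub io u).
  have -> : (fun u : 'rV[R]_n => colsub io u) = (fun u => u *m P).
    by apply/funext => u; rewrite colsubE.
  exact: bounded_linear_mulmx.
have mul_bilin : bounded_bilinear (fun (v : 'rV[R]_n) (L : 'M[R]_(n, k)) => v *m L).
  split=> [u a v w|v a u w|]; first by rewrite mulmxDr scalemxAr.
    by rewrite mulmxDl scalemxAl.
  by have [K K0 HK] := @norm_mulmx R n k; exists K; split=> //; exact: ltW.
have FD z : N z -> exists M m (Nm : 'M[R]_(d, n * k)), [/\ chart_diff io B id (b z) M, chart_diff io B f (b z) m,
   M *m Lam (b z) = m &
   strict_diff F z (fun u => colsub io u *m m + ((u - colsub io u *m M) *m Lam (b z) +
      (z - b z) *m vec_mx (colsub io u *m Nm)))].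
  move=> Nz; have [x zx] := Nz; have px : piece (b z) by rewrite (bE _ _ zx); case: zx.
  have [[M [m [X [cM [cm [_ [ML _]]]]]]] [_ [[Nm cN] _]]] := piece_good_point px.
  exists M, m, Nm; split=> //.
  have sb := chart_diff_comp bl_pi (near_b z Nz) cM.
  have sf := chart_diff_comp bl_pi (near_b z Nz) cm.
  have sL := strict_diff_comp (chart_diff_comp bl_pi (near_b z Nz) cN)
    (strict_diff_linear _ (@bounded_linear_vec_mx n k)).
  have sL' : strict_diff (fun z => Lam (b z)) z (fun u => vec_mx (colsub io u *m Nm)).
    by apply: strict_diff_ext sL; [exact: ltr01|move=> z' _; rewrite mxvecK].
  exact: (strict_diff_add sf (strict_diff_bilinear mul_bilin
    (strict_diff_sub (strict_diff_id z) sb) sL')).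
have bY y : piece y -> b y = y by move=> /base_self; exact: bE.
have NY y : piece y -> N y by move=> /base_self yy; exists y.
exists N, F; split; split.
- by rewrite /N; have dr := def_base_rel; deft.
- move=> z [x zx]; have [q q0 Hq] := base_near zx ltr01; exists q => // z' /Hq[x' [z'x' _]].
  by exists x'.
- exact: NY.
- by rewrite /F; deft.
- move=> z Nz; have [M [m [Nm [_ _ _ sF]]]] := FD z Nz.
  by have [J [sJ _]] := strict_diff_matrix sF; exists J.
- by move=> y py; rewrite /F bY// subrr mul0mx addr0.
(* On the piece z = b z, so the term with [Nm] drops out, and M Lam = m reduces the derivative to
   [Lam y]. *)
- move=> y py; have [M [m [Nm [_ _ ML sF]]]] := FD y (NY y py).
  exists (Lam y); split.
    apply: strict_diff_eqL sF => u; rewrite bY// subrr mul0mx addr0 -ML bY//.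
    by rewrite mulmxBl -mulmxA subrKC.
  by have [_ [_ [_ [r r0 Hr]]]] := piece_good_point py; exists r => // x xy Ax; exact: Hr.
Qed.
End OnePiece.
End Piece.

(** * Smooth minorants and cutoffs *)

Section Smoothing.
Context (R : realType) (D : set_family R) (omD : o_minimal D).
Notation def := (@def R D _ _).
Notation dfun := (@dfun R D _ _ _ _).

(** A uniform quadratic remainder forces the derivative to be Lipschitz: with r = |a - x|, a point
    at distance r from [a] is expanded from [a] and from [x], and the remainders are all of order C
    r^2. *)
Lemma quadratic_strict_diff (V : normedModType R) (S : V -> R) (l : V -> V -> R) (C : R) :
  0 <= C -> (forall x, bounded_linear (l x : V -> R^o)) ->
  (forall x h, `|S (x + h) - S x - l x h| <= C * `|h| ^+ 2) ->
  forall x, strict_diff (S : V -> R^o) x (l x).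
Proof.
move=> C0 bl H x.
have lip a v : `|l a v - l x v| <= 12 * C * `|a - x| * `|v|.
  have [->|ax] := eqVneq a x; first by rewrite !subrr !normr0 mulr0 mul0r.
  have [->|v0] := eqVneq v 0.
    by rewrite (bounded_linear0 (bl a)) (bounded_linear0 (bl x)) subrr !normr0 mulr0.
  pose r := `|a - x|; have r0 : 0 < r by rewrite normr_gt0 subr_eq0.
  have nv : 0 < `|v| by rewrite normr_gt0.
  pose t := r / `|v|; have t0 : 0 < t by rewrite divr_gt0.
  have tv : `|t *: v| = r by rewrite normrZ gtr0_norm// divfK// gt_eqF.
  have h1 := H a (t *: v); have h2 := H x (a - x + t *: v); have h3 := H x (a - x).
  rewrite addrA subrKC in h2; rewrite subrKC in h3.
  rewrite tv in h1; rewrite -/r in h3.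
  have h4 : `|a - x + t *: v| <= 2 * r.
    by apply: le_trans (ler_normD _ _) _; rewrite tv -/r; lra.
  have h5 : C * `|a - x + t *: v| ^+ 2 <= C * (4 * r ^+ 2).
    rewrite ler_wpM2l//; have -> : 4 * r ^+ 2 = (2 * r) ^+ 2 by ring.
    by rewrite ler_sqr ?nnegrE// mulr_ge0// ltW.
  rewrite (bounded_linearD _ _ (bl x)) in h2.
  have lZ y w : l y (t *: w) = t * l y w := bounded_linearZ _ _ (bl y).
  rewrite lZ in h1; rewrite lZ in h2.
  have key : `|t * (l a v - l x v)| <= 6 * C * r ^+ 2.
    move: h1 (le_trans h2 h5) h3; rewrite !ler_norml mulrBr.
    by move=> /andP[? ?] /andP[? ?] /andP[? ?]; apply/andP; lra.
  rewrite normrM (gtr0_norm t0) in key.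
  have key2 : `|l a v - l x v| <= 6 * C * r * `|v|.
    rewrite -(ler_pM2l t0); apply: le_trans key _; rewrite /t.
    by rewrite le_eqVlt; apply/orP; left; apply/eqP; field; rewrite gt_eqF.
  apply: le_trans key2 _; rewrite ler_wpM2r// ler_wpM2r//; lra.
split=> // e e0; pose K := C + 12 * C + 1; have K0 : 0 < K by rewrite /K; lra.
exists (e / K / 2); first by rewrite !divr_gt0.
move=> a b ax bx.
have h1 := H a (b - a); rewrite subrKC in h1.
have ba : `|b - a| <= e / K.
  rewrite -(subrKA x); apply: le_trans (ler_normD _ _) _.
  by rewrite (distrC x); lra.
have -> : S b - S a - l x (b - a) = (S b - S a - l a (b - a)) + (l a (b - a) - l x (b - a)) by rewrite subrKA.
apply: le_trans (ler_normD _ _) _; have := lip a (b - a).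
have n0 : 0 <= `|b - a| by [].
have h2 : C * `|b - a| ^+ 2 <= C * (e / K) * `|b - a|.
  by rewrite expr2 mulrA ler_wpM2r// ler_wpM2l.
have h3 : 12 * C * `|a - x| * `|b - a| <= 12 * C * (e / K) * `|b - a|.
  rewrite ler_wpM2r// ler_wpM2l ?mulr_ge0//.
  by apply: le_trans (ltW ax) _; have : 0 < e / K by [rewrite divr_gt0]; lra.
have h4 : C * (e / K) * `|b - a| + 12 * C * (e / K) * `|b - a| <= e * `|b - a|.
  rewrite -mulrDl ler_wpM2r// -mulrDl mulrA ler_pdivrMr// mulrC ler_wpM2l ?(ltW e0)//.
  by rewrite /K; lra.
move: h1 h2 h3 h4; clear; lra.
Qed.

Lemma strict_diff_inv1 (t : R) : t != 0 ->
  strict_diff (fun s : R^o => s^-1 : R^o) t (fun h => - t ^- 2 * h).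
Proof.
move=> t0; split.
  split=> [a u v|]; first by change (- t ^- 2 * (a * u + v) = a * (- t ^- 2 * u) + - t ^- 2 * v); ring.
  by exists `|- t ^- 2|; split=> // u; rewrite normrM.
move=> e e0; have nt : 0 < `|t| by rewrite normr_gt0.
exists (Num.min (`|t| / 2) (e * `|t| ^+ 3 / 10)).
  by rewrite lt_min !divr_gt0// mulr_gt0// exprn_gt0.
move=> a b; rewrite !lt_min => /andP[a1 a2] /andP[b1 b2].
have na : `|t| / 2 <= `|a|.
  by have := ler_normD (t - a) a; rewrite subrK distrC; lra.
have nb : `|t| / 2 <= `|b|.
  by have := ler_normD (t - b) b; rewrite subrK distrC; lra.
have a0 : a != 0 by rewrite -normr_gt0; lra.
have b0 : b != 0 by rewrite -normr_gt0; lra.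
have -> : b^-1 - a^-1 - - t ^- 2 * (b - a) = (b - a) * ((a * (b - t) + t * (a - t)) / (t ^+ 2 * (a * b))).
  by field; rewrite t0 a0 b0.
rewrite normrM mulrC ler_wpM2r// normrM normfV ler_pdivrMr; last first.
  by rewrite normr_gt0 !mulf_neq0 ?expf_neq0.
have ab : `|t| ^+ 2 / 4 <= `|a * b|.
  rewrite normrM; have -> : `|t| ^+ 2 / 4 = (`|t| / 2) * (`|t| / 2) by field.
  by apply: ler_pM => //; lra.
have na2 : `|a| <= 3 / 2 * `|t|.
  by have := ler_normD (a - t) t; rewrite subrK; lra.
have num : `|a * (b - t) + t * (a - t)| <= 5 / 2 * `|t| * (e * `|t| ^+ 3 / 10).
  apply: le_trans (ler_normD _ _) _; rewrite !normrM.
  have h1 : `|a| * `|b - t| <= 3 / 2 * `|t| * (e * `|t| ^+ 3 / 10).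
    by apply: ler_pM => //; exact: ltW.
  have h2 : `|t| * `|a - t| <= `|t| * (e * `|t| ^+ 3 / 10).
    by rewrite ler_pM2l// ltW.
  by move: h1 h2; clear; lra.
apply: le_trans num _; rewrite normrM normrX.
have -> : 5 / 2 * `|t| * (e * `|t| ^+ 3 / 10) = e * (`|t| ^+ 2 * (`|t| ^+ 2 / 4)) by field.
by rewrite ler_pM2l// ler_wpM2l// exprn_ge0.
Qed.

Lemma strict_diff_inv (V : normedModType R) (f : V -> R) x (L : V -> R) : f x != 0 ->
  strict_diff (f : V -> R^o) x L ->
  strict_diff (fun z => (f z)^-1 : R^o) x (fun u => - (f x) ^- 2 * L u).
Proof.
move=> fx df.
exact: (@strict_diff_comp R V R^o R^o (fun s => s^-1) f x (fun h => - (f x) ^- 2 * h) L df (strict_diff_inv1 fx)).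
Qed.

Lemma bounded_bilinear_scale (W : normedModType R) :
  bounded_bilinear (fun (c : R^o) (w : W) => c *: w).
Proof.
split=> [u a v w|v a u w|].
- by rewrite scalerDr !scalerA mulrC.
- by rewrite scalerDl; congr (_ + _); rewrite scalerA.
- by exists 1; split=> // u v; rewrite normrZ mul1r.
Qed.

Lemma strict_diff_mul (V : normedModType R) (f g : V -> R) x (Lf Lg : V -> R) :
  strict_diff (f : V -> R^o) x Lf -> strict_diff (g : V -> R^o) x Lg ->
  strict_diff (fun z => f z * g z : R^o) x (fun u => Lf u * g x + f x * Lg u).
Proof. exact: (strict_diff_bilinear (@bounded_bilinear_scale R^o)). Qed.

Lemma dotDD n (u v : 'rV[R]_n) : dot (u + v) (u + v) = dot u u + 2 * dot u v + dot v v.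
Proof. by rewrite dotDl !dotDr (dotC v u); ring. Qed.

Lemma dotBB n (u v : 'rV[R]_n) : dot (u - v) (u - v) = dot u u - 2 * dot u v + dot v v.
Proof. by rewrite dotBl !dotBr (dotC v u); ring. Qed.

Lemma bounded_linear_dot n (v : 'rV[R]_n) (c : R) :
  bounded_linear (fun u : 'rV[R]_n => c * dot v u : R^o).
Proof.
split=> [a u w|]; first by change (c * dot v (a *: u + w) = a * (c * dot v u) + c * dot v w); rewrite dotDr dotZr; ring.
exists (`|c| * (enorm v * n%:R)); split=> [|u]; first by rewrite !mulr_ge0// enorm_ge0.
rewrite normrM -mulrA ler_wpM2l//; apply: le_trans (cauchy_schwarz _ _) _.
by rewrite -mulrA ler_wpM2l ?enorm_ge0// enorm_le_norm.
Qed.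

(* Lasry-Lions regularization: the inf-convolution s of a is semiconcave and its
   sup-convolution S is both semiconvex and semiconcave, hence C^1. *)
Lemma smooth_minorant n (a : 'rV[R]_n -> R) : dfun a -> (forall x, 0 <= a x) ->
  exists sg : 'rV[R]_n -> R, [/\ dfun sg,
    forall x, 0 <= sg x /\ sg x <= 3 * a x /\ sg x <= 1,
    forall x d r, 0 < d -> 0 < r -> (forall y, `|y - x| < r -> d <= a y) -> 0 < sg x &
    forall x, exists L, strict_diff (sg : 'rV[R]_n -> R^o) x L /\ forall u, `|L u| <= 8 * enorm u].
Proof.
move=> da a0.
pose isinf x m := (forall y : 'rV[R]_n, m <= a y + enorm (x - y) ^+ 2) /\
  forall m' : R, (forall y : 'rV[R]_n, m' <= a y + enorm (x - y) ^+ 2) -> m' <= m.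
have di : def (fun z : 'rV[R]_n * R => isinf z.1 z.2) by rewrite /isinf; deft.
have [s [ds Hs]] := def_choice omD di.
have {}Hs x : isinf x (s x).
  apply: Hs; pose T := [set a y + enorm (x - y) ^+ 2 | y in [set: 'rV[R]_n]].
  have hT : has_inf T.
    split; first by exists (a x + enorm (x - x) ^+ 2); exists x.
    by exists 0 => _ [y _ <-]; rewrite addr_ge0// sqr_ge0.
  exists (inf T); split=> [y|m' Hm']; first by apply: (ge_inf hT.2); exists y.
  by apply: lb_le_inf; [exact: hT.1|move=> _ [y _ <-]].
have s_le x y : s x <= a y + dot (x - y) (x - y) by rewrite -enorm_sqr; have [] := Hs x.
have s_ge0 x : 0 <= s x by have [_] := Hs x; apply=> y; rewrite addr_ge0// sqr_ge0.
have s_near x e : 0 < e -> exists y, a y + dot (x - y) (x - y) < s x + e.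
  move=> e0; apply: contrapT => ny; have [_ /(_ (s x + e))] := Hs x.
  move=> H; have : s x + e <= s x by apply: H => y; rewrite leNgt enorm_sqr; apply/negP => h; apply: ny; exists y.
  by rewrite gerDl leNgt e0.
have s_conc z v : s (z + v) + s (z - v) <= 2 * s z + 2 * dot v v.
  apply/ler_addgt0Pl => e e0; have e20 : 0 < e / 2 by lra.
  have [y Hy] := s_near z _ e20.
  have := s_le (z + v) y; have := s_le (z - v) y.
  have -> : z + v - y = (z - y) + v by rewrite addrAC.
  have -> : z - v - y = (z - y) - v by rewrite addrAC.
  by rewrite (dotDD (z - y) v) (dotBB (z - y) v); lra.
(* From |z - y|^2 <= 3/2 |z - x|^2 + 3 |x - y|^2. As 3/2 < 2, the sup-convolution with weight 2 is
   finite, and S <= 3 s <= 3 a. *)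
have s_growth x z : s z <= 3 * s x + 3 / 2 * dot (z - x) (z - x).
  apply/ler_addgt0Pl => e e0; have e30 : 0 < e / 3 by lra.
  have [y Hy] := s_near x _ e30; have := s_le z y.
  have -> : z - y = (z - x) + (x - y) by rewrite subrKA.
  have := dot_ge0 (z - x - 2 *: (x - y)); rewrite (dotBB (z - x)) (dotDD (z - x)) !dotZl !dotZr.
  have := a0 y; lra.
pose issup x m := (forall z : 'rV[R]_n, s z - 2 * enorm (x - z) ^+ 2 <= m) /\
  forall m' : R, (forall z : 'rV[R]_n, s z - 2 * enorm (x - z) ^+ 2 <= m') -> m <= m'.
have dsu : def (fun z : 'rV[R]_n * R => issup z.1 z.2) by rewrite /issup; deft.
have [S [dS HS]] := def_choice omD dsu.
have bnd x z : s z - 2 * dot (x - z) (x - z) <= 3 * s x - 1 / 2 * dot (x - z) (x - z).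
  by have := s_growth x z; rewrite -[z - x]opprB -scaleN1r dotZl dotZr; lra.
have {}HS x : issup x (S x).
  apply: HS; pose T := [set s z - 2 * enorm (x - z) ^+ 2 | z in [set: 'rV[R]_n]].
  have hT : has_sup T.
    split; first by exists (s x - 2 * enorm (x - x) ^+ 2); exists x.
    exists (3 * s x) => _ [z _ <-]; rewrite enorm_sqr; apply: le_trans (bnd x z) _.
    by have := dot_ge0 (x - z); lra.
  exists (sup T); split=> [y|m' Hm']; first by apply: (ub_le_sup hT.2); exists y.
  by apply: ge_sup; [exact: hT.1|move=> _ [y _ <-]].
have S_ge x z : s z - 2 * dot (x - z) (x - z) <= S x by rewrite -enorm_sqr; have [] := HS x.
have S_near x e : 0 < e -> exists z, S x - e < s z - 2 * dot (x - z) (x - z).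
  move=> e0; apply: contrapT => ny; have [_ /(_ (S x - e))] := HS x.
  move=> H; have : S x <= S x - e by apply: H => y; rewrite leNgt enorm_sqr; apply/negP => h; apply: ny; exists y.
  by rewrite lerDl oppr_ge0 leNgt e0.
have sS x : s x <= S x.
  by have := S_ge x x; rewrite subrr -enorm_sqr enorm0 expr0n/= mulr0 subr0.
have S_ge0 x : 0 <= S x := le_trans (s_ge0 x) (sS x).
have S_le x : S x <= 3 * s x.
  have [_] := HS x; apply=> z; rewrite enorm_sqr; apply: le_trans (bnd x z) _.
  by have := dot_ge0 (x - z); lra.
have S_conc x h : S (x + h) + S (x - h) <= 2 * S x + 4 * dot h h.
  apply/ler_addgt0Pl => e e0; have e20 : 0 < e / 2 by lra.
  have [z1 H1] := S_near (x + h) _ e20; have [z2 H2] := S_near (x - h) _ e20.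
  pose z := 2^-1 *: (z1 + z2); pose v := 2^-1 *: (z1 - z2).
  have z1E : z1 = z + v by apply/rowP => i; rewrite !mxE; field.
  have z2E : z2 = z - v by apply/rowP => i; rewrite !mxE; field.
  have := s_conc z v; have := S_ge x z; move: H1 H2; rewrite {}z1E {}z2E.
  have -> : x + h - (z + v) = (x - z) + (h - v) by apply/rowP => i; rewrite !mxE; ring.
  have -> : x - h - (z - v) = (x - z) - (h - v) by apply/rowP => i; rewrite !mxE; ring.
  (* Semiconcavity survives since 2 |v|^2 - 4 |h - v|^2 <= 4 |h|^2, with difference 2 |2 h -
     v|^2. *)
  have := dot_ge0 (2 *: h - v); rewrite (dotDD (x - z)) (dotBB (x - z)) (dotBB (2 *: h)) (dotBB h) !dotZl !dotZr; clear; lra.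
(* A maximizer z in the sup-convolution at x would give w = -4 (x - z). Instead, z is the limit of a
   definable family of near maximizers, bounded thanks to the margin 1/2 in [bnd]; the inequality
   passes to the limit. *)
have dz x : exists w, forall h, S x + dot w h - 2 * dot h h <= S (x + h).
  pose Pz t z := S x - t < s z - 2 * enorm (x - z) ^+ 2 /\ S x - 1 < s z - 2 * enorm (x - z) ^+ 2.
  have dP : def (fun w : R * 'rV[R]_n => Pz w.1 w.2) by rewrite /Pz; deft.
  have [zt [dzt Hzt]] := def_choice omD dP.
  have {}Hzt t : 0 < t -> Pz t (zt t).
    move=> t0; apply: Hzt; have [|z Hz] := S_near x (Num.min t 1); first by rewrite lt_min t0 ltr01.
    have m1 : Num.min t 1 <= t by rewrite ge_min lexx.
    have m2 : Num.min t 1 <= 1 by rewrite ge_min lexx orbT.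
    by exists z; rewrite /Pz enorm_sqr; split; lra.
  have bd i t : 0 < t -> `|zt t 0 i| <= `|x| + (4 * S x + 3).
    move=> /Hzt[_]; rewrite enorm_sqr => h.
    have := rV_norm_coord (zt t) i => /le_trans; apply.
    rewrite -(subrKC x (zt t)); apply: le_trans (ler_normD _ _) _; rewrite lerD2l distrC.
    apply: le_trans (rV_norm_enorm _) _.
    have : enorm (x - zt t) ^+ 2 <= 4 * S x + 2.
      by rewrite enorm_sqr; have := bnd x (zt t); have := sS x; move: h; clear; lra.
    have := enorm_ge0 (x - zt t); have := S_ge0 x; clear; nra.
  have dzti i : dfun (fun t => zt t 0 i) by deft.
  have [zl Hzl] := choice (fun i => bounded_tame_limit omD (dzti i) (bd i)).
  pose z : 'rV[R]_n := \row_i zl i.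
  have lim e : 0 < e -> exists t, 0 < t /\ t < e /\ `|zt t - z| < e.
    move=> e0; have e20 : 0 < e / 2 by lra.
    have [r r0 Hr] := finite_pos_min (fun i => Hzl i _ e20)
      (fun i r r' r'r H t t0 tr => H t t0 (lt_le_trans tr r'r)).
    pose t := Num.min r e / 2.
    have m0 : 0 < Num.min r e by rewrite lt_min r0.
    have m1 : Num.min r e <= r by rewrite ge_min lexx.
    have m2 : Num.min r e <= e by rewrite ge_min lexx orbT.
    exists t; split; first by rewrite divr_gt0.
    split; first by rewrite /t; move: m0 m2; clear; lra.
    apply: le_lt_trans (_ : e / 2 < _); last by move: e0; clear; lra.
    apply/rV_norm_le; split=> [|i]; first exact: ltW.
    rewrite !mxE; apply: Hr; first by rewrite divr_gt0.
    by rewrite /t; move: m0 m1; clear; lra.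
  exists ((- 4) *: (x - z)) => h; apply/ler_addgt0Pl => e e0.
  have c0 : 0 < 1 + 4 * (n%:R * enorm h) :> R by rewrite ltr_pwDl// !mulr_ge0// enorm_ge0.
  have [t [t0 [te tz]]] := lim (e / (1 + 4 * (n%:R * enorm h))) ltac:(by rewrite divr_gt0).
  have [+ _] := Hzt t t0; rewrite enorm_sqr => h1; have := S_ge (x + h) (zt t).
  have -> : x + h - zt t = (x - zt t) + h by rewrite addrAC.
  rewrite (dotDD (x - zt t)) dotZl => h2.
  have h3 : dot (x - zt t) h <= dot (x - z) h + n%:R * enorm h * `|zt t - z|.
    have -> : x - zt t = (x - z) - (zt t - z) by rewrite opprB addrA subrK.
    rewrite dotBl lerD2l; apply: le_trans (ler_norm _) _; rewrite normrN.
    apply: le_trans (cauchy_schwarz _ _) _.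
    by rewrite mulrAC ler_wpM2r ?enorm_ge0// enorm_le_norm.
  have h4 : (t + 4 * (n%:R * enorm h) * `|zt t - z|) <= e.
    have : (1 + 4 * (n%:R * enorm h)) * (e / (1 + 4 * (n%:R * enorm h))) = e by rewrite mulrC divfK ?gt_eqF.
    have : 4 * (n%:R * enorm h) * `|zt t - z| <= 4 * (n%:R * enorm h) * (e / (1 + 4 * (n%:R * enorm h))).
      by rewrite ler_wpM2l ?(ltW tz)// !mulr_ge0// enorm_ge0.
    by move: te; clear; lra.
  by move: h1 h2 h3 h4; clear; lra.
have [w Hw] := choice dz.
have quad x h : `|S (x + h) - S x - dot (w x) h| <= 6 * dot h h.
  rewrite ler_norml; have h1 := Hw x h; have h2 := Hw x (- h).
  have h3 := S_conc x h; have hh := dot_ge0 h.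
  rewrite -[- h]scaleN1r !dotZr !dotZl scaleN1r in h2.
  by apply/andP; move: h1 h2 h3 hh; clear; lra.
(* At x - w / 12 the quadratic upper bound of S is least; it is nonnegative there because S is. The
   result controls the derivative of S / (1 + S) uniformly. *)
have wS x : dot (w x) (w x) <= 24 * S x.
  have := quad x (- 12^-1 *: w x); rewrite ler_norml => /andP[_].
  have := S_ge0 (x + (- 12^-1 *: w x)); rewrite !dotZl !dotZr; clear; lra.
have Sdiff x : strict_diff (S : _ -> R^o) x (fun u => 1 * dot (w x) u).
  apply: (@quadratic_strict_diff _ S (fun x u => 1 * dot (w x) u) (6 * (n%:R * n%:R))).
  - by rewrite !mulr_ge0.
  - by move=> y; exact: bounded_linear_dot.
  move=> y h; rewrite mul1r; apply: le_trans (quad y h) _; rewrite -mulrA ler_wpM2l//.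
  rewrite -enorm_sqr -!expr2 -exprMn ler_sqr ?nnegrE ?enorm_ge0 ?mulr_ge0//.
  exact: enorm_le_norm.
have S1 x : 0 < 1 + S x by have := S_ge0 x; lra.
have S1d x : strict_diff (fun z => 1 + S z : R^o) x (fun u => 0 + 1 * dot (w x) u).
  exact: (strict_diff_add (@strict_diff_cst R _ R^o 1 x) (Sdiff x)).
exists (fun x => S x * (1 + S x)^-1); split.
- by deft.
- move=> x; have := S_ge0 x; have := S_le x; have [+ _] := Hs x => /(_ x).
  rewrite subrr enorm0 expr0n addr0 => h1 h2 h3; split; first by rewrite divr_ge0// ltW.
  by split; rewrite ler_pdivrMr//; have := a0 x; nra.
- move=> x d r d0 r0 ad; rewrite divr_gt0//; apply: lt_le_trans (sS x).
  have [_ /(_ (Num.min d (r ^+ 2)))] := Hs x => H.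
  apply: lt_le_trans (_ : Num.min d (r ^+ 2) <= _); first by rewrite lt_min d0 exprn_gt0.
  apply: H => y; have [yr|yr] := ltP `|y - x| r.
    apply: le_trans (_ : d <= _); first by rewrite ge_min lexx.
    by apply: le_trans (ad y yr) _; rewrite lerDl sqr_ge0.
  apply: le_trans (_ : r ^+ 2 <= _); first by rewrite ge_min lexx orbT.
  apply: le_trans (_ : enorm (x - y) ^+ 2 <= _); last by rewrite lerDr.
  rewrite ler_sqr ?nnegrE ?enorm_ge0 ?(ltW r0)//; apply: le_trans yr _.
  by rewrite distrC rV_norm_enorm.
- move=> x; have inv1 := @strict_diff_inv _ (fun z => 1 + S z) x _ (lt0r_neq0 (S1 x)) (S1d x).
  exists (fun u => 1 * dot (w x) u * (1 + S x)^-1 + S x * (- (1 + S x) ^- 2 * (0 + 1 * dot (w x) u))).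
  split; first exact: (strict_diff_mul (Sdiff x) inv1).
  move=> u /=; have S0 := S1 x.
  have -> : 1 * dot (w x) u * (1 + S x)^-1 + S x * (- (1 + S x) ^- 2 * (0 + 1 * dot (w x) u)) =
     dot (w x) u * (1 + S x) ^- 2 by field; rewrite gt_eqF.
  rewrite normrM [`|_ ^- 2|]ger0_norm; last by rewrite invr_ge0 exprn_ge0// ltW.
  rewrite ler_pdivrMr ?exprn_gt0//; apply: le_trans (cauchy_schwarz _ _) _.
  rewrite mulrAC ler_wpM2r ?enorm_ge0//.
  have : enorm (w x) ^+ 2 <= (8 * (1 + S x) ^+ 2) ^+ 2.
    rewrite enorm_sqr; apply: le_trans (wS x) _; have := S_ge0 x; move: (S x) => c c0.
    have : 0 <= c * c by rewrite mulr_ge0. have : 0 <= c * c * c by rewrite !mulr_ge0.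
    have : 0 <= c * c * c * c by rewrite !mulr_ge0.
    have -> : (8 * (1 + c) ^+ 2) ^+ 2 = 64 + 256 * c + 384 * (c * c) + 256 * (c * c * c) + 64 * (c * c * c * c) by ring.
    by move: c0; clear; lra.
  by rewrite ler_sqr ?nnegrE ?enorm_ge0// mulr_ge0// exprn_ge0// ltW.
Qed.
End Smoothing.

(** * Slowly varying cutoffs and blending of two maps *)

Section Cutoff.
Context (R : realType) (D : set_family R) (omD : o_minimal D).
Notation def := (@def R D _ _).
Notation dfun := (@dfun R D _ _ _ _).

Definition pos_part (t : R) := (t + `|t|) / 2.

Lemma pos_partP (t : R) : (0 <= t /\ pos_part t = t) \/ (t < 0 /\ pos_part t = 0).
Proof.
rewrite /pos_part; have [t0|t0] := leP 0 t; [left|right]; split=> //.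
  by rewrite ger0_norm//; field.
by rewrite ltr0_norm// subrr mul0r.
Qed.

Lemma pos_part_sqr_quadratic (t h : R) :
  `|pos_part (t + h) ^+ 2 - pos_part t ^+ 2 - 2 * pos_part t * h| <= h ^+ 2.
Proof.
rewrite ler_norml.
have [[t0 ->]|[t0 ->]] := pos_partP t; have [[h0 ->]|[h0 ->]] := pos_partP (t + h); apply/andP; split; nra.
Qed.

(* A C^1 quadratic spline from 1 (for t <= 1) to 0 (for t >= 3). *)
Definition spline (t : R) :=
  1 - (pos_part (t - 1) ^+ 2 - 2 * pos_part (t - 2) ^+ 2 + pos_part (t - 3) ^+ 2) / 2.
Definition dspline (t : R) := - (pos_part (t - 1) - 2 * pos_part (t - 2) + pos_part (t - 3)).

Lemma spline_quadratic (t h : R) : `|spline (t + h) - spline t - dspline t * h| <= 2 * h ^+ 2.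
Proof.
have h1 := pos_part_sqr_quadratic (t - 1) h; have h2 := pos_part_sqr_quadratic (t - 2) h.
have h3 := pos_part_sqr_quadratic (t - 3) h.
rewrite /spline /dspline ![t + h - _]addrAC.
move: h1 h2 h3; rewrite !ler_norml => /andP[? ?] /andP[? ?] /andP[? ?]; apply/andP; lra.
Qed.

Lemma spline_bounds (t : R) : [/\ 0 <= spline t, spline t <= 1, -1 <= dspline t & dspline t <= 0].
Proof.
rewrite /spline /dspline.
have [[t1 ->]|[t1 ->]] := pos_partP (t - 1); have [[t2 ->]|[t2 ->]] := pos_partP (t - 2);
  have [[t3 ->]|[t3 ->]] := pos_partP (t - 3); split; nra.
Qed.

Lemma spline_eq1 (t : R) : t <= 1 -> spline t = 1 /\ dspline t = 0.
Proof.
move=> t1; rewrite /spline /dspline.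
have [[h1 ->]|[h1 ->]] := pos_partP (t - 1); have [[h2 ->]|[h2 ->]] := pos_partP (t - 2);
  have [[h3 ->]|[h3 ->]] := pos_partP (t - 3); try lra.
all: try by split; ring.
by rewrite (_ : t - 1 = 0); [split; ring|lra].
Qed.

Lemma spline_eq0 (t : R) : 3 <= t -> spline t = 0 /\ dspline t = 0.
Proof.
move=> t1; rewrite /spline /dspline.
have [[h1 ->]|[h1 ->]] := pos_partP (t - 1); last lra.
have [[h2 ->]|[h2 ->]] := pos_partP (t - 2); last lra.
have [[h3 ->]|[h3 ->]] := pos_partP (t - 3); last lra.
by split; [field|ring].
Qed.

Lemma spline_deriv_scaled (t : R) : 0 <= t -> `|t * dspline t| <= 2.
Proof.
move=> t0; have [_ _ d1 d2] := spline_bounds t.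
have [t1|t1] := leP t 1; first by have [_ ->] := spline_eq1 t1; rewrite mulr0 normr0.
have [t3|t3] := leP 3 t; first by have [_ ->] := spline_eq0 t3; rewrite mulr0 normr0.
have [t2|t2] := leP t 2; first by rewrite ler_norml; apply/andP; split; nra.
rewrite ler_norml; apply/andP.
have -> : dspline t = t - 3.
  rewrite /dspline; have [[h1 ->]|[h1 ->]] := pos_partP (t - 1); have [[h2 ->]|[h2 ->]] := pos_partP (t - 2);
  have [[h3 ->]|[h3 ->]] := pos_partP (t - 3); lra.
split; nra.
Qed.

Fixpoint spline_sum m t := if m is m'.+1 then spline t + spline_sum m' (3 * t) else 0.
Fixpoint dspline_sum m t := if m is m'.+1 then dspline t + 3 * dspline_sum m' (3 * t) else 0.

Lemma spline_sum_quadratic m : exists2 C, 0 <= C & forall t h : R,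
  `|spline_sum m (t + h) - spline_sum m t - dspline_sum m t * h| <= C * h ^+ 2.
Proof.
elim: m => [|m [C C0 IH]]; first by exists 0 => // t h /=; rewrite subrr mul0r subr0 normr0 mul0r.
exists (2 + 9 * C) => [|t h /=]; first by lra.
have h1 := spline_quadratic t h; have := IH (3 * t) (3 * h); rewrite -mulrDr => h2.
move: h1 h2; rewrite !ler_norml => /andP[? ?] /andP[? ?]; apply/andP; lra.
Qed.

Lemma spline_sum_bounds m (t : R) : 0 <= spline_sum m t /\ spline_sum m t <= m%:R.
Proof.
elim: m t => [|m IH] t /=; first by rewrite lexx.
have [a b _ _] := spline_bounds t; have [c d] := IH (3 * t).
rewrite -[m.+1%:R]natr1; split; move: a b c d; clear; lra.
Qed.

Lemma dspline_sum_bound m : exists2 K, 0 <= K & forall t : R, `|dspline_sum m t| <= K.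
Proof.
elim: m => [|m [K K0 IH]]; first by exists 0 => // t /=; rewrite normr0.
exists (1 + 3 * K) => [|t /=]; first by lra.
have [_ _ ? ?] := spline_bounds t; have := IH (3 * t); rewrite !ler_norml => /andP[? ?].
by apply/andP; lra.
Qed.

Lemma spline_sum_eq0 m (t : R) : 3 <= t -> spline_sum m t = 0 /\ dspline_sum m t = 0.
Proof.
elim: m t => [|m IH] t t3 //=; have [-> ->] := spline_eq0 t3.
by have [|-> ->] := IH (3 * t); [lra|split; ring].
Qed.

Lemma spline_sum_eqm m : exists2 d, 0 < d & forall t : R, t <= d -> spline_sum m t = m%:R.
Proof.
elim: m => [|m [d d0 IH]]; first by exists 1.
exists (Num.min 1 (d / 3)) => [|t]; first by rewrite lt_min ltr01 divr_gt0.
rewrite le_min => /andP[t1 td] /=; have [-> _] := spline_eq1 t1.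
by rewrite IH ?natrS 1?addrC//; lra.
Qed.

Lemma dspline_sum_scaled m (t : R) : 0 <= t -> `|t * dspline_sum m t| <= 2.
Proof.
elim: m t => [|m IH] t t0 /=; first by rewrite mulr0 normr0.
have [t1|t1] := leP t 1.
  have [_ ->] := spline_eq1 t1; rewrite add0r mulrA [t * 3]mulrC; apply: IH; lra.
have [|_ ->] := @spline_sum_eq0 m (3 * t); first by lra.
by rewrite mulr0 addr0 spline_deriv_scaled.
Qed.

Lemma dfun_spline_sum m : dfun (spline_sum m : R -> R).
Proof.
have dp : dfun pos_part by rewrite /pos_part; deft.
have ds : dfun spline by rewrite /spline; deft.
have d3 : dfun (fun t : R => 3 * t) by deft.
elim: m => [|m IH] /=; deft; exact: d3.
Qed.

(* Averaging m splines, cutting off at successive powers of 3, makes t k'(t) of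
   size 2 / m, because at most one term varies at a given t. *)
Lemma slow_cutoff (e : R) : 0 < e -> exists (k k' : R -> R) (C K d : R),
  [/\ dfun k, 0 <= C /\ forall t h, `|k (t + h) - k t - k' t * h| <= C * h ^+ 2,
   forall t, 0 <= k t /\ k t <= 1 & 0 < d /\ forall t, t <= d -> k t = 1] /\
  [/\ forall t, 1 <= t -> k t = 0 /\ k' t = 0, forall t, 0 <= t -> `|t * k' t| <= e &
      0 <= K /\ forall t, `|k' t| <= K].
Proof.
move=> e0; pose m := (Num.Def.truncn (2 / e)).+1.
have m0 : 0 < m%:R :> R by rewrite ltr0n.
have me : 2 / m%:R <= e.
  by rewrite ler_pdivrMr// mulrC -ler_pdivrMr//; apply: ltW; exact: truncnS_gt.
have [C C0 HC] := spline_sum_quadratic m; have [K K0 HK] := dspline_sum_bound m.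
have [d d0 Hd] := spline_sum_eqm m.
exists (fun t => spline_sum m (3 * t) / m%:R), (fun t => 3 * dspline_sum m (3 * t) / m%:R).
exists (9 * C / m%:R), (3 * K / m%:R), (d / 3); split; split.
- have ds := dfun_spline_sum m; have d3 : dfun (fun t : R => 3 * t) by deft.
  by deft; exact: d3.
- split=> [|t h]; first by rewrite divr_ge0 ?mulr_ge0// ltW.
  have -> : spline_sum m (3 * (t + h)) / m%:R - spline_sum m (3 * t) / m%:R - 3 * dspline_sum m (3 * t) / m%:R * h
    = (spline_sum m (3 * t + 3 * h) - spline_sum m (3 * t) - dspline_sum m (3 * t) * (3 * h)) / m%:R.
    by rewrite mulrDr; ring.
  rewrite normrM [`|_^-1|]gtr0_norm ?invr_gt0// mulrAC ler_pM2r ?invr_gt0//.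
  by apply: le_trans (HC _ _) _; rewrite exprMn; lra.
- move=> t; have [h1 h2] := spline_sum_bounds m (3 * t).
  by rewrite divr_ge0 ?(ltW m0)// ler_pdivrMr// mul1r.
- split=> [|t td]; first by rewrite divr_gt0.
  by rewrite Hd ?divff ?gt_eqF//; lra.
- by move=> t t1; have [|-> ->] := @spline_sum_eq0 m (3 * t); [lra|rewrite mulr0 !mul0r].
- move=> t t0; apply: le_trans me.
  have -> : t * (3 * dspline_sum m (3 * t) / m%:R) = (3 * t * dspline_sum m (3 * t)) / m%:R by ring.
  rewrite normrM [`|_^-1|]gtr0_norm ?invr_gt0// ler_pM2r ?invr_gt0//.
  by apply: dspline_sum_scaled; lra.
- split=> [|t]; first by rewrite divr_ge0 ?mulr_ge0// ltW.
  rewrite normrM [`|_^-1|]gtr0_norm ?invr_gt0// ler_pM2r ?invr_gt0// normrM ger0_norm//.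
  by rewrite ler_pM2l.
Qed.

Lemma bounded_bilinear_dot n : bounded_bilinear (fun u v : 'rV[R]_n => dot u v : R^o).
Proof.
split=> [u a v w|v a u w|].
- by change (dot u (a *: v + w) = a * dot u v + dot u w); rewrite dotDr dotZr.
- by change (dot (a *: u + w) v = a * dot u v + dot w v); rewrite dotDl dotZl.
exists (n%:R * n%:R); split=> [|u v]; first by rewrite mulr_ge0.
apply: le_trans (cauchy_schwarz _ _) _.
apply: le_trans (ler_pM (enorm_ge0 _) (enorm_ge0 _) (enorm_le_norm u) (enorm_le_norm v)) _.
by rewrite mulrACA mulrA.
Qed.

(** The derivative is a convex combination of [LH] and [LF], bounded by [a], plus multiples of v = H
    - F from the derivatives of rho and of the cutoff. Both matter only where q = |v|^2 / eta^2 < 1,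
    that is |v| < eta, so rho contributes [b]. Since eta has derivative at most 1, that of q times
    |v| is at most q (4 c + 2), and |q k'(q)| <= e. The separate bound [c] lets e be fixed
    independently of the slope at x. *)
Lemma blend_strict_diff n k (H F : 'rV[R]_n -> 'rV[R]_k) (eta rho : 'rV[R]_n -> R) x
    LH LF (Le Lr : 'rV[R]_n -> R) (kap kap' : R -> R) (C a b c e : R) :
  strict_diff H x LH -> strict_diff F x LF ->
  strict_diff (eta : _ -> R^o) x Le -> strict_diff (rho : _ -> R^o) x Lr -> 0 < eta x ->
  0 <= C -> (forall t h, `|kap (t + h) - kap t - kap' t * h| <= C * h ^+ 2) ->
  (forall t, 0 <= kap t /\ kap t <= 1) -> (forall t, 1 <= t -> kap t = 0 /\ kap' t = 0) ->
  (forall t, 0 <= t -> `|t * kap' t| <= e) -> 0 <= rho x -> rho x <= 1 ->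
  (forall u, enorm (LH u) <= a * enorm u) -> (forall u, enorm (LF u) <= a * enorm u) ->
  (forall u, enorm (LH u) <= c * enorm u) -> (forall u, enorm (LF u) <= c * enorm u) ->
  (forall u, `|Le u| <= enorm u) -> (forall u, `|Lr u| * eta x <= b * enorm u) ->
  exists L, strict_diff (fun z => H z -
       (rho z * kap (dot (H z - F z) (H z - F z) * (eta z * eta z)^-1)) *: (H z - F z)) x L /\
    forall u, enorm (L u) <= (a + b + e * (4 * c + 2)) * enorm u.
Proof.
move=> dH dF de dr e0 C0 kq kb k0 ks r0 r1 aH aF cH cF bLe bLr.
have dv := strict_diff_sub dH dF; have dvv := strict_diff_bilinear (@bounded_bilinear_dot k) dv dv.
have dee := strict_diff_mul de de.
have ee0 : eta x * eta x != 0 by rewrite mulf_neq0// gt_eqF.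
have dei := @strict_diff_inv R _ (fun z => eta z * eta z) x _ ee0 dee.
have dq := strict_diff_mul dvv dei.
have dkap t : strict_diff (kap : R^o -> R^o) t (fun h => kap' t * h).
  apply: (@quadratic_strict_diff R R^o kap (fun t h => kap' t * h) C) => // [y|y h]; last first.
    by apply: le_trans (kq y h) _; rewrite real_normK// num_real.
  split=> [s u v|]; first by change (kap' y * (s * u + v) = s * (kap' y * u) + kap' y * v); ring.
  by exists `|kap' y|; split=> // u; rewrite normrM.
have dk := @strict_diff_comp R _ R^o R^o kap _ x _ _ dq (dkap _).
have drk := strict_diff_mul dr dk.
have dall := strict_diff_sub dH (strict_diff_bilinear (@bounded_bilinear_scale R _) drk dv).
eexists; split; first exact: dall.
move=> u /=.
move: (aH u) (aF u) (cH u) (cF u) (bLe u) (bLr u).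
move: (LH u) (LF u) (Le u) (Lr u) (enorm u) (enorm_ge0 u) => h w l r N N0 ah aw ch cw bl br.
set v := H x - F x; set q := dot v v / _.
have q0 : 0 <= q by rewrite divr_ge0 ?dot_ge0// -expr2 sqr_ge0.
have [k1 k2] := kb q; have ksq := ks q q0.
have eN : 0 <= e * (4 * c + 2) * N.
  have : 0 <= c * N by apply: le_trans ch; exact: enorm_ge0.
  have : 0 <= e by apply: le_trans ksq.
  clear -N0; nra.
have bN : 0 <= b * N by apply: le_trans br; rewrite mulr_ge0// ltW.
have [q1|q1] := leP 1 q.
  have [-> ->] := k0 q q1.
  rewrite !(mulr0, mul0r, addr0, scale0r, subr0).
  by move: ah bN eN; clear; lra.
set s := _ + dot v v * _.
have -> : h - ((r * kap q + rho x * (kap' q * s)) *: v + (rho x * kap q) *: (h - w)) =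
   ((1 - rho x * kap q) *: h + (rho x * kap q) *: w) + (- (r * kap q) *: v + - (rho x * (kap' q * s)) *: v).
  by apply/rowP => i; rewrite !mxE; ring.
have v0 := enorm_ge0 v.
have vE : enorm v ^+ 2 = q * eta x ^+ 2 by rewrite enorm_sqr /q -expr2 divfK// expf_neq0// gt_eqF.
have ve : enorm v <= eta x.
  rewrite -ler_sqr ?nnegrE ?(ltW e0)// vE ler_piMl ?sqr_ge0//; exact: ltW.
have rk0 : 0 <= rho x * kap q by rewrite mulr_ge0.
have rk1 : rho x * kap q <= 1 by rewrite mulr_ile1.
have t1 : enorm ((1 - rho x * kap q) *: h + (rho x * kap q) *: w) <= a * N.
  apply: le_trans (enormD _ _) _; rewrite !enormZ [`|1 - _|]ger0_norm ?subr_ge0// [`|_ * _|]ger0_norm//.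
  have : (1 - rho x * kap q) * enorm h <= (1 - rho x * kap q) * (a * N) by rewrite ler_wpM2l// subr_ge0.
  have : (rho x * kap q) * enorm w <= (rho x * kap q) * (a * N) by rewrite ler_wpM2l.
  by clear; lra.
have t2 : enorm (- (r * kap q) *: v) <= b * N.
  apply: le_trans br; rewrite enormZ normrN normrM [`|kap q|]ger0_norm//.
  by rewrite ler_pM// ?mulr_ge0// ler_piMr.
have t3 : enorm (- (rho x * (kap' q * s)) *: v) <= e * (4 * c + 2) * N.
  rewrite enormZ normrN normrM (ger0_norm r0).
  apply: le_trans (_ : `|kap' q| * (`|s| * enorm v) <= _).
    by rewrite normrM -mulrA -[_ * _ * enorm v]mulrA ler_piMl// !mulr_ge0.
  have hw : enorm (h - w) <= 2 * c * N.
    by apply: le_trans (enormD _ _) _; rewrite enormN; move: ch cw; clear; lra.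
  have sv : `|s| * enorm v <= q * ((4 * c + 2) * N).
    have -> : s = 2 * dot v (h - w) / eta x ^+ 2 - q * (2 * l / eta x).
      by rewrite /s /q (dotC (h - w)); field; rewrite gt_eqF.
    apply: le_trans (ler_wpM2r v0 (ler_normB _ _)) _; rewrite mulrDl.
    have s1 : `|2 * dot v (h - w) / eta x ^+ 2| * enorm v <= q * (4 * c * N).
      rewrite normrM [`|_^-1|]ger0_norm ?invr_ge0 ?sqr_ge0// mulrAC ler_pdivrMr ?exprn_gt0//.
      have vw : `|2 * dot v (h - w)| <= 2 * (enorm v * (2 * c * N)).
        rewrite normrM normr_nat ler_pM2l//; apply: le_trans (cauchy_schwarz _ _) _.
        exact: ler_wpM2l.
      apply: le_trans (ler_wpM2r v0 vw) _.
      have -> : 2 * (enorm v * (2 * c * N)) * enorm v = enorm v ^+ 2 * (4 * c * N) by ring.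
      by rewrite vE mulrAC.
    have s2 : `|q * (2 * l / eta x)| * enorm v <= q * (2 * N).
      rewrite normrM (ger0_norm q0) -[q * _ * _]mulrA ler_wpM2l// normrM [`|_^-1|]gtr0_norm ?invr_gt0//.
      rewrite mulrAC ler_pdivrMr// normrM normr_nat -!mulrA ler_pM2l//.
      by apply: ler_pM.
    by move: s1 s2; clear; lra.
  apply: le_trans (ler_wpM2l (normr_ge0 _) sv) _.
  have kq' : `|kap' q| * q <= e by move: ksq; rewrite normrM (ger0_norm q0) mulrC.
  have : 0 <= (4 * c + 2) * N.
    have : 0 <= c * N by apply: le_trans ch; exact: enorm_ge0.
    by move: N0; clear; lra.
  by move=> cN0; rewrite -(mulrA e) [`|_| * _]mulrA; exact: (ler_wpM2r cN0 kq').
apply: le_trans (enormD _ _) _; apply: le_trans (lerD t1 (enormD _ _)) _.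
by move: t2 t3; clear; lra.
Qed.
End Cutoff.

(** * Gluing *)

Section Neighbourhoods.
Context (R : realType) (d : nat).
Implicit Types (x : 'rV[R]_d) (P Q : 'rV[R]_d -> Prop).

Lemma near_all_self x P : near_all x P -> P x.
Proof. by move=> [r r0]; apply; rewrite subrr normr0. Qed.

Lemma near_all_and x P Q : near_all x P -> near_all x Q -> near_all x (fun z => P z /\ Q z).
Proof.
move=> [r r0 Hr] [q q0 Hq]; exists (Num.min r q); first by rewrite lt_min r0.
by move=> z; rewrite lt_min => /andP[zr zq]; split; [exact: Hr|exact: Hq].
Qed.

Lemma near_all_mono x P Q : near_all x P -> (forall z, P z -> Q z) -> near_all x Q.
Proof. by move=> [r r0 Hr] PQ; exists r => // z /Hr /PQ. Qed.

Lemma near_all_open x P : near_all x P -> near_all x (fun z => near_all z P).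
Proof.
move=> [r r0 Hr]; exists r => // z zr; have [q q0 Hq] := ball_near zr.
by exists q => // w /Hq /Hr.
Qed.

Lemma near_all_cont_lt (g : 'rV[R]_d -> R) x c : cont_at (g : _ -> R^o) x -> g x < c ->
  near_all x (fun z => g z < c).
Proof.
move=> cg gc; have [|r r0 Hr] := cg (c - g x); first by rewrite subr_gt0.
exists r => // z /Hr /(le_lt_trans (ler_norm _)); rewrite ltrBlDr subrK.
exact.
Qed.

Lemma near_all_cont_gt (g : 'rV[R]_d -> R) x c : cont_at (g : _ -> R^o) x -> c < g x ->
  near_all x (fun z => c < g z).
Proof.
move=> cg gc; have [|r r0 Hr] := cg (g x - c); first by rewrite subr_gt0.
exists r => // z /Hr; rewrite distrC => /(le_lt_trans (ler_norm _)).
by rewrite ltrD2l ltrN2.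
Qed.
End Neighbourhoods.

(** * Extending f off A, and pieces with their neighbourhoods *)

Section Extension.
Context (R : realType) (D : set_family R) (omD : o_minimal D).
Notation def := (@def R D _ _).
Notation dfun := (@dfun R D _ _ _ _).
Variables (n k : nat) (A : set 'rV[R]_n) (f : 'rV[R]_n -> 'rV[R]_k) (C0 : R).
Hypotheses (dA : def A) (df : dfun f).
Hypothesis slA : forall x, A x -> slope_le A f x C0.

Definition adherent (B : set 'rV[R]_n) (x : 'rV[R]_n) :=
  forall r : R, 0 < r -> exists2 y : 'rV[R]_n, B y & `|y - x| < r.

(* The complement of the frontier of A. *)
Definition ambient (x : 'rV[R]_n) := near_all x (fun y => adherent A y -> A y).

(* f evaluated at a point of A that is nearest up to a factor 2. *)
Lemma continuous_extension : (forall x, A x -> ambient x) -> exists ft : 'rV[R]_n -> 'rV[R]_k,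
  [/\ dfun ft, forall x, A x -> ft x = f x & forall x, A x -> cont_at ft x].
Proof.
move=> AO; pose rel (z y : 'rV[R]_n) := A y /\ forall y' : 'rV[R]_n, A y' -> `|y - z| <= 2 * `|y' - z|.
have dr : def (fun z : 'rV[R]_n * 'rV[R]_n => rel z.1 z.2) by rewrite /rel; deft.
have [p [dp Hp]] := def_choice omD dr.
have pA x : A x -> p x = x.
  move=> Ax; have [|Ap /(_ x Ax)] := Hp x.
    by exists x; split=> // y' _; rewrite subrr normr0 mulr_ge0.
  by rewrite subrr normr0 mulr0 normr_le0 subr_eq0 => /eqP.
exists (fun z => f (p z)); split=> [|x Ax|x Ax e e0]; first by deft.
  by rewrite pA.
have [r r0 Hr] := slope_le_cont (slA Ax) e0; have [q q0 Hq] := AO x Ax.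
exists (Num.min (r / 3) q); first by rewrite lt_min divr_gt0.
move=> z; rewrite lt_min => /andP[zr zq].
have [Ap Hpz] : rel z (p z).
  apply: Hp; have [Az|nAz] := pselect (A z).
    by exists z; split=> // y' _; rewrite subrr normr0 mulr_ge0.
  (* [z] is not adherent to A, since [ambient] would put it into A; the positive distance leaves
     room for the factor 2. *)
  have [q1 q10 Hq1] : exists2 q1, 0 < q1 & forall y, A y -> q1 <= `|y - z|.
    apply: contrapT => nq; apply: nAz; apply: Hq => // q1 q10; apply: contrapT => ny; apply: nq.
    by exists q1 => // y Ay; rewrite leNgt; apply/negP => yq; apply: ny; exists y.
  pose T := [set `|y - z| | y in A].
  have hT : has_inf T.
    by split; [exists `|x - z|, x|exists q1 => _ [y Ay <-]; exact: Hq1].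
  have i0 : 0 < inf T.
    by apply: lt_le_trans q10 _; apply: lb_le_inf => [|_ [y Ay <-]]; [exact: hT.1|exact: Hq1].
  have [_ [y Ay <-] yT] := inf_adherent i0 hT.
  exists y; split=> // y' Ay'; apply: le_trans (ltW yT) _.
  rewrite mulr2n mulrDl mul1r; suff : inf T <= `|y' - z| by move=> h; exact: lerD.
  by apply: (ge_inf hT.2); exists y'.
rewrite (pA x Ax); apply: le_lt_trans (rV_norm_enorm _) _; apply: Hr => //.
rewrite -(subrKA z); apply: le_lt_trans (ler_normD _ _) _.
by have := Hpz x Ax; rewrite (distrC x); lra.
Qed.

(** [piece_extension] compares slopes near [y] with the derivative of F at [y] only. Continuity of
    the derivative transfers this to the derivative at the nearby points themselves, at the cost of
    the second mu / 2; N is shrunk to where this holds. *)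
Lemma exists_piece (mu : R) (B : set 'rV[R]_n) d (io : 'I_d -> 'I_n) : 0 < mu -> def B ->
  (forall x, B x -> A x) -> (forall io' : 'I_d.+1 -> 'I_n, ~ proj_interior io' B) ->
  exists (Y N : set 'rV[R]_n) (F : 'rV[R]_n -> 'rV[R]_k),
  [/\ def Y, forall y, Y y -> B y, forall y, Y y -> near_all y (fun x => B x -> Y x) &
      ~ proj_interior io (fun x => B x /\ ~ Y x)] /\
  [/\ def N, forall z, N z -> near_all z N, forall y, Y y -> N y, dfun F & forall y, Y y -> F y = f y] /\
  [/\ forall z, N z -> exists J : 'M[R]_(n, k), strict_diff F z (fun u => u *m J) &
      forall z, N z -> A z -> exists J : 'M[R]_(n, k), strict_diff F z (fun u => u *m J) /\
        bounded_by_slope A f mu J z].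
Proof.
move=> mu0 dB BA noint; have mu20 : 0 < mu / 2 by rewrite divr_gt0.
have [Lam [dLam LamT]] := def_choice omD (def_tangential omD df io dB).
have [N [F [[dN oN YN dF] [FD FY bF]]]] := piece_extension omD (mu / 2) dA df io dB dLam.
pose Y := piece A f (mu / 2) B io Lam.
pose good (w : 'rV[R]_n) := exists J : 'M[R]_(n, k), (forall e : R, 0 < e -> exists2 r : R, 0 < r &
    forall a b : 'rV[R]_n, `|a - w| < r -> `|b - w| < r -> `|F b - F a - (b - a) *m J| <= e * `|b - a|) /\
    bounded_by_slope A f mu J w.
have dgood : def good.
  by have ds := def_slope_le omD dA df; rewrite /good /bounded_by_slope; deft.
exists Y, (fun z => N z /\ near_all z (fun w => A w -> good w)), F; split; [split|split; split] => //.
- exact: (def_piece omD (mu / 2) dA df io dB dLam).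
- by move=> y [].
- by move=> y /piece_open[r r0 Hr]; exists r => // x xr Bx; exact: Hr.
- exact: (piece_complement omD mu20 dA df slA dB BA noint dLam LamT).
- by rewrite /near_all; deft.
- move=> z [Nz gz]; apply: near_all_and; first exact: oN.
  exact: near_all_open.
- move=> y Yy; split; first exact: YN.
  have JD z : exists J : 'M[R]_(n, k), N z -> strict_diff F z (fun u => u *m J).
    by have [/FD[J HJ]|nN] := pselect (N z); [exists J|exists 0].
  have [J HJ] := choice JD.
  have [r r0 Hr] := oN y (YN y Yy).
  have e0 : 0 < mu / 2 / k.+1%:R by rewrite divr_gt0.
  have [s s0 Hs] := strict_diff_derivative_cont r0 (fun z zr => HJ z (Hr z zr)) e0.
  have [J' [SJ' [q q0 Hq]]] := bF y Yy.
  have eJ (u : 'rV[R]_n) : u *m J y = u *m J'.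
    exact: (strict_diff_unique (HJ y (YN y Yy)) SJ' u).
  exists (Num.min (Num.min r s) q); first by rewrite !lt_min r0 s0.
  move=> z; rewrite !lt_min => /andP[/andP[zr zs] zq] Az; exists (J z); split; first by have [] := HJ z (Hr z zr).
  move=> c sc u; rewrite -[u *m J z](subrK (u *m J y)).
  apply: le_trans (enormD _ _) _; rewrite eJ.
  have h1 := Hq z zq Az c sc u; have h2 := Hs z zs u.
  have h3 : enorm (u *m J z - u *m J') <= mu / 2 * enorm u.
    apply: le_trans (enorm_le_norm _) _; rewrite -eJ; apply: le_trans (ler_wpM2l (ler0n _ _) h2) _.
    have h4 : `|u| <= enorm u by exact: rV_norm_enorm.
    apply: le_trans (_ : k.+1%:R * (mu / 2 / k.+1%:R * `|u|) <= _).
      by rewrite ler_wpM2r ?ler_nat// mulr_ge0// ltW.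
    by rewrite mulrA [_ * (_ / _)]mulrC divfK// ler_pM2l.
  by lra.
- by move=> z [Nz _]; exact: FD.
- move=> z [Nz gz] Az; have [J [HJ bJ]] := near_all_self gz Az; exists J; split=> //.
  by split=> //; exact: bounded_linear_mulmx.
Qed.
End Extension.

Section Gluing.
Context (R : realType) (D : set_family R) (omD : o_minimal D).
Notation def := (@def R D _ _).
Notation dfun := (@dfun R D _ _ _ _).

Lemma dfun_if T U {dT : dtype R T} {dU : dtype R U} (P : T -> Prop) (f g : T -> U) :
  def P -> dfun f -> dfun g -> dfun (fun t => if `[< P t >] then f t else g t).
Proof.
move=> dP df dg; apply: (dfun_graph (G := fun t u => (P t /\ u = f t) \/ (~ P t /\ u = g t))).
  by move=> t u; case: asboolP => h; split; [case=> -[]|left|case=> -[]|right].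
by deft.
Qed.

Lemma smooth_indicator n (P : set 'rV[R]_n) : def P -> exists s : 'rV[R]_n -> R, [/\ dfun s,
    forall x, 0 <= s x /\ s x <= 1, forall x, 0 < s x -> P x, forall x, near_all x P -> 0 < s x &
    forall x, exists L, strict_diff (s : _ -> R^o) x L /\ forall u, `|L u| <= 8 * enorm u].
Proof.
move=> dP; have da : dfun (fun t => if `[< P t >] then 1 else 0 : R).
  exact: (dfun_if dP (dfun_cst omD (1 : R)) (dfun_cst omD (0 : R))).
have [|s [ds bs ps Ls]] := smooth_minorant omD da; first by move=> x; case: ifP.
exists s; split=> // [x|x|x [r r0 Hr]]; first by have [? []] := bs x.
  by have [_ [+ _]] := bs x; case: asboolP => // _; rewrite mulr0 => /le_lt_trans h /h; rewrite ltxx.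
by apply: (ps x 1 r) => // y /Hr Py; case: asboolP.
Qed.

Lemma smooth_positive_minorant n (e : 'rV[R]_n -> R) : dfun e -> exists s : 'rV[R]_n -> R, [/\ dfun s,
    forall x, 0 <= s x /\ s x <= 1, forall x, 0 < e x -> s x <= e x,
    forall x, (exists2 d, 0 < d & near_all x (fun y => d <= e y)) -> 0 < s x &
    forall x, exists L, strict_diff (s : _ -> R^o) x L /\ forall u, `|L u| <= 8 * enorm u].
Proof.
move=> de; have dp : dfun (fun t => if `[< is_true (0 < e t) >] then e t else 0 : R).
  exact: (dfun_if (def_lt omD (dfun_cst omD (0 : R)) de) de (dfun_cst omD (0 : R))).
(* The factor 1/3 offsets the 3 in [smooth_minorant]. *)
pose a x := 3^-1 * (if `[< is_true (0 < e x) >] then e x else 0).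
have da : dfun a by rewrite /a; deft.
have [|s [ds bs ps Ls]] := smooth_minorant omD da.
  by move=> x; rewrite mulr_ge0//; case: asboolP => // /ltW.
exists s; split=> // [x|x ex|x [d d0 [r r0 Hr]]]; first by have [? []] := bs x.
  have [_ [+ _]] := bs x; rewrite /a; case: asboolP => // _.
  by rewrite mulrA divff ?mul1r// pnatr_eq0.
apply: (ps x (3^-1 * d) r) => [|//|y /Hr dy]; first by rewrite mulr_gt0.
rewrite /a; case: asboolP => [_|]; first by rewrite ler_pM2l.
by move=> []; exact: lt_le_trans dy.
Qed.

(** Error bounds are definable but not continuous, so positivity at the point alone would not give a
    positive smooth minorant. *)
Definition locally_positive n (e : 'rV[R]_n -> R) (x : 'rV[R]_n) :=
  exists2 d, 0 < d & near_all x (fun y => d <= e y).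

Lemma locally_positive_diff n (e : 'rV[R]_n -> R) (x : 'rV[R]_n) L :
  strict_diff (e : _ -> R^o) x L -> 0 < e x -> locally_positive e x.
Proof.
move=> /strict_diff_cont ce ex; exists (e x / 2); first by rewrite divr_gt0.
apply: near_all_mono (near_all_cont_gt (c := e x / 2) ce _) _ => [|z /ltW//].
by rewrite ltr_pdivrMr// ltr_pMr// ltr1n.
Qed.

Lemma locally_positive_self n (e : 'rV[R]_n -> R) (x : 'rV[R]_n) : locally_positive e x -> 0 < e x.
Proof. by move=> [d d0 /near_all_self]; exact: lt_le_trans. Qed.

(* w = s1 / (s1 + s2) is 0 where s1 = 0 and 1 where s2 = 0. *)
Lemma ratio_diff n (s1 s2 : 'rV[R]_n -> R) x L1 L2 :
  0 <= s1 x -> 0 <= s2 x -> 0 < s1 x + s2 x ->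
  strict_diff (s1 : _ -> R^o) x L1 -> strict_diff (s2 : _ -> R^o) x L2 ->
  (forall u, `|L1 u| <= 8 * enorm u) -> (forall u, `|L2 u| <= 8 * enorm u) ->
  exists L, strict_diff (fun z => s1 z * (s1 z + s2 z)^-1 : R^o) x L /\
    forall u, `|L u| * (s1 x + s2 x) <= 8 * enorm u.
Proof.
move=> s10 s20 s0 d1 d2 b1 b2; have ds := strict_diff_add d1 d2.
have di := @strict_diff_inv R _ (fun z => s1 z + s2 z) x _ (lt0r_neq0 s0) ds.
eexists; split; first exact: (strict_diff_mul d1 di).
move=> u /=; rewrite -[X in _ * X <= _](gtr0_norm s0) -normrM.
have -> : (L1 u / (s1 x + s2 x) + s1 x * (- (s1 x + s2 x) ^- 2 * (L1 u + L2 u))) * (s1 x + s2 x) =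
  (L1 u * s2 x - L2 u * s1 x) / (s1 x + s2 x) by field; rewrite gt_eqF.
rewrite normrM [`|_^-1|]gtr0_norm ?invr_gt0// ler_pdivrMr//.
apply: le_trans (ler_normB _ _) _; rewrite !normrM (ger0_norm s10) (ger0_norm s20).
have := ler_wpM2r s20 (b1 u); have := ler_wpM2r s10 (b2 u); clear; lra.
Qed.

(* The error bound e need not be positive on B, so it may tend to 0 there. *)
Definition approximable_off n k (A : set 'rV[R]_n) (f ft : 'rV[R]_n -> 'rV[R]_k) (mu : R) (B : set 'rV[R]_n) :=
  forall e : 'rV[R]_n -> R, dfun e ->
  (forall x, ambient A x -> ~ B x -> locally_positive e x) ->
  exists (V : set 'rV[R]_n) (H : 'rV[R]_n -> 'rV[R]_k),
  [/\ def V, dfun H, forall z, V z -> near_all z V & forall x, A x -> ~ B x -> V x] /\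
  [/\ forall z, V z -> ambient A z /\ ~ B z,
      forall z, V z -> exists J : 'M[R]_(n, k), strict_diff H z (fun u => u *m J),
      forall z, V z -> enorm (H z - ft z) < e z &
      forall z, V z -> A z -> exists J : 'M[R]_(n, k), strict_diff H z (fun u => u *m J) /\
        bounded_by_slope A f mu J z].

Definition closed_in_ambient n (A B : set 'rV[R]_n) := forall x, ambient A x -> adherent B x -> B x.

(** [H] is taken within [dl * eta] of [ft], so close that near Y both cutoffs are 1 and the blend is
    F itself; there F replaces H, which is not defined on Y. Where w >= 1/2, in particular where
    [s2] vanishes and F may be unusable, rho is 0 and the blend is H. One part of the 4 mu1 is
    inherited from H and F, one pays for rho, one for the cutoff of the difference, and one is
    spare. *)
Lemma approximable_off_piece n k (A : set 'rV[R]_n) (f ft : 'rV[R]_n -> 'rV[R]_k) (C0 : R)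
    (B Y N : set 'rV[R]_n) (F : 'rV[R]_n -> 'rV[R]_k) (mu1 : R) :
  def A -> dfun ft -> dfun f -> (forall x, A x -> slope_le A f x C0) -> (forall x, A x -> ambient A x) ->
  (forall x, A x -> ft x = f x) -> (forall x, A x -> cont_at ft x) ->
  def B -> closed_in_ambient A B -> approximable_off A f ft mu1 B -> 0 < mu1 ->
  def Y -> (forall y, Y y -> B y) -> (forall y, Y y -> A y) ->
  (forall y, Y y -> near_all y (fun x => B x -> Y x)) ->
  def N -> (forall z, N z -> near_all z N) -> (forall y, Y y -> N y) -> dfun F ->
  (forall y, Y y -> F y = f y) ->
  (forall z, N z -> exists J : 'M[R]_(n, k), strict_diff F z (fun u => u *m J)) ->
  (forall z, N z -> A z -> exists J : 'M[R]_(n, k), strict_diff F z (fun u => u *m J) /\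
     bounded_by_slope A f mu1 J z) ->
  approximable_off A f ft (4 * mu1) (fun x => B x /\ ~ Y x).
Proof.
move=> dA dft df slA Aamb ft_eq ft_cont dB cB QB mu0 dY YB YA oY dN oN YN dF FY FD bF e de ep.
have damb : def (ambient A) by rewrite /ambient /adherent /near_all; deft.
have [s0 [ds0 s0b s0e s0p s0L]] := smooth_positive_minorant de.
have [s1 [ds1 s1b s1P s1p s1L]] := smooth_indicator (def_not omD dY).
have [s2 [ds2 s2b s2P s2p s2L]] := smooth_indicator dN.
have [kr [kr' [Cr [Kr [dr [[dkr [Cr0 qkr] bkr [dr0 kr1]] [kr0 _ [Kr0 Krb]]]]]]]] := slow_cutoff omD ltr01.
pose cc := C0 + mu1.
have [C00|nA] := pselect (0 <= C0); last first.
  (* A slope bound is nonnegative, so a negative [C0] forces A to be empty. *)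
  have noA x : ~ A x by move=> /slA[].
  exists set0, (fun=> 0); split; split=> //; first exact: def_cst.
  - by deft.
  - by move=> x /noA.
have cc0 : 0 <= cc by rewrite /cc addr_ge0// ltW.
(* Makes the cutoff error e (4 c + 2) of [blend_strict_diff] equal to mu1 for c = cc. *)
have e20 : 0 < mu1 / (4 * cc + 2) by rewrite divr_gt0// ltr_wpDl// mulr_ge0.
have [ks [ks' [Cs [_ [ds [[dks [Cs0 qks] bks [dsp ks1]] [ks0 sks _]]]]]]] := slow_cutoff omD e20.
(* The derivative of [eta] is at most 32 c, which is at most 1, and that of rho times [eta] at most
   16 Kr c, which is at most mu1. *)
pose c := mu1 / (16 * Kr + 1 + 32 * mu1).
have den0 : 0 < 16 * Kr + 1 + 32 * mu1 by rewrite ltr_wpDr ?mulr_ge0 ?(ltW mu0)// ltr_wpDl// mulr_ge0.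
have c0 : 0 < c by rewrite divr_gt0.
have c32 : 32 * c <= 1.
  by rewrite /c mulrA ler_pdivrMr// mul1r lerDr addr_ge0// mulr_ge0.
have cK : 16 * Kr * c <= mu1.
  rewrite /c mulrA ler_pdivrMr// mulrC ler_pM2l//; move: (ltW mu0); clear; lra.
(* Ensures (2 dl)^2 <= ds, so that the cutoff is 1 where |H - F| <= 2 dl eta. *)
pose dl := Num.min ds 1 / 4.
have dm0 : 0 < Num.min ds 1 by rewrite lt_min dsp ltr01.
have dm1 : Num.min ds 1 <= ds by rewrite ge_min lexx.
have dm2 : Num.min ds 1 <= 1 by rewrite ge_min lexx orbT.
have dl0 : 0 < dl by rewrite divr_gt0.
(* [s0] keeps the gauge below the error bound; the factor [s1 + s2] cancels the denominator of the
   derivative of [w]. *)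
pose eta x := c * (s0 x * (s1 x + s2 x)).
have deta : dfun eta by rewrite /eta; deft.
(* On Y the point is interior to N, so [s2] is positive. Off B, closedness of B keeps Y away, so
   [s1] is positive. *)
have s12 x : ambient A x -> ~ (B x /\ ~ Y x) -> 0 < s1 x + s2 x.
  move=> Ax nBY; have [Yx|nY] := pselect (Y x).
    by rewrite ltr_wpDl ?s2p//; [have [] := s1b x|exact: oN (YN x Yx)].
  rewrite ltr_pwDl ?(s2b x).1// s1p//; apply: contrapT => nn.
  have Bx : B x.
    apply: cB => // r r0; apply: contrapT => nr; apply: nn; exists r => // z zr Yz.
    by apply: nr; exists z => //; exact: YB.
  by apply: nBY.
have eta0 x : ambient A x -> ~ (B x /\ ~ Y x) -> 0 < eta x.
  by move=> Ax nBY; rewrite mulr_gt0// mulr_gt0 ?s12// s0p//; exact: ep.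
have etaD x : exists L, strict_diff (eta : _ -> R^o) x L /\ forall u, `|L u| <= enorm u.
  have [L0 [D0 b0]] := s0L x; have [L1 [D1 b1]] := s1L x; have [L2 [D2 b2]] := s2L x.
  have dall := strict_diff_mul (@strict_diff_cst R _ R^o c x) (strict_diff_mul D0 (strict_diff_add D1 D2)).
  eexists; split; first exact: dall.
  move=> u /=; rewrite mul0r add0r normrM (gtr0_norm c0).
  have [s00 s01] := s0b x; have [s10 s11] := s1b x; have [s20 s21] := s2b x.
  have h1 : `|L0 u * (s1 x + s2 x)| <= 8 * enorm u * 2.
    rewrite normrM; apply: ler_pM => //; rewrite ger0_norm; lra.
  have h2 : `|s0 x * (L1 u + L2 u)| <= 1 * (16 * enorm u).
    rewrite normrM; apply: ler_pM => //; first by rewrite ger0_norm.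
    by apply: le_trans (ler_normD _ _) _; have := b1 u; have := b2 u; lra.
  have h3 : `|L0 u * (s1 x + s2 x) + s0 x * (L1 u + L2 u)| <= 32 * enorm u.
    by apply: le_trans (ler_normD _ _) _; lra.
  apply: le_trans (ler_wpM2l (ltW c0) h3) _; rewrite mulrA [c * 32]mulrC.
  by apply: ler_piMl => //; exact: enorm_ge0.
have etae x : ambient A x -> ~ (B x /\ ~ Y x) -> 2 * eta x <= e x.
  move=> Ax nBY; have ex := locally_positive_self (ep x Ax nBY).
  have h := s0e x ex; have [s00 _] := s0b x; have [s10 s11] := s1b x; have [s20 s21] := s2b x.
  have h1 : s0 x * (s1 x + s2 x) <= e x * 2 by apply: ler_pM => //; lra.
  have h2 := ler_wpM2l (ltW c0) h1.
  have h3 : 32 * c * e x <= 1 * e x by rewrite ler_pM2r.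
  rewrite /eta; move: h2 h3 (ltW ex); clear; lra.
pose e1 x := dl * eta x.
have de1 : dfun e1 by rewrite /e1; deft.
have nBBY x : ~ B x -> ~ (B x /\ ~ Y x) by move=> nB [].
have e1p x : ambient A x -> ~ B x -> locally_positive e1 x.
  move=> Ax nB; have [L [DL _]] := etaD x.
  apply: locally_positive_diff (strict_diff_mul (@strict_diff_cst R _ R^o dl x) DL) _.
  by rewrite mulr_gt0// eta0//; exact: nBBY.
have [V [H [[dV dH oV AV] [VB HD He HA]]]] := QB e1 de1 e1p.
pose w x := s1 x * (s1 x + s2 x)^-1.
pose rho x := kr (2 * w x).
pose q x := dot (H x - F x) (H x - F x) * (eta x * eta x)^-1.
pose H2 z := H z - (rho z * ks (q z)) *: (H z - F z).
pose H' z := if `[< V z >] then H2 z else F z.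
have drho : dfun rho by rewrite /rho /w; deft.
have dH2 : dfun H2.
  rewrite /H2 /q; have dq : dfun (fun z => dot (H z - F z) (H z - F z)) by apply: dfun_dot; deft.
  by deft.
have dH' : dfun H' by exact: dfun_if.
(* Here H' equals F whether or not H is defined; [N'] is the interior, needed for openness of the
   new domain. *)
pose N'0 (z : 'rV[R]_n) := [/\ ambient A z, ~ (B z /\ ~ Y z), N z, 2 * w z <= dr & enorm (F z - ft z) < dl * eta z].
pose N' (z : 'rV[R]_n) := near_all z N'0.
have dN' : def N'.
  have d0 : def N'0.
    apply: (def_ext (P := fun z => ambient A z /\ (~ (B z /\ ~ Y z) /\ (N z /\
      (2 * w z <= dr /\ enorm (F z - ft z) < dl * eta z))))); first by rewrite /w; deft.
    by move=> z; split=> [[? [? [? []]]]|[]].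
  by rewrite /N' /near_all; deft.
have H'F z : N'0 z -> H' z = F z.
  move=> [Az nBY Nz wz Fz]; rewrite /H'; case: asboolP => // Vz; rewrite /H2.
  have eta_z := eta0 z Az nBY.
  have -> : rho z = 1 by apply: kr1.
  have -> : ks (q z) = 1; last by rewrite mulr1 scale1r subKr.
  have hv : enorm (H z - F z) <= 2 * dl * eta z.
    rewrite -(subrKA (ft z)); apply: le_trans (enormD _ _) _; rewrite [enorm (ft z - _)]enormB.
    by have := He z Vz; rewrite /e1; move: Fz; clear; lra.
  apply: ks1; rewrite /q -enorm_sqr -expr2 ler_pdivrMr ?exprn_gt0//.
  apply: le_trans (_ : (2 * dl * eta z) ^+ 2 <= _).
    rewrite ler_sqr ?nnegrE ?enorm_ge0//; apply: le_trans hv; exact: enorm_ge0.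
  rewrite exprMn ler_wpM2r ?sqr_ge0// /dl; move: dm0 dm1 dm2; clear; nra.
have rho01 z : 0 <= rho z /\ rho z <= 1 by exact: bkr.
have H2ft z : V z -> enorm (H2 z - ft z) < e z.
  move=> Vz; have [Az nB] := VB z Vz; have nBY := nBBY z nB.
  have eta_z := eta0 z Az nBY; have [r0 r1] := rho01 z; have [k0 k1] := bks (q z).
  have h1 := He z Vz; have h2 := etae z Az nBY.
  have h3 : enorm ((rho z * ks (q z)) *: (H z - F z)) <= eta z.
    have [q1|q1] := leP 1 (q z); first by rewrite (ks0 _ q1).1 mulr0 scale0r enorm0 ltW.
    rewrite enormZ ger0_norm ?mulr_ge0//.
    apply: le_trans (_ : enorm (H z - F z) <= _).
      by apply: ler_piMl; [exact: enorm_ge0|exact: mulr_ile1].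
    rewrite -ler_sqr ?nnegrE ?enorm_ge0 ?(ltW eta_z)// enorm_sqr expr2.
    have ee : 0 < eta z * eta z := mulr_gt0 eta_z eta_z.
    by rewrite -[leRHS]mul1r -(ler_pdivrMr _ _ ee); exact: (ltW q1).
  have -> : H2 z - ft z = (H z - ft z) - (rho z * ks (q z)) *: (H z - F z) by rewrite /H2 addrAC.
  apply: le_lt_trans (enormD _ _) _; rewrite enormN.
  apply: lt_le_trans h2; rewrite mulr2n mulrDl mul1r; apply: ltr_leD => //.
  apply: lt_le_trans h1 _; rewrite /e1 ler_piMl ?(ltW eta_z)// /dl; move: dm2; clear; lra.
have D2 z : V z ->
    (exists J : 'M[R]_(n, k), strict_diff H2 z (fun u => u *m J)) /\
    (A z -> exists J : 'M[R]_(n, k), strict_diff H2 z (fun u => u *m J) /\ bounded_by_slope A f (4 * mu1) J z).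
  move=> Vz; have [amb nB] := VB z Vz; have nBY := nBBY z nB.
  have eta_z := eta0 z amb nBY; have s_z := s12 z amb nBY.
  have [L1 [D1 b1]] := s1L z; have [L2 [D2 b2]] := s2L z.
  have [s10 s11] := s1b z; have [s20 s21] := s2b z; have [s00 s01] := s0b z.
  have [Lw [Dw bw]] := ratio_diff s10 s20 s_z D1 D2 b1 b2.
  (* Where [s2] vanishes, F need not be differentiable; but w = 1 there, so rho vanishes nearby and
     [H2] is H. *)
  have [s2z|s2z] := eqVneq (s2 z) 0.
    have wz : w z = 1 by rewrite /w s2z addr0 divff// gt_eqF//; move: s_z; rewrite s2z addr0.
    have hw : 1 / 2 < w z by rewrite wz ltr_pdivrMr// mul1r ltr1n.
    have [r r0 Hr] := near_all_cont_gt (c := 1 / 2) (strict_diff_cont Dw) hw.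
    have HH2 (y : 'rV[R]_n) : `|y - z| < r -> H y = H2 y.
      move=> /Hr; rewrite -/(w y) => h; rewrite /H2 /rho (kr0 _ _).1 ?mul0r ?scale0r ?subr0//.
      by move: h; clear; lra.
    split; first by have [J HJ] := HD z Vz; exists J; exact: strict_diff_ext r0 HH2 HJ.
    move=> Az; have [J [HJ bJ]] := HA z Vz Az; exists J; split; first exact: strict_diff_ext r0 HH2 HJ.
    move=> c' sc u; apply: le_trans (bJ c' sc u) _; rewrite ler_wpM2r ?enorm_ge0// lerD2l.
    by move: mu0; clear; lra.
  have Nz : N z by apply: s2P; rewrite lt_neqAle eq_sym s2z.
  have [Le [De be]] := etaD z.
  have Dkr t : strict_diff (kr : R^o -> R^o) t (fun h => kr' t * h).
    apply: (@quadratic_strict_diff R R^o kr (fun t h => kr' t * h) Cr) => // [y|y h]; last first.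
      by apply: le_trans (qkr y h) _; rewrite real_normK// num_real.
    split=> [s u v|]; first by change (kr' y * (s * u + v) = s * (kr' y * u) + kr' y * v); ring.
    by exists `|kr' y|; split=> // u; rewrite normrM.
  have D2w := strict_diff_mul (@strict_diff_cst R _ R^o 2 z) Dw.
  have Drho := @strict_diff_comp R _ R^o R^o kr _ z _ _ D2w (Dkr _).
  have [rz0 rz1] := rho01 z.
  have brho u : `|kr' (2 * (s1 z / (s1 z + s2 z))) * (0 * (s1 z / (s1 z + s2 z)) + 2 * Lw u)| * eta z <= mu1 * enorm u.
    rewrite mul0r add0r !normrM normr_nat.
    have h1 := bw u; have h2 := Krb (2 * (s1 z / (s1 z + s2 z))).
    have h3 : s0 z * (`|Lw u| * (s1 z + s2 z)) <= 1 * (8 * enorm u).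
      by apply: ler_pM => //; rewrite mulr_ge0// ltW.
    have -> : forall t, t * (2 * `|Lw u|) * eta z = 2 * c * (t * (s0 z * (`|Lw u| * (s1 z + s2 z)))).
      by move=> t; rewrite /eta; ring.
    have h4 : `|kr' (2 * (s1 z / (s1 z + s2 z)))| * (s0 z * (`|Lw u| * (s1 z + s2 z))) <= Kr * (1 * (8 * enorm u)).
      by apply: ler_pM => //; rewrite mulr_ge0// mulr_ge0// ltW.
    apply: le_trans (ler_wpM2l _ h4) _; first by rewrite mulr_ge0// ltW.
    have -> : 2 * c * (Kr * (1 * (8 * enorm u))) = (16 * Kr * c) * enorm u by ring.
    by rewrite ler_wpM2r ?enorm_ge0.
  have key JH JF a b : strict_diff H z (fun u => u *m JH) -> strict_diff F z (fun u => u *m JF) ->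
      (forall u : 'rV[R]_n, enorm (u *m JH) <= a * enorm u) -> (forall u : 'rV[R]_n, enorm (u *m JF) <= a * enorm u) ->
      (forall u : 'rV[R]_n, enorm (u *m JH) <= b * enorm u) -> (forall u : 'rV[R]_n, enorm (u *m JF) <= b * enorm u) ->
      exists L, strict_diff H2 z L /\ forall u, enorm (L u) <= (a + mu1 + mu1 / (4 * cc + 2) * (4 * b + 2)) * enorm u.
    move=> DH DF ah af bh bf.
    exact: (blend_strict_diff DH DF De Drho eta_z Cs0 qks bks ks0 sks rz0 rz1 ah af bh bf be brho).
  split.
    have [JH DH] := HD z Vz; have [JF DF] := FD z Nz.
    have [K K0 HK] := @norm_mulmx R n k.
    have bnd (J : 'M[R]_(n, k)) : exists2 a, 0 <= a & forall u : 'rV[R]_n, enorm (u *m J) <= a * enorm u.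
      exists (k%:R * (K * `|J|)) => [|u]; first by rewrite !mulr_ge0// ltW.
      apply: le_trans (enorm_le_norm _) _; rewrite -!mulrA ler_wpM2l//.
      apply: le_trans (HK _ _) _; rewrite -mulrA ler_pM2l// mulrC ler_wpM2l//.
      exact: rV_norm_enorm.
    have [a a0 Ha] := bnd JH; have [b b0 Hb] := bnd JF.
    have Ha' u : enorm (u *m JH) <= (a + b) * enorm u.
      by apply: le_trans (Ha u) _; rewrite ler_wpM2r ?enorm_ge0// lerDl.
    have Hb' u : enorm (u *m JF) <= (a + b) * enorm u.
      by apply: le_trans (Hb u) _; rewrite ler_wpM2r ?enorm_ge0// lerDr.
    have [L [DL _]] := key JH JF _ _ DH DF Ha' Hb' Ha' Hb'.
    have [J [LJ _]] := strict_diff_matrix DL; exists J; exact: LJ.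
  move=> Az; have [JH [DH bH]] := HA z Vz Az; have [JF [DF bJ]] := bF z Nz Az.
  have exL a : slope_le A f z a ->
     exists L, strict_diff H2 z L /\ forall u, enorm (L u) <= (a + mu1 + mu1 + mu1 / (4 * cc + 2) * (4 * cc + 2)) * enorm u.
    move=> sa; have := key JH JF _ _ DH DF (bH a sa) (bJ a sa) (bH C0 (slA _ Az)) (bJ C0 (slA _ Az)).
    by [].
  (* One J must serve all slope bounds [a]; uniqueness of the derivative identifies the maps
     obtained for different [a]. *)
  have [L [DL _]] := exL C0 (slA _ Az); have [J [LJ _]] := strict_diff_matrix DL.
  exists J; split; first exact: LJ.
  move=> a sa u; have [L' [DL' bL']] := exL a sa.
  have := bL' u; rewrite -(strict_diff_unique LJ DL' u) => /le_trans; apply.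
  rewrite divfK; last by rewrite gt_eqF// ltr_wpDl// mulr_ge0.
  by rewrite ler_wpM2r ?enorm_ge0//; move: mu0; clear; lra.
pose V' : set 'rV[R]_n := fun z => V z \/ N' z.
exists V', H'.
split; split; [|exact: dH'|..].
- exact: (def_or omD dV dN').
- move=> z [Vz|Nz]; first by apply: near_all_mono (oV z Vz) _ => y; left.
  by apply: near_all_mono (near_all_open Nz) _ => y; right.
- move=> x Ax nBY; have [Yx|nY] := pselect (Y x); last first.
    by left; apply: AV => // Bx; apply: nBY.
  right; rewrite /N' /N'0.
  have ambx := Aamb _ Ax; have s_x := s12 x ambx nBY; have eta_x := eta0 x ambx nBY.
  have [L1 [D1 b1]] := s1L x; have [L2 [D2' b2]] := s2L x.
  have [s10 s11] := s1b x; have [s20 s21] := s2b x.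
  have [Lw [Dw _]] := ratio_diff s10 s20 s_x D1 D2' b1 b2.
  have w0 : w x = 0.
    rewrite /w (_ : s1 x = 0) ?mul0r//; apply: le_anti; rewrite s10 andbT leNgt; apply/negP => /s1P.
    exact.
  have [Le [De _]] := etaD x; have [d d0 Hd] := locally_positive_diff De eta_x.
  have [JF DF] := FD x (YN x Yx).
  have n1 : near_all x (fun z => enorm (F z - ft z) < dl * d).
    have [r r0 Hr] := enorm_small k (mulr_gt0 dl0 d0); have r20 : 0 < r / 2 by rewrite divr_gt0.
    have [r1 r10 Hr1] := strict_diff_cont DF r20; have [r2 r20' Hr2] := ft_cont _ Ax _ r20.
    exists (Num.min r1 r2) => [|z]; first by rewrite lt_min r10.
    rewrite lt_min => /andP[/Hr1 h1 /Hr2 h2]; apply: Hr.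
    rewrite -(subrKA (F x)); apply: le_lt_trans (ler_normD _ _) _.
    rewrite {2}(FY x Yx) -(ft_eq _ Ax) [`|ft x - _|]distrC; move: h1 h2; clear; lra.
  have n2 : near_all x (fun z => w z < dr / 2).
    by apply: near_all_cont_lt (strict_diff_cont Dw) _; rewrite -/(w x) w0 divr_gt0.
  have n3 := near_all_and (near_all_and ambx (oY x Yx)) (near_all_and (oN x (YN x Yx)) (near_all_and n2 (near_all_and n1 Hd))).
  apply: near_all_mono (near_all_and (near_all_open ambx) n3) _ => z [amb [[_ BYz] [Nz [wz [Fz dz]]]]].
  split=> //; first by move=> [/BYz].
    by move: wz; clear; lra.
  by apply: lt_le_trans Fz _; rewrite ler_pM2l.
- move=> z [Vz|/near_all_self[]//]; have [? ?] := VB z Vz; split=> //; exact: nBBY.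
- move=> z [Vz|Nz].
    have [[J HJ] _] := D2 z Vz; exists J; have [r r0 Hr] := oV z Vz.
    by apply: strict_diff_ext r0 _ HJ => y /Hr Vy; rewrite /H'; case: asboolP.
  have [_ _ Nz' _ _] := near_all_self Nz; have [J HJ] := FD z Nz'; exists J; have [r r0 Hr] := Nz.
  by apply: strict_diff_ext r0 _ HJ => y /Hr Ny; rewrite H'F.
- move=> z [Vz|/near_all_self N0z]; first by rewrite /H'; case: asboolP => // _; exact: H2ft.
  rewrite H'F//; case: N0z => amb nBY _ _ h; apply: lt_le_trans h _.
  have := etae z amb nBY; have := eta0 z amb nBY; move: dl0 dm2; rewrite /dl; clear; nra.
- move=> z [Vz|Nz] Az.
    have [_ /(_ Az)[J [HJ bJ]]] := D2 z Vz; exists J; split=> //; have [r r0 Hr] := oV z Vz.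
    by apply: strict_diff_ext r0 _ HJ => y /Hr Vy; rewrite /H'; case: asboolP.
  have [_ _ Nz' _ _] := near_all_self Nz; have [J [HJ bJ]] := bF z Nz' Az; exists J; have [r r0 Hr] := Nz.
  split; first by apply: strict_diff_ext r0 _ HJ => y /Hr Ny; rewrite H'F.
  move=> a sa u; apply: le_trans (bJ a sa u) _; rewrite ler_wpM2r ?enorm_ge0// lerD2l.
  by move: mu0; clear; lra.
Qed.
End Gluing.

(** * Exhaustion by pieces *)

Section Exhaustion.
Context (R : realType) (D : set_family R) (omD : o_minimal D).
Notation def := (@def R D _ _).
Notation dfun := (@dfun R D _ _ _ _).

Lemma approximable_off_mono n k (A : set 'rV[R]_n) (f ft : 'rV[R]_n -> 'rV[R]_k) (mu mu' : R) B :
  mu <= mu' -> approximable_off D A f ft mu B -> approximable_off D A f ft mu' B.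
Proof.
move=> mm H e de ep; have [V [G [h1 [h2 h3 h4 h5]]]] := H e de ep.
exists V, G; split=> //; split=> // z Vz Az; have [J [DJ bJ]] := h5 z Vz Az; exists J; split=> //.
by move=> c sc u; apply: le_trans (bJ c sc u) _; rewrite ler_wpM2r ?enorm_ge0// lerD2l.
Qed.

(* Induction on the number of coordinate projections under which B has an image
   with interior; for d = 0 this says that B is nonempty. *)
Lemma approximable_off_empty n k (A : set 'rV[R]_n) (f ft : 'rV[R]_n -> 'rV[R]_k) (C0 mu : R) :
  def A -> dfun ft -> dfun f -> (forall x, A x -> slope_le A f x C0) -> (forall x, A x -> ambient A x) ->
  (forall x, A x -> ft x = f x) -> (forall x, A x -> cont_at ft x) -> 0 < mu ->
  approximable_off D A f ft mu set0.
Proof.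
move=> dA dft df slA Aamb ft_eq ft_cont mu0.
pose I := {d : 'I_n.+1 & {ffun 'I_d -> 'I_n}}.
pose fat (B : set 'rV[R]_n) := [pred p : I | `[< proj_interior (tagged p) B >]].
have main m : forall (B : set 'rV[R]_n) nu, 0 < nu -> def B -> (forall x, B x -> A x) ->
    closed_in_ambient A B -> (#|fat B| <= m)%N -> approximable_off D A f ft nu B ->
    approximable_off D A f ft (4 ^+ m * nu) set0.
  elim: m => [|m IH] B nu nu0 dB BA cB.
    rewrite leqn0 => /eqP/card0_eq h QB; rewrite expr0 mul1r.
    suff -> : set0 = B by [].
    apply/seteqP; split=> // x Bx; exfalso.
    have := h (Tagged (fun d : 'I_n.+1 => {ffun 'I_d -> 'I_n}) ([ffun i : 'I_0 => False_rect _ (notF (ltn_ord i))] : {ffun 'I_(@ord0 n) -> 'I_n})).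
    rewrite inE => /asboolP; apply; exists 0, 1; split=> // p _; exists x; split=> //.
    by apply/rowP => -[].
  have [|] := leqP #|fat B| m => [h _ QB|fatB cardB QB].
    apply: approximable_off_mono (IH B nu nu0 dB BA cB h QB).
    by rewrite ler_pM2r// exprS ler_peMl ?exprn_ge0// ler1n.
  have /card_gt0P[p0 p0B] : (0 < #|fat B|)%N by exact: leq_ltn_trans fatB.
  have [p pB pmax] := @arg_maxnP _ p0 (fun p => p \in fat B) (fun p => tag p : nat) p0B.
  have noint (io' : 'I_(tag p).+1 -> 'I_n) : ~ proj_interior io' B.
    move=> pio; have inj := proj_interior_inj pio.
    have dn : ((tag p).+1 < n.+1)%N by have := leq_card io' inj; rewrite !card_ord ltnS.
    pose p' : I := Tagged (fun d : 'I_n.+1 => {ffun 'I_d -> 'I_n}) ([ffun i => io' i] : {ffun 'I_(Ordinal dn) -> 'I_n}).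
    suff /pmax : p' \in fat B by rewrite /= ltnn.
    rewrite inE.
    refine (eq_rect io' (fun g : 'I_(tag p).+1 -> 'I_n => proj_interior g B) pio _ _).
    by apply/funext => i; rewrite /p' /= ffunE.
  have [Y [N [F [[dY YB oY nY] [[dN oN YN dF FY] [FD bF]]]]]] := exists_piece omD dA df slA (tagged p) nu0 dB BA noint.
  have Q' := approximable_off_piece omD dA dft df slA Aamb ft_eq ft_cont dB cB QB nu0 dY YB
    (fun y Yy => BA y (YB y Yy)) oY dN oN YN dF FY FD bF.
  rewrite exprSr -mulrA; apply: (IH (fun x => B x /\ ~ Y x)) => //.
  - by rewrite mulr_gt0.
  - by apply: (def_and omD) => //; exact: def_not.
  - by move=> x [/BA].
  - move=> x ax adx; have Bx : B x by apply: cB => // r /adx[y []]; exists y.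
    split=> // Yx; have [r r0 Hr] := oY x Yx; have [y [By nYy] yr] := adx r r0.
    by apply: nYy; exact: Hr.
  rewrite -ltnS; apply: leq_trans cardB; apply: proper_card; apply/properP; split.
    apply/fintype.subsetP => q; rewrite !inE => -[c [r [r0 H]]]; exists c, r; split=> //.
    by move=> z /H[x [[Bx _] xz]]; exists x.
  by exists p => //; rewrite inE; apply/asboolP.
have nu0 : 0 < mu / 4 ^+ #|fat A| by rewrite divr_gt0// exprn_gt0.
have E : 4 ^+ #|fat A| * (mu / 4 ^+ #|fat A|) = mu by rewrite mulrC divfK// expf_neq0// pnatr_eq0.
rewrite -[mu]E; apply: (main _ A _ nu0 dA) => //.
- by move=> x /near_all_self.
(* The start B = A is trivial: no point of A has to be covered, so the empty domain will do. *)
move=> e de ep; exists set0, (fun=> 0); split; split=> //; first exact: def_cst.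
exact: dfun_cst.
Qed.
End Exhaustion.

(** * From balls and strict derivatives to topology and C^1 maps *)

Section Topology.
Context (R : realType).

Lemma locally_closed_ambient n (A : set 'rV[R]_n) x : locally_closed A -> A x -> ambient A x.
Proof.
move=> [U [F [oU cF ->]]] [Ux Fx].
have /nbhs_ballP[r /= r0 Hr] : nbhs x U by exact: open_nbhs_nbhs.
exists r => // z zr adz; split; first by apply: Hr; rewrite -ball_normE /= distrC.
apply: cF => V /nbhs_ballP[q /= q0 Hq]; have [y [_ Fy] yq] := adz q q0.
by exists y; split=> //; apply: Hq; rewrite -ball_normE /= distrC.
Qed.

Lemma near_all_nbhs n (x : 'rV[R]_n) P : near_all x P -> nbhs x P.
Proof.
move=> [r r0 Hr]; apply/nbhs_ballP; exists r => //= z.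
by rewrite -ball_normE /= distrC; exact: Hr.
Qed.

Lemma within_continuous_dist (T : set R) n (g : R -> 'rV[R]_n) t e : {within T, continuous g} -> T t -> 0 < e ->
  exists2 r, 0 < r & forall s, T s -> `|s - t| < r -> `|g s - g t| < e.
Proof.
move=> /subspace_continuousP cg Tt e0; have /cvgrPdist_lt/(_ e e0) := cg t Tt.
rewrite near_withinE => /nbhs_ballP[r /= r0 Hr]; exists r => // s Ts st.
by rewrite distrC; apply: Hr => //; rewrite /ball /= distrC.
Qed.

Lemma within_continuous_lbound n (A : set 'rV[R]_n) (g : 'rV[R]_n -> R) x : {within A, continuous g} -> A x -> 0 < g x ->
  near_all x (fun y => A y -> g x / 2 <= g y).
Proof.
move=> /subspace_continuousP cg Ax g0; have g20 : 0 < g x / 2 by rewrite divr_gt0.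
have /cvgrPdist_lt/(_ _ g20) := cg x Ax.
rewrite near_withinE => /nbhs_ballP[r /= r0 Hr]; exists r => // z zr Az.
have /Hr/(_ Az) : ball x r z by rewrite -ball_normE /= distrC.
by move=> h; have : g x - g z < g x / 2 := le_lt_trans (ler_norm _) h; lra.
Qed.

Lemma cont_at_continuous (V W : normedModType R) (f : V -> W) x : cont_at f x -> {for x, continuous f}.
Proof.
move=> cf; apply/cvgrPdist_lt => e e0; have [r r0 Hr] := cf e e0.
apply/nbhs_ballP; exists r => //= z; rewrite -ball_normE /= distrC => /Hr.
by rewrite distrC.
Qed.

Lemma strict_diff_differentiable n k (G : 'rV[R]_n -> 'rV[R]_k) x (J : 'M[R]_(n, k)) :
  strict_diff G x (fun u => u *m J) -> differentiable G x /\ 'd G x = (fun u => u *m J) :> (_ -> _).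
Proof.
move=> [bJ H].
have cJ : continuous (mulmxr J : 'rV[R]_n -> 'rV[R]_k).
  by move=> y; apply: cont_at_continuous; exact: strict_diff_cont (strict_diff_linear y bJ).
have lit : G \o shift x = cst (G x) + mulmxr J +o_ (0 : 'rV[R]_n) id.
  apply/eqaddoP => e e0; have [r r0 Hr] := H e e0.
  apply: near_all_nbhs; exists r => // z; rewrite subr0 => zr.
  have := Hr x (z + x); rewrite subrr normr0 addrK => /(_ r0 zr).
  by rewrite opprD addrA.
have dE := diff_unique cJ lit; split; last exact: dE.
by apply/diff_locallyP; rewrite dE.
Qed.

Lemma strict_diff_C1 n k (G : 'rV[R]_n -> 'rV[R]_k) (V : set 'rV[R]_n) :
  (forall z, V z -> near_all z V) ->
  (forall z, V z -> exists J : 'M[R]_(n, k), strict_diff G z (fun u => u *m J)) ->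
  open V /\ C1_on V G.
Proof.
move=> oV DG; split; first by rewrite openE => z /oV /near_all_nbhs.
move=> x Vx; have [J DJ] := DG x Vx; have [dG dE] := strict_diff_differentiable DJ; split=> //.
apply: cont_at_continuous => e0' e0'0; pose e := e0' / 2; have e0 : 0 < e by rewrite divr_gt0.
have JE (z : 'rV[R]_n) : exists Jz : 'M[R]_(n, k), V z -> strict_diff G z (fun u => u *m Jz).
  by have [/DG[Jz h]|nV] := pselect (V z); [exists Jz|exists 0].
have [Jf HJ] := choice JE; have [r r0 Hr] := oV x Vx.
have [s s0 Hs] := strict_diff_derivative_cont r0 (fun z zr => HJ z (Hr z zr)) e0.
exists (Num.min r s) => [|z]; first by rewrite lt_min r0.
rewrite lt_min => /andP[zr zs].
have jac y : V y -> jacobian G y = Jf y.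
  move=> Vy; have [_ dy] := strict_diff_differentiable (HJ y Vy).
  by apply/row_matrixP => i; rewrite !rowE mul_rV_lin1 dy.
rewrite !jac//; last exact: Hr.
apply: le_lt_trans (_ : e < _); last by rewrite ltr_pdivrMr// ltr_pMr// ltr1n.
rewrite [leLHS]/Num.norm/= mx_normrE; apply/bigmax_leP; split=> [|[i j] _]; first exact: ltW.
rewrite !mxE /=; have := Hs z zs (delta_mx 0 i); rewrite -!rowE => h.
have := rV_norm_coord (row i (Jf z) - row i (Jf x)) j; rewrite !mxE => /le_trans; apply.
by apply: le_trans h _; have := norm_scale_delta i (1 : R); rewrite scale1r normr1 => /ler_piMr; apply; exact: ltW.
Qed.
End Topology.

(** * Lipschitz bounds along arcs *)

Section Arcs.
Context (R : realType).

Lemma arc_variation_rcons n (g : R -> 'rV[R]_n) s t :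
  arc_variation g (rcons s t) = arc_variation g s + enorm (g (last 0 s) - g t).
Proof.
rewrite /arc_variation size_rcons big_nat_recr//=; congr (_ + _).
  rewrite !big_nat; apply: eq_bigr => i /andP[_ si].
  rewrite /= -rcons_cons !nth_rcons /= si; case: ltnP => //.
  by move=> /(ltn_trans si); rewrite ltnn.
by rewrite -rcons_cons nth_rcons /= ltnS leqnn nth_rcons ltnn eqxx -(last_nth 1).
Qed.

Lemma arc_variation_ge0 n (g : R -> 'rV[R]_n) s : 0 <= arc_variation g s.
Proof. by apply: sumr_ge0 => i _; exact: enorm_ge0. Qed.

Lemma arc_length_variation n (g : R -> 'rV[R]_n) s :
  itv_partition 0 1 s -> ((arc_variation g s)%:E <= arc_length g)%E.
Proof. by move=> ps; apply: ereal_sup_ubound; exists s. Qed.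

Lemma strict_diff_slope n k (G : 'rV[R]_n -> 'rV[R]_k) (J : 'M[R]_(n, k)) x K e :
  strict_diff G x (fun u => u *m J) -> (forall u, enorm (u *m J) <= K * enorm u) -> 0 < e ->
  exists2 r, 0 < r & forall z, `|z - x| < r -> enorm (G z - G x) <= (K + e) * enorm (z - x).
Proof.
move=> [_ H] bJ e0; have e'0 : 0 < e / k.+1%:R by rewrite divr_gt0.
have [r r0 Hr] := H _ e'0; exists r => // z zr.
have := Hr x z; rewrite subrr normr0 => /(_ r0 zr) h.
rewrite -[G z - G x](subrK ((z - x) *m J)); apply: le_trans (enormD _ _) _.
rewrite addrC mulrDl; apply: lerD (bJ _) _.
apply: le_trans (enorm_le_norm _) _; apply: le_trans (ler_wpM2l (ler0n _ _) h) _.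
apply: le_trans (_ : k.+1%:R * (e / k.+1%:R * `|z - x|) <= _).
  by rewrite ler_wpM2r ?ler_nat// mulr_ge0// ltW.
by rewrite mulrA [_ * (_ / _)]mulrC divfK// ler_wpM2l ?(ltW e0)// rV_norm_enorm.
Qed.

(** Real induction builds the partition. The local estimate is centred at one point of the arc only,
    but in each step one of the two consecutive points is such a centre. *)
Lemma lipschitz_along_arc n k (G : 'rV[R]_n -> 'rV[R]_k) (g : R -> 'rV[R]_n) K :
  {within `[0, 1], continuous g} ->
  (forall t, 0 <= t <= 1 -> exists2 r, 0 < r & forall z, `|z - g t| < r ->
    enorm (G z - G (g t)) <= K * enorm (z - g t)) ->
  exists s, itv_partition 0 1 s /\ enorm (G (g 0) - G (g 1)) <= K * arc_variation g s.
Proof.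
move=> cg HG.
pose P t := exists s : seq R, (path <%O 0 s /\ last 0 s = t) /\
  enorm (G (g 0) - G (g t)) <= K * arc_variation g s.
have near t : 0 <= t -> t <= 1 -> exists2 r, 0 < r & forall s, 0 <= s -> s <= 1 -> `|s - t| < r ->
    enorm (G (g s) - G (g t)) <= K * enorm (g s - g t).
  move=> t0 t1; have tt : 0 <= t <= 1 by rewrite t0.
  have [r r0 Hr] := HG t tt; have Tt : `[0, 1]%classic t by rewrite /= in_itv/=.
  have [q q0 Hq] := within_continuous_dist cg Tt r0.
  exists q => // s s0 s1 st; apply: Hr; apply: Hq => //.
  by rewrite /= in_itv/= s0.
have step t s : 0 <= t -> t < s -> enorm (G (g t) - G (g s)) <= K * enorm (g t - g s) -> P t -> P s.
  move=> t0 ts h [p [[pp lp] hp]]; exists (rcons p s); split.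
    by rewrite rcons_path last_rcons lp pp ts.
  rewrite arc_variation_rcons lp mulrDr -(subrKA (G (g t))).
  by apply: le_trans (enormD _ _) _; exact: lerD.
suff [s [[ps ls] h]] : P 1 by exists s; split=> //; split=> //; rewrite ls.
apply: (@real_induction R P 0 1) => //.
- exists [::]; split=> //; rewrite subrr enorm0 /arc_variation /= big_nil mulr0 //.
- move=> t t0 t1 Pt; have [r r0 Hr] := near t t0 (ltW t1).
  exists (Num.min r (1 - t)) => [|s ts]; first by rewrite lt_min r0 subr_gt0.
  rewrite -ltrBlDl lt_min => /andP[sr s1]; apply: step Pt => //.
  rewrite [leLHS]enormB [enorm (g t - _)]enormB; apply: Hr.
  + by rewrite ltW// (le_lt_trans t0).
  + by move: s1; rewrite ltrD2r => /ltW.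
  + by rewrite gtr0_norm// subr_gt0.
- move=> t t0 t1 H; have [r r0 Hr] := near t (ltW t0) t1.
  pose s := Num.max 0 (t - r / 2).
  have s0 : 0 <= s by rewrite le_max lexx.
  have st : s < t by rewrite gt_max t0 ltrBlDr ltrDl divr_gt0.
  have ts : t - r / 2 <= s by rewrite le_max lexx orbT.
  apply: (step s) => //; last exact: H.
  apply: Hr => //; first by rewrite ltW// (lt_le_trans st).
  by rewrite distrC gtr0_norm ?subr_gt0//; lra.
Qed.
End Arcs.

(** * Inner Lipschitz constants from local bounds *)

Section InnerDistance.
Context (R : realType) (D : set_family R) (omD : o_minimal D).
Notation def := (@def R D _ _).
Notation dfun := (@dfun R D _ _ _ _).

Lemma inner_dist_ge0 n (A : set 'rV[R]_n) x y : (0 <= inner_dist D A x y)%E.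
Proof.
rewrite /inner_dist; case: ifP => // _; apply: le_ereal_inf_tmp => _ [g _ <-].
apply: le_trans (arc_length_variation g (itv_partition1 (@ltr01 R))).
by rewrite lee_fin arc_variation_ge0.
Qed.

Lemma inner_lipschitz_local n k (A : set 'rV[R]_n) (G : 'rV[R]_n -> 'rV[R]_k) K : 0 < K ->
  (forall x, A x -> exists2 r, 0 < r & forall z, `|z - x| < r -> enorm (G z - G x) <= K * enorm (z - x)) ->
  inner_lipschitz_on D A A G K.
Proof.
move=> K0 HG x y Ax Ay; rewrite /inner_dist; case: ifP => // _ _.
rewrite -lee_pdivrMl//; apply: le_ereal_inf_tmp => _ [g [cg _ Ag <- <-] <-].
have [s [ps h]] := lipschitz_along_arc cg (fun t tt => HG _ (Ag t tt)).
apply: le_trans (arc_length_variation g ps).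
by rewrite -EFinM lee_fin mulrC ler_pdivrMr// mulrC.
Qed.

Lemma inner_lipschitz_on_mono n k (A B : set 'rV[R]_n) (f f' : 'rV[R]_n -> 'rV[R]_k) C C' :
  (forall x, B x -> f x = f' x) -> C <= C' ->
  inner_lipschitz_on D A B f C -> inner_lipschitz_on D A B f' C'.
Proof.
move=> ff CC H x y Bx By d; rewrite -!ff//; apply: le_trans (H x y Bx By d) _.
by apply: lee_wpmul2r; rewrite ?inner_dist_ge0// lee_fin.
Qed.

Lemma definable_fun_dfun n (A : set 'rV[R]_n) (e : 'rV[R]_n -> R) : def A ->
  definable_fun D A e -> exists e0 : 'rV[R]_n -> R, dfun e0 /\ forall x, A x -> e0 x = e x.
Proof.
move=> dA /(definable_map_dfun omD dA)[e0 [de0 He0]]; exists (fun x => e0 x 0 0); split; first by deft.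
by move=> x /He0 ->; rewrite mxE.
Qed.
End InnerDistance.

Theorem theorem4p3 (R : realType) (D : set_family R)
    (omD : o_minimal D) (pbD : polynomially_bounded D)
    (n k : nat) (A : set 'rV[R]_n)
    (lcA : locally_closed A) (defA : D n A)
    (f : 'rV[R]_n -> 'rV[R]_k)
    (deff : definable_map D A f) (lipf : inner_lipschitz D A f)
    (eps : 'rV[R]_n -> R)
    (eps_gt0 : forall x, A x -> 0 < eps x)
    (eps_cont : {within A, continuous eps})
    (defeps : definable_fun D A eps)
    (mu : R) (mu_gt0 : 0 < mu) :
  exists g G : 'rV[R]_n -> 'rV[R]_k,
    [/\ definable_map D A g,
        inner_lipschitz D A g,
        C1_extension A g G
      & forall x, A x ->
          enorm (f x - g x) < eps x /\
          ((diff_norm G x)%:E <= local_inner_lip D A f x + mu%:E)%E].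
Proof.
have dA : def D A by [].
have [f0 [df0 ff0]] := definable_map_dfun omD dA deff.
have [eps0 [deps0 Heps0]] := definable_fun_dfun omD dA defeps.
(* A Lipschitz constant in [inner_lipschitz] may be negative, a slope bound may not. *)
have [C HC] := lipf; pose C0 := Num.max C 0.
have C00 : 0 <= C0 by rewrite le_max lexx orbT.
have slope x c r : A x -> 0 <= c -> 0 < r -> inner_lipschitz_on D A (eball x r `&` A) f c -> slope_le A f0 x c.
  move=> Ax c0 r0 h; apply: (slope_le_inner omD dA df0 Ax c0 r0).
  by apply: inner_lipschitz_on_mono h => // y [_ Ay]; rewrite ff0.
have slA x : A x -> slope_le A f0 x C0.
  move=> Ax; apply: (slope x C0 1) => // y z [_ Ay] [_ Az]; apply: inner_lipschitz_on_mono HC y z Ay Az => //.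
  by rewrite le_max lexx.
have Aamb x : A x -> ambient A x := locally_closed_ambient lcA.
have [ft [dft ft_eq ft_cont]] := continuous_extension omD dA df0 slA Aamb.
(* The value 1 off A makes [e] locally positive also at ambient points off A, which have a
   neighbourhood disjoint from A. *)
pose e x := if `[< A x >] then eps0 x else 1.
have de : dfun D e by apply: dfun_if => //; exact: dfun_cst.
have ep x : ambient A x -> ~ set0 x -> locally_positive e x.
  move=> ambx _; have [Ax|nA] := pselect (A x).
    have h := within_continuous_lbound eps_cont Ax (eps_gt0 x Ax).
    exists (Num.min (eps x / 2) 1); first by rewrite lt_min divr_gt0 ?eps_gt0/=.
    apply: near_all_mono h _ => y hy; rewrite /e ge_min; case: asboolP => [Ay|_].
      by rewrite (Heps0 _ Ay) hy.
    by rewrite lexx orbT.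
  have [r r0 Hr] : near_all x (fun y => ~ A y).
    apply: contrapT => nr; apply: nA; apply: (near_all_self ambx) => r r0.
    apply: contrapT => ny; apply: nr; exists r => // y yr Ay; apply: ny; exists y => //.
  by exists 1 => //; exists r => // y /Hr nAy; rewrite /e; case: asboolP.
have [V [G [[dV dG oV AV] [_ DG eG bG]]]] :=
  approximable_off_empty omD dA dft df0 slA Aamb ft_eq ft_cont mu_gt0 de ep.
have {}AV x : A x -> V x by move=> Ax; apply: AV.
have [opV C1V] := strict_diff_C1 oV DG.
(* The approximation lives on a neighbourhood of A and is its own extension. *)
exists G, G; split.
- exact: dfun_definable_map.
- exists (C0 + mu + 1); apply: inner_lipschitz_local => [|x Ax].
    by rewrite ltr_pwDr// addr_ge0// ltW.
  have [J [DJ bJ]] := bG x (AV x Ax) Ax.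
  exact: strict_diff_slope DJ (bJ _ (slA x Ax)) ltr01.
- by exists V.
move=> x Ax; split.
  have := eG x (AV x Ax); rewrite /e; case: asboolP => // _.
  by rewrite (Heps0 _ Ax) (ft_eq _ Ax) (ff0 _ Ax) enormB.
have [J [DJ bJ]] := bG x (AV x Ax) Ax.
(* The local constant is an infimum of admissible [c], and each of these bounds the slope at x; so
   it suffices to bound the norm by every c + mu. *)
rewrite -leeBlDr// -EFinB; apply: le_ereal_inf_tmp => _ [c [c0 [r r0 Hr]] <-].
rewrite lee_fin lerBlDr /diff_norm; have [_ dE] := strict_diff_differentiable DJ.
have sc := slope x c r Ax c0 r0 Hr.
have ub : ubound [set enorm ('d G x u) | u in [set u : 'rV[R]_n | enorm u = 1]] (c + mu).
  by move=> _ [u /= u1 <-]; rewrite dE; apply: le_trans (bJ c sc u) _; rewrite u1 mulr1.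
(* The unit sphere is empty for n = 0, where [ge_sup] does not apply. *)
have [->|/set0P ne] := eqVneq [set enorm ('d G x u) | u in [set u : 'rV[R]_n | enorm u = 1]] set0.
  by rewrite sup0 addr_ge0// ltW.
exact: ge_sup.
Qed.
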